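(* Assume (H1)--(H3) (stated in the context) and let $\boldsymbol U_0=(U_0^1,\dots,U_0^N)\in ((L^1\cap BV)(\mathbb R))^N$ be non-negative initial data. Let $\boldsymbol U_\Delta$ be the finite volume approximations described in the context, with either the Lax--Friedrichs type or the Godunov type flux, under the corresponding CFL condition. Then there exist constants $\mathcal K_3,\dots,\mathcal K_6$, independent of the mesh size $\Delta x$, such that, for $0<t\le T$, the following hold. (1) Positivity: $\boldsymbol U_\Delta(t,x)\ge 0$ (componentwise). (2) $L^1$ estimate: $\|\boldsymbol U_\Delta(t)\|_{(L^1(\mathbb R))^N}=\|\boldsymbol U_0\|_{(L^1(\mathbb R))^N}$. (3) $L^\infty$ estimate: $\|\overline{\boldsymbol U}_\Delta(t)\|_{(L^\infty(\mathbb R))^N}\le \exp(\mathcal K_3 t)\,\|\overline{\boldsymbol U}_\Delta(0)\|_{(L^\infty(\mathbb R))^N}$, and furthermore $$\|\boldsymbol U_\Delta(t)\|_{(L^\infty(\mathbb R))^N}\le \frac{\|\boldsymbol\sigma\|_{(L^\infty(\mathbb R))^N}}{\min_{1\le k\le N}\inf_{x\in\mathbb R}\sigma^k(x)}\exp(\mathcal K_3 t)\,\|\boldsymbol U_0\|_{(L^\infty(\mathbb R))^N}.$$ (4) BV estimate: for each $n\in\{0,\dots,N_T\}$ and $k\in\{1,\dots,N\}$, $$\sum_{i\in\mathbb Z}|\overline U^{k,n}_{i+1}-\overline U^{k,n}_i|\le \exp(\mathcal K_4 t^n)\Big(\sum_{i\in\mathbb Z}|\overline U^{k,0}_{i+1}-\overline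 U^{k,0}_i|+\mathcal K_5 t^n\Big).$$ (5) Time estimate: for each $n\in\{0,\dots,N_T-1\}$ and $k\in\{1,\dots,N\}$, $$\Delta x\sum_{i\in\mathbb Z}|U_i^{k,n+1}-U_i^{k,n}|\le \mathcal K_6\,\Delta t.$$ (6) Discrete entropy inequality: for each $n\in\{0,\dots,N_T-1\}$, $i\in\mathbb Z$, $k\in\{1,\dots,N\}$ and all $\alpha\in\mathbb R$, $$\Big|U_i^{k,n+1}-\frac{\alpha}{\sigma_i^k}\Big|-\Big|U_i^{k,n}-\frac{\alpha}{\sigma_i^k}\Big|+\lambda\Big(G^{k,n}_{i+1/2}(U_i^{k,n},U_{i+1}^{k,n},\alpha)-G^{k,n}_{i-1/2}(U_{i-1}^{k,n},U_i^{k,n},\alpha)\Big)$$ $$+\lambda\,\operatorname{sgn}\Big(U_i^{k,n+1}-\frac{\alpha}{\sigma_i^k}\Big)f^k(\alpha)\Big(\nu^k(\boldsymbol c^{k,n}_{i+1/2})-\nu^k(\boldsymbol c^{k,n}_{i-1/2})\Big)\le 0,$$ where, with $u\vee v=\max(u,v)$ and $u\wedge v=\min(u,v)$, $$G^{k,n}_{i+1/2}(p,q,\alpha):=F^{k,n}_{i+1/2}\Big(\sigma_i^k\big(p\vee \tfrac{\alpha}{\sigma_i^k}\big),\sigma_{i+1}^k\big(q\vee\tfrac{\alpha}{\sigma_{i+1}^k}\big)\Big)-F^{k,n}_{i+1/2}\Big(\sigma_i^k\big(p\wedge \tfrac{\alpha}{\sigma_i^k}\big),\sigma_{i+1}^k\big(q\wedge\tfrac{\alpha}{\sigma_{i+1}^k}\big)\Big).$$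 (7) Up to a subsequence (as $\Delta x\to0$), the approximations $\boldsymbol U_\Delta$ converge (in $(L^1_{\rm loc}(\overline Q_T))^N$ and pointwise a.e.) to an entropy solution $\boldsymbol U\in (C([0,T];L^1(\mathbb R))\cap L^\infty([0,T];BV(\mathbb R)))^N$ of the initial-value problem with initial data $\boldsymbol U_0$.
   Context: Problem. Fix $N\ge1$, $T>0$, $Q_T=(0,T)\times\mathbb R$, $\overline Q_T=[0,T]\times\mathbb R$. The initial-value problem (IVP) for $\boldsymbol U=(U^1,\dots,U^N)$ is, for $k=1,\dots,N$, $$\partial_tU^k+\partial_x\big(f^k(\sigma^k(x)U^k)\,\nu^k((\boldsymbol\mu*\boldsymbol U)^k)\big)=0\ \text{ in }Q_T,\qquad U^k(0,x)=U_0^k(x),$$ where $\boldsymbol\mu=(\mu^{k,j})_{k,j=1}^N$, $(\boldsymbol\mu*\boldsymbol U)^k:=(\mu^{k,1}*U^1,\dots,\mu^{k,N}*U^N)$, and $*$ is convolution in space only. Standing assumptions, for all $k$: (H1) $f^k:\mathbb R\to\mathbb R$ is Lipschitz, $f^k(0)=0$. (H2) $\nu^k\in(C^2\cap BV\cap W^{2,\infty})(\mathbb R^N,\mathbb R)$, $\nu^k(\boldsymbol 0)=0$, $\boldsymbol\mu\in(C^2\cap BV\cap W^{2,\infty})(\mathbb R,\mathbb R^{N^2})$. (H3) $\sigma^k\in BV(\mathbb R)$ with $\inf_{x\in\mathbb R}\sigma^k(x)>0$. In (H2) and (H3), $BV$ means finite total variation; pointwise values of $\sigma^k$ are those of its right-continuous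 representative. Norms: $\|\boldsymbol z\|=\sum_k|z^k|$ on $\mathbb R^N$; $\|\boldsymbol f\|_{(L^1(\mathbb R))^N}=\sum_k\|f^k\|_{L^1(\mathbb R)}$; $\|\boldsymbol f\|_{(L^\infty(\mathbb R))^N}=\max_k\|f^k\|_{L^\infty(\mathbb R)}$; $|f|_{\mathrm{Lip}(\mathbb R)}$ is the Lipschitz constant. Entropy solution. Write $\overline U^k(t,x)=\sigma^k(x)U^k(t,x)$. A function $\boldsymbol U\in(C([0,T];L^1(\mathbb R))\cap L^\infty([0,T];BV(\mathbb R)))^N$ is an entropy solution of the IVP if for all $k$, all $\alpha\in\mathbb R$ and all non-negative $\phi\in C_c^\infty([0,T)\times\mathbb R)$, $$\int_{Q_T}\Big|U^k-\frac{\alpha}{\sigma^k(x)}\Big|\phi_t\,dx\,dt+\int_{Q_T}\operatorname{sgn}(\overline U^k-\alpha)\,\nu^k((\boldsymbol\mu*\boldsymbol U)^k)(f^k(\overline U^k)-f^k(\alpha))\phi_x\,dx\,dt$$ $$-\int_{Q_T}f^k(\alpha)\operatorname{sgn}(\overline U^k-\alpha)\,\partial_x\nu^k((\boldsymbol\mu*\boldsymbol U)^k)\,\phi\,dx\,dt+\int_{\mathbb R}\Big|U_0^k(x)-\frac{\alpha}{\sigma^k(x)}\Big|\phi(0,x)\,dx\ge0.$$ Scheme. Let $\Delta x,\Delta t>0$, $\lambda=\Delta t/\Delta x$ (kept fixed as the mesh is refined), $x_i=i\Delta x$ ($i\in\mathbb Z$), $x_{i+1/2}=\frac12(x_i+x_{i+1})$,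 $C_i=[x_{i-1/2},x_{i+1/2})$, $t^n=n\Delta t$, $n=0,\dots,N_T$, $T=N_T\Delta t$, $C^n=[t^n,t^{n+1})$, $C_i^n=C^n\times C_i$. Put $U_i^{k,0}=\frac1{\Delta x}\int_{C_i}U_0^k\,dx$, $\sigma_i^k=\sigma^k(x_i)$, $\overline U_i^{k,n}=\sigma_i^kU_i^{k,n}$, and let $U_\Delta^k=U_i^{k,n}$, $\overline U^k_\Delta=\overline U_i^{k,n}$ on $C_i^n$; $\boldsymbol U_\Delta=(U_\Delta^1,\dots,U_\Delta^N)$, $\overline{\boldsymbol U}_\Delta=(\overline U_\Delta^1,\dots,\overline U_\Delta^N)$. The update is $$U_i^{k,n+1}=U_i^{k,n}-\lambda\big[F^{k,n}_{i+1/2}(\overline U_i^{k,n},\overline U_{i+1}^{k,n})-F^{k,n}_{i-1/2}(\overline U_{i-1}^{k,n},\overline U_i^{k,n})\big],\qquad F^{k,n}_{i+1/2}(b,c):=F^k(\nu^k(\boldsymbol c^{k,n}_{i+1/2}),b,c),$$ where $\boldsymbol c^{k,n}_{i+1/2}=(c^{1,k,n}_{i+1/2},\dots,c^{N,k,n}_{i+1/2})$, $c^{j,k,n}_{i+1/2}=\Delta x\sum_{p\in\mathbb Z}\mu^{k,j}(x_{i+1/2-p})\,U^{j,n}_{p+1/2}$, and $U^{j,n}_{p+1/2}=\kappa U^{j,n}_p+(1-\kappa)U^{j,n}_{p+1}$ with a fixed $\kappa\in[0,1]$. The flux $F^k$ is required to be such that the right-hand side of the update, as a function $H^k(\nu^k(\boldsymbol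 c^{k,n}_{i-1/2}),\nu^k(\boldsymbol c^{k,n}_{i+1/2}),\overline U_{i-1}^{k,n},\overline U_i^{k,n},\overline U_{i+1}^{k,n})$, is increasing (nondecreasing) in its last three arguments. It is one of: (a) Lax--Friedrichs type: $F^k(a,b,c)=\frac a2(f^k(b)+f^k(c))-\frac{\theta}{2\lambda}(c-b)$, with $\theta\in(0,\frac{2}{3\|\sigma^k\|_{L^\infty}})$ for all $k$, under the CFL condition $$\lambda\le\min_k\frac{\min(1,\,4-6\theta\|\sigma^k\|_{L^\infty},\,6\theta\|\sigma^k\|_{L^\infty})}{1+6\|\sigma^k\|_{L^\infty}|f^k|_{\mathrm{Lip}(\mathbb R)}\|\nu^k\|_{L^\infty}}.$$ (b) Godunov type: $F^k(a,b,c)=a\,F^k_{\rm God}(b,c)$, where $F^k_{\rm God}$ is the Godunov flux for the local conservation law with flux $f^k(\sigma^k(x)u)$, expressed in the variables $\overline u=\sigma^ku$: $F^k_{\rm God}(b,c)=\min_{[b,c]}f^k$ if $b\le c$ and $\max_{[c,b]}f^k$ if $b>c$; under the CFL condition $\lambda\max_k\{\|\sigma^k\|_{L^\infty}|f^k|_{\mathrm{Lip}(\mathbb R)}\|\nu^k\|_{L^\infty}\}\le\frac16$. *)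

(* Defs.v *)
From HB Require Import structures.
From mathcomp Require Import all_boot all_order all_algebra.
From mathcomp Require Import all_classical all_reals all_analysis.
Set Implicit Arguments.
Unset Strict Implicit.
Unset Printing Implicit Defensive.
Import Order.TTheory GRing.Theory Num.Theory.
Import numFieldNormedType.Exports.
Local Open Scope classical_set_scope.
Local Open Scope ring_scope.

Section Regularity.
Context {R : realType}.

(* On a finite-dimensional space this is the usual C^k: all iterated
   directional (equivalently, partial) derivatives exist and are continuous. *)
Fixpoint Ck (V : normedModType R) (m : nat) (g : V -> R) : Prop :=
  continuous g /\
  if m is m'.+1 then
    forall v : V, (forall x, derivable g x v) /\ Ck m' ('D_v g)
  else True.

Definition smooth (V : normedModType R) (g : V -> R) := forall m, Ck m g.

(* W^{m,oo}, to be used only together with [Ck m]: weak derivatives are then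
   the classical ones, and the essential supremum of a continuous function is
   its supremum. *)
Fixpoint Wkoo (V : normedModType R) (m : nat) (g : V -> R) : Prop :=
  [bounded g x | x in [set: V]] /\
  if m is m'.+1 then forall v : V, Wkoo m' ('D_v g) else True.

Definition compactly_supported_in (V : topologicalType) (D : set V)
    (g : V -> R) :=
  exists K : set V, [/\ compact K, K `<=` D & forall x, ~ K x -> g x = 0].

(* Pointwise total variation over the whole line. *)
Definition TV (g : R -> R) : \bar R :=
  ereal_sup [set total_variation ab.1 ab.2 g | ab in [set ab : R * R | ab.1 <= ab.2]].

(* Total variation of an a.e.-class: infimum over its representatives. *)
Definition ess_TV (g : R -> R) : \bar R :=
  ereal_inf [set TV h | h in [set h : R -> R |
    {ae (@lebesgue_measure R), forall x, h x = g x}]].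

(* Integral over R^n as an iterated integral; it is applied below only to
   continuous compactly supported integrands, where it is the Lebesgue
   integral. *)
Fixpoint iterated_integral (n : nat) : ('rV[R]_n -> R) -> R :=
  match n with
  | 0%N => fun g => g 0
  | m.+1 => fun g =>
      \int[@lebesgue_measure R]_x
        iterated_integral (fun z : 'rV[R]_m => g (row_mx (x%:M : 'rV[R]_1) z))
  end.

(* Variation of a continuous function of n variables:
   sup { \int g div phi | phi in C_c^1(R^n, R^n), |phi| <= 1 }. *)
Definition TVn (n : nat) (g : 'rV[R]_n -> R) : \bar R :=
  ereal_sup [set (iterated_integral (fun z =>
      g z * \sum_(j < n) 'D_(delta_mx 0 j) (phi j) z))%:E |
    phi in [set phi : 'I_n -> 'rV[R]_n -> R |
      [/\ forall j, Ck 1 (phi j),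
          forall j, compactly_supported_in setT (phi j)
        & forall z, \sum_(j < n) phi j z ^+ 2 <= 1]]].

Definition Lip (g : R -> R) : R :=
  sup [set `|g xy.1 - g xy.2| / `|xy.1 - xy.2| |
    xy in [set xy : R * R | xy.1 != xy.2]].

Definition sup_norm (V : Type) (g : V -> R) : R := sup (range (fun x => `|g x|)).

Definition Loo_norm (g : R -> R) : \bar R :=
  'N[@lebesgue_measure R]_(+oo)[EFin \o g]%E.

Definition L1_norm (g : R -> R) : \bar R :=
  'N[@lebesgue_measure R]_(1)[EFin \o g]%E.

Definition Loo_norms (N : nat) (g : 'I_N -> R -> R) : \bar R :=
  \big[maxe/0%E]_(k < N) Loo_norm (g k).

Definition L1_norms (N : nat) (g : 'I_N -> R -> R) : \bar R :=
  (\sum_(k < N) L1_norm (g k))%E.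

Definition L1_BV (g : R -> R) :=
  (@lebesgue_measure R).-integrable setT (EFin \o g) /\ (ess_TV g < +oo)%E.

(* Sum of an absolutely summable family indexed by Z. *)
Definition zsum (a : int -> R) : R :=
  fine (\esum_(p in [set: int]) ((EFin \o a)^\+ p)
        - \esum_(p in [set: int]) ((EFin \o a)^\- p))%E.

Definition l1Z (a : int -> R) : \bar R := \esum_(i in [set: int]) `|a i|%:E.

Definition zTV (a : int -> R) : \bar R := l1Z (fun i => a (i + 1) - a i).

Definition convol (m u : R -> R) (x : R) : R :=
  \int[@lebesgue_measure R]_y (m (x - y) * u y).

End Regularity.

Record ivp (R : realType) (N : nat) := IVP {
  flux : 'I_N -> R -> R;
  nu : 'I_N -> 'rV[R]_N -> R;
  mu : 'I_N -> 'I_N -> R -> R;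
  sigma : 'I_N -> R -> R;
  U0 : 'I_N -> R -> R
}.

Section Continuous_problem.
Context {R : realType} {N : nat}.
Implicit Types (P : ivp R N) (U : 'I_N -> R -> R -> R) (T : R).

Definition H1 P := forall k, lipschitz (flux P k) /\ flux P k 0 = 0.

Definition H2 P := forall k,
  [/\ Ck 2 (nu P k), Wkoo 2 (nu P k), (TVn (nu P k) < +oo)%E, nu P k 0 = 0
    & forall j, [/\ Ck 2 (mu P k j), Wkoo 2 (mu P k j)
                  & (TV (mu P k j) < +oo)%E]].

(* sigma is the right-continuous representative of its class. *)
Definition H3 P := forall k,
  [/\ (TV (sigma P k) < +oo)%E,
      forall x, sigma P k y @[y --> x^'+] --> sigma P k x
    & 0 < inf (range (sigma P k))].

Definition nonneg_initial_data P := forall k,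
  L1_BV (U0 P k) /\ {ae (@lebesgue_measure R), forall x, 0 <= U0 P k x}.

Definition leb2 := ((@lebesgue_measure R) \x (@lebesgue_measure R))%E.

Definition QT T : set (R * R) := `]0, T[ `*` setT.
Definition QTbar T : set (R * R) := `[0, T] `*` setT.

(* (C([0,T]; L^1(R)) /\ L^oo([0,T]; BV(R)))^N. *)
Definition solution_space T U := forall k,
  [/\ measurable_fun (QTbar T) (fun z => U k z.1 z.2),
      forall t, t \in `[0, T] ->
        (@lebesgue_measure R).-integrable setT (EFin \o U k t),
      forall t, t \in `[0, T] ->
        L1_norm (fun x => U k s x - U k t x) @[s --> within `[0, T] (nbhs t)]
          --> 0%E
    & exists M : R, {ae (@lebesgue_measure R), forall t, t \in `[0, T] ->
        (L1_norm (U k t) + ess_TV (U k t) <= M%:E)%E}].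

(* nu^k((mu * U)^k)(t, x) *)
Definition nonlocal P U k t x : R :=
  nu P k (\row_(j < N) convol (mu P k j) (U j t) x).

Definition sg_alpha P U k alpha (z : R * R) : R :=
  Num.sg (sigma P k z.2 * U k z.1 z.2 - alpha).

(* Test functions in C_c^oo([0,T) x R) are taken as restrictions to t >= 0 of
   functions in C_c^oo(]-oo,T) x R). *)
Definition entropy_solution P T U :=
  solution_space T U /\
  forall k (alpha : R) (phi : R * R -> R),
    smooth phi ->
    compactly_supported_in (`]-oo, T[ `*` setT) phi ->
    (forall t x, 0 <= t -> 0 <= phi (t, x)) ->
    0 <=
      \int[leb2]_(z in QT T)
        (`|U k z.1 z.2 - alpha / sigma P k z.2| * 'D_((1, 0) : R * R) phi z)
    + \int[leb2]_(z in QT T)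
        (sg_alpha P U k alpha z * nonlocal P U k z.1 z.2
         * (flux P k (sigma P k z.2 * U k z.1 z.2) - flux P k alpha)
         * 'D_((0, 1) : R * R) phi z)
    - \int[leb2]_(z in QT T)
        (flux P k alpha * sg_alpha P U k alpha z
         * derive1 (nonlocal P U k z.1) z.2 * phi z)
    + \int[@lebesgue_measure R]_x
        (`|U0 P k x - alpha / sigma P k x| * phi (0, x)).

End Continuous_problem.

Inductive flux_type (R : realType) := LaxFriedrichs of R | Godunov.
Arguments Godunov {R}.

(* In this section the mesh index i of [xhalf], [cvec], [vel], [Fhalf] and
   [entropy_flux] stands for i + 1/2. *)
Section Scheme.
Context {R : realType} {N : nat}.
Variables (P : ivp R N) (sch : flux_type R) (lambda kappa : R).

Definition godunov (g : R -> R) (b c : R) : R :=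
  if b <= c then inf (g @` `[b, c]) else sup (g @` `[c, b]).

Definition numerical_flux (k : 'I_N) (a b c : R) : R :=
  match sch with
  | LaxFriedrichs theta =>
      a / 2 * (flux P k b + flux P k c) - theta / (2 * lambda) * (c - b)
  | Godunov => a * godunov (flux P k) b c
  end.

Definition sigma_norm (k : 'I_N) : R := fine (Loo_norm (sigma P k)).

Definition CFL : Prop :=
  match sch with
  | LaxFriedrichs theta => forall k,
      0 < theta < 2 / (3 * sigma_norm k) /\
      lambda <= Num.min 1 (Num.min (4 - 6 * theta * sigma_norm k)
                                   (6 * theta * sigma_norm k))
                / (1 + 6 * sigma_norm k * Lip (flux P k) * sup_norm (nu P k))
  | Godunov => forall k,
      lambda * (sigma_norm k * Lip (flux P k) * sup_norm (nu P k)) <= 1 / 6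
  end.

Variable dx : R.

Definition dt : R := lambda * dx.
Definition xgrid (i : int) : R := i%:~R * dx.
Definition xhalf (i : int) : R := (xgrid i + xgrid (i + 1)) / 2.
Definition cell (i : int) : set R := `[xhalf (i - 1), xhalf i[.
Definition sigma_ (k : 'I_N) (i : int) : R := sigma P k (xgrid i).

Implicit Type u : 'I_N -> int -> R.

Definition bar u (k : 'I_N) (i : int) : R := sigma_ k i * u k i.

Definition edge (a : int -> R) (p : int) : R :=
  kappa * a p + (1 - kappa) * a (p + 1).

Definition cvec u (k : 'I_N) (i : int) : 'rV[R]_N :=
  \row_(j < N) (dx * zsum (fun p => mu P k j (xhalf (i - p)) * edge (u j) p)).

Definition vel u (k : 'I_N) (i : int) : R := nu P k (cvec u k i).

Definition Fhalf u (k : 'I_N) (i : int) (b c : R) : R :=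
  numerical_flux k (vel u k i) b c.

Definition step u (k : 'I_N) (i : int) : R :=
  u k i - lambda * (Fhalf u k i (bar u k i) (bar u k (i + 1))
                    - Fhalf u k (i - 1) (bar u k (i - 1)) (bar u k i)).

Definition initial (k : 'I_N) (i : int) : R :=
  (\int[@lebesgue_measure R]_(x in cell i) U0 P k x) / dx.

Definition Un (n : nat) : 'I_N -> int -> R := iter n step initial.

(* Right-hand side of the update in terms of the velocities am, ap at
   i - 1/2, i + 1/2 and of the values of bar U at i - 1, i, i + 1. *)
Definition Hfun (k : 'I_N) (i : int) (am ap bm b bp : R) : R :=
  b / sigma_ k i - lambda * (numerical_flux k ap b bp - numerical_flux k am bm b).

Definition monotone_update (NT : nat) : Prop :=
  forall (n : nat) (k : 'I_N) (i : int), (n < NT)%N ->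
  forall bm b bp bm' b' bp' : R, bm <= bm' -> b <= b' -> bp <= bp' ->
    Hfun k i (vel (Un n) k (i - 1)) (vel (Un n) k i) bm b bp
    <= Hfun k i (vel (Un n) k (i - 1)) (vel (Un n) k i) bm' b' bp'.

Definition mesh (T : R) (NT : nat) : Prop :=
  [/\ 0 < dx, T = NT%:R * dt & monotone_update NT].

Definition tindex (t : R) : nat := Num.truncn (t / dt).
(* the i such that x lies in [cell i] *)
Definition xindex (x : R) : int := Num.floor (x / dx + 1 / 2).

Definition Udelta (k : 'I_N) (t x : R) : R := Un (tindex t) k (xindex x).
Definition Ubardelta (k : 'I_N) (t x : R) : R :=
  bar (Un (tindex t)) k (xindex x).

Definition entropy_flux u (k : 'I_N) (i : int) (p q alpha : R) : R :=
  Fhalf u k i (sigma_ k i * Num.max p (alpha / sigma_ k i))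
              (sigma_ k (i + 1) * Num.max q (alpha / sigma_ k (i + 1)))
  - Fhalf u k i (sigma_ k i * Num.min p (alpha / sigma_ k i))
                (sigma_ k (i + 1) * Num.min q (alpha / sigma_ k (i + 1))).

End Scheme.

Definition min_sigma {R : realType} {N : nat} (P : ivp R N) : R :=
  fine (\big[mine/+oo%E]_(k < N) (inf (range (sigma P k)))%:E).

(* Main.v *)
Require Import Defs.
From mathcomp Require Import all_boot all_order all_algebra.
From mathcomp Require Import all_classical all_reals all_analysis.
From mathcomp Require Import measurable_realfun ess_sup_inf.
From mathcomp Require Import zify ring lra.
Import Order.TTheory GRing.Theory Num.Theory.
Import numFieldNormedType.Exports.
Local Open Scope classical_set_scope.
Local Open Scope ring_scope.
Set Implicit Arguments.
Unset Strict Implicit.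
Unset Printing Implicit Defensive.

(** The scheme is monotone and conservative up to the variation of the nonlocal
velocity. The discrete velocity is [nu] at a discrete convolution, so its first
and second differences are of order [dx] and [dx ^+ 2], with constants that
depend on the mass only ([vel_diff1], [vel_diff2]); and the mass is conserved,
because monotonicity keeps the state nonnegative ([step_ge0], [step_mass]). All
bounds follow from one-step estimates and the discrete Gronwall lemma. For the
supremum of [bar U], the state is compared with a constant one ([step_sup]). For
its total variation the scheme is put into incremental form: under the CFL
condition the jumps are transferred between neighbouring edges with coefficients
between 0 and 1, while the velocity contributes a source that is summable by the
second difference estimate ([l1Z_transfer], [step_TV]). The time estimate is the
sum of the same increments ([step_time]), and the discrete entropy inequality
compares the update with those of the maximum and the minimum of the state and of
the profile [alpha / sigma] ([step_entropy]).

Compactness is needed uniformly in time. The approximations at time [t] have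
bounded variation, are Lipschitz in time in mean up to one time step, and have
uniformly small tails, since mass travels at most one cell per step ([step_cut]). A member
of the family is then determined in mean, uniformly in time, by finitely many
approximate values ([uniform_cluster]), and a free ultrafilter on the indices
decides all these values at once, which yields a subsequence whose distances decay
geometrically ([uniform_subsequence]). The series of the distances converges
almost everywhere, at every time and in space-time, so the limit is jointly
measurable; ultralimits of the approximations, which exist at every point, give a
representative of bounded variation ([space_time_limit_bv]).

The limit is an entropy solution: the discrete entropy inequality is multiplied by
the values of a test function and summed by parts, after the numerical entropy
flux has been replaced by its diagonal value at a cost of order [dx]
([discrete_entropy]). The sums are integrals of mesh functions ([grid_integral])
and converge by dominated convergence, the discrete velocity and its difference
quotient being consistent with the nonlocal velocity and its derivative
([vel_near]). The sign of [sigma * U - alpha] is a continuous function of the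
state only away from the level [alpha]. By Fubini almost every level is taken on a
null set ([ae_null_level]), which settles almost every [alpha]; the others are
limits of such levels from above and from below, whose inequalities are averaged
([entropy_limit]). *)

(** * Absolutely summable families over the integers *)

Section IntSums.
Context {R : realType}.
Implicit Types (a b c u v : int -> R) (A B : R).

Lemma l1Z_ge0 a : (0 <= l1Z a)%E.
Proof. by apply: esum_ge0 => i _; rewrite lee_fin. Qed.

Lemma l1Z_window a (m : nat) (s : int) :
  ((\sum_(p < m) `|a (p%:Z + s)|)%:E <= l1Z a)%E.
Proof.
pose h := fun p : nat => (p%:Z + s : int).
apply: esum_ge; exists (h @` `I_m).
  by split => //; exact: finite_image.
rewrite fsbig_image; last by move=> x y _ _ /addIr [].
by rewrite fsumEFin// -fsbig_ord.
Qed.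

(** Every finite subset of the integers lies in a window centred at zero, so the
sum of the family is the supremum of these finite sums, which are accessible
to induction. *)
Lemma l1Z_le_windows a A :
  (forall n : nat, \sum_(p < n.*2) `|a (p%:Z - n%:Z)| <= A) ->
  (l1Z a <= A%:E)%E.
Proof.
move=> aA; apply: ge_ereal_sup => _ [X [Xfin _] <-].
have [n Xn] : exists n : nat, forall x, X x -> (- n%:Z <= x < n%:Z)%R.
  have /finite_seqP[s Xs] := Xfin.
  exists (\sum_(x <- s) (`|x|%N + 1))%N => x; rewrite Xs /= => xs.
  have : (`|x| + 1 <= \sum_(x <- s) (`|x| + 1))%N.
    by rewrite (big_rem x)//= leq_addr.
  by move: (\sum_(_ <- s) _)%N => S; lia.
apply: (@le_trans _ _ (\sum_(x \in [set (p%:Z - n%:Z)%R | p in `I_(n.*2)])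
   `|a x|%:E)%E).
  apply: lee_fsum_nneg_subset => //.
    exact: finite_image.
  move=> x /set_mem/Xn xn; apply/mem_set => /=.
  by exists (absz (x + n%:Z)) => /=; lia.
rewrite fsbig_image; last by move=> x y _ _ /addIr [].
by rewrite fsumEFin// -fsbig_ord lee_fin.
Qed.

Lemma l1Z_le a b : (forall i, `|a i| <= `|b i|) -> (l1Z a <= l1Z b)%E.
Proof. by move=> ab; apply: le_esum => i _; rewrite lee_fin. Qed.

Lemma l1Z_shift a (s : int) : l1Z (fun i => a (i + s)) = l1Z a.
Proof.
rewrite /l1Z [RHS](reindex_esum [set: int] _ (fun i => i + s))//.
split => //; first by move=> x y _ _ /addIr.
by move=> x _; exists (x - s) => //; rewrite subrK.
Qed.

Lemma l1ZD a b c : (forall i, `|c i| <= `|a i| + `|b i|) ->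
  (l1Z c <= l1Z a + l1Z b)%E.
Proof.
move=> cab; rewrite /l1Z -esumD; try by move=> *; rewrite lee_fin.
by apply: le_esum => i _; rewrite -EFinD lee_fin.
Qed.

Lemma l1ZDE a b c : (forall i, `|c i| = `|a i| + `|b i|) ->
  l1Z c = (l1Z a + l1Z b)%E.
Proof.
move=> cab; rewrite /l1Z -esumD; try by move=> *; rewrite lee_fin.
by apply: eq_esum => i _; rewrite -EFinD cab.
Qed.

Lemma l1Z_leD a b c A B : (forall i, `|c i| <= `|a i| + `|b i|) ->
  (l1Z a <= A%:E)%E -> (l1Z b <= B%:E)%E -> (l1Z c <= (A + B)%:E)%E.
Proof.
by move=> /l1ZD cab aA bB; rewrite EFinD (le_trans cab)// leeD.
Qed.

Lemma l1Z_leM (k : R) a b A : 0 <= k -> (forall i, `|b i| <= k * `|a i|) ->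
  (l1Z a <= A%:E)%E -> (l1Z b <= (k * A)%:E)%E.
Proof.
move=> k0 bka aA; apply: l1Z_le_windows => n.
apply: (@le_trans _ _ (\sum_(p < n.*2) k * `|a (p%:Z - n%:Z)|)).
  exact: ler_sum.
rewrite -mulr_sumr ler_wpM2l// -lee_fin (le_trans _ aA)//.
exact: l1Z_window.
Qed.

Lemma l1Z_fin a A : (l1Z a <= A%:E)%E -> l1Z a \is a fin_num.
Proof.
move=> aA; rewrite ge0_fin_numE ?l1Z_ge0//.
by rewrite (le_lt_trans aA) ?ltry.
Qed.

(** Incremental form of Harten's lemma: mass [p] leaves the cell to the right
neighbour and mass [q] to the left one, so the transfers cancel in the total
and only the source [s] can increase it. *)
Lemma l1Z_transfer (d p q s e : int -> R) V S :
  (forall i, 0 <= p i) -> (forall i, 0 <= q i) ->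
  (forall i, p i + q i <= `|d i|) ->
  (forall i, `|e i| <= (`|d i| - p i - q i) + p (i + 1) + q (i - 1) + `|s i|) ->
  (l1Z d <= V%:E)%E -> (l1Z s <= S%:E)%E -> (l1Z e <= (V + S)%:E)%E.
Proof.
move=> p0 q0 pqd eh dV sS.
pose r (i : int) : R := `|d i| - p i - q i.
have r0 i : 0 <= r i by rewrite /r; have := pqd i; lra.
have dE : l1Z d = (l1Z r + (l1Z p + l1Z q))%E.
  rewrite -(@l1ZDE p q (fun i => p i + q i)); last first.
    by move=> i; rewrite !ger0_norm// addr_ge0.
  apply: l1ZDE => i; rewrite (ger0_norm (r0 i)) [`|_ + _|]ger0_norm ?addr_ge0//.
  by rewrite /r; ring.
have step : (l1Z e <= (l1Z r + (l1Z (fun i => p (i + 1)%R) +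
    l1Z (fun i => q (i - 1)%R))) + l1Z s)%E.
  rewrite -(@l1ZDE _ _ (fun i => p (i + 1) + q (i - 1))); last first.
    by move=> i; rewrite !ger0_norm// addr_ge0.
  rewrite -(@l1ZDE r _ (fun i => r i + (p (i + 1) + q (i - 1)))); last first.
    by move=> i; rewrite !ger0_norm//; do ?[exact: addr_ge0 | apply: addr_ge0 => //].
  apply: l1ZD => i; rewrite [`|_ + (_ + _)|]ger0_norm; last first.
    by rewrite addr_ge0// addr_ge0.
  by apply: le_trans (eh i) _; rewrite lerD2r /r; lra.
rewrite (le_trans step)// (l1Z_shift p) (l1Z_shift q) -dE EFinD.
exact: leeD.
Qed.

(** The positive and negative parts of the fluxes are added to both sides, so
that only sums of nonnegative terms are compared and the telescoping becomes a
shift of the index. *)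
Lemma l1Z_conservation u v (F : int -> R) B :
  (forall i, 0 <= u i) -> (forall i, 0 <= v i) ->
  (forall i, v i = u i - (F i - F (i - 1))) ->
  (l1Z F <= B%:E)%E -> l1Z v = l1Z u.
Proof.
move=> u0 v0 vE FB.
pose P (i : int) : R := Num.max (F i) 0.
pose M (i : int) : R := Num.max (- F i) 0.
have P0 i : 0 <= P i by rewrite /P le_max lexx orbT.
have M0 i : 0 <= M i by rewrite /M le_max lexx orbT.
have FE i : F i = P i - M i.
  by rewrite /P /M; case: (leP (F i) 0); case: (leP (- F i) 0) => *; lra.
have PF i : `|P i| <= `|F i|.
  by rewrite ger0_norm// /P; case: (leP (F i) 0) => h; rewrite ?normr_ge0// ler_norm.
have MF i : `|M i| <= `|F i|.
  rewrite ger0_norm// /M -normrN; case: (leP (- F i) 0) => h; rewrite ?normr_ge0//.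
  by rewrite ler_norm.
have finP : l1Z P \is a fin_num by apply: (@l1Z_fin P B); apply: le_trans FB; exact: l1Z_le.
have finM : l1Z M \is a fin_num by apply: (@l1Z_fin M B); apply: le_trans FB; exact: l1Z_le.
have e1 : l1Z (fun i => v i + (P i + M (i - 1)))%R = (l1Z v + (l1Z P + l1Z M))%E.
  rewrite -(l1Z_shift M (-1)) -(@l1ZDE P _ (fun i => P i + M (i - 1))).
    by apply: l1ZDE => i; rewrite !ger0_norm ?addr_ge0//.
  by move=> i; rewrite !ger0_norm ?addr_ge0//.
have e2 : l1Z (fun i => u i + (P (i - 1) + M i))%R = (l1Z u + (l1Z P + l1Z M))%E.
  rewrite -(l1Z_shift P (-1)) -(@l1ZDE _ M (fun i => P (i - 1) + M i)).
    by apply: l1ZDE => i; rewrite !ger0_norm ?addr_ge0//.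
  by move=> i; rewrite !ger0_norm ?addr_ge0//.
have : l1Z (fun i => v i + (P i + M (i - 1))) =
       l1Z (fun i => u i + (P (i - 1) + M i)).
  by congr l1Z; apply/funext => i; rewrite vE !FE; ring.
rewrite e1 e2 => /(congr1 (fun x => x - (l1Z P + l1Z M))%E).
by rewrite !addeK// fin_numD finP finM.
Qed.

End IntSums.

(** * Cells and step functions *)

Section StepFunctions.
Context {R : realType}.
Local Notation leb := (@lebesgue_measure R).
Implicit Types (dx : R) (u : int -> R).

Lemma esumZl (I : choiceType) (k : R) (a : I -> \bar R) : 0 < k ->
  (forall i, (0 <= a i)%E) ->
  (\esum_(i in [set: I]) (k%:E * a i) = k%:E * \esum_(i in [set: I]) a i)%E.
Proof.
move=> k0 a0; rewrite /esum -ereal_sup_pZl// -[in RHS]image_comp image_comp/=.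
congr ereal_sup; apply/seteqP; split => [_ [X Xf <-]|_ [_ [X Xf <-] <-]] /=.
  by exists (\sum_(x \in X) a x)%E; [exists X|rewrite ge0_mule_fsumr].
by exists X => //; rewrite ge0_mule_fsumr.
Qed.

Lemma xhalfE dx i : xhalf dx i = (i%:~R + 1 / 2) * dx.
Proof. by rewrite /xhalf /xgrid intrD; field. Qed.

Lemma xhalfB1 dx i : xhalf dx (i - 1) = (i%:~R - 1 / 2) * dx.
Proof. by rewrite xhalfE intrB; field. Qed.

Lemma cellP dx i x : 0 < dx -> cell dx i x <-> xindex dx x = i.
Proof.
move=> dx0; rewrite /cell/= in_itv/= xhalfB1 xhalfE /xindex.
rewrite -ler_pdivlMr// -ltr_pdivrMr//.
have := floor_itv (x / dx + 1 / 2); set f := Num.floor _.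
rewrite intrD => /andP[f1 f2]; split => [/andP[i1 i2]|<-]; last by lra.
apply/eqP; rewrite eq_le -!ltzD1 -!(ltr_int R) !intrD; lra.
Qed.

Lemma cell_xindex dx x : 0 < dx -> cell dx (xindex dx x) x.
Proof. by move=> dx0; apply/cellP. Qed.

Lemma xindex_near dx x : 0 < dx -> `|x - xgrid dx (xindex dx x)| <= dx / 2.
Proof.
move=> dx0; have := cell_xindex x dx0.
rewrite /cell/= in_itv/= xhalfB1 xhalfE /xgrid ler_norml => /andP[].
set i := _%:~R; nra.
Qed.

Lemma xindex_le dx x y : 0 < dx -> x <= y -> xindex dx x <= xindex dx y.
Proof. by move=> dx0 xy; apply: le_floor; rewrite lerD2r ler_pM2r// invr_gt0. Qed.

Lemma measurable_cell dx i : measurable (cell dx i).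
Proof. exact: measurable_itv. Qed.

Lemma lebesgue_cell dx i : 0 < dx -> leb (cell dx i) = dx%:E.
Proof.
move=> dx0; rewrite lebesgue_measure_itv/= lte_fin xhalfB1 xhalfE.
by rewrite ifT; [rewrite -EFinB; congr EFin; field|rewrite ltr_pM2r//; lra].
Qed.

Lemma measurable_xindex d' (T' : measurableType d') dx (g : int -> T') : 0 < dx ->
  measurable_fun [set: R] (fun x => g (xindex dx x)).
Proof.
move=> dx0 _ Y mY; rewrite setTI.
have -> : (fun x => g (xindex dx x)) @^-1` Y =
    \bigcup_(i in [set i : int | Y (g i)]) cell dx i.
  apply/seteqP; split => [x /= Yx|x [i /= Yi]].
    by exists (xindex dx x) => //; exact: cell_xindex.
  by move/(@cellP dx i x dx0) => ->.
rewrite bigcup_mkcond; apply: countable_bigcupT_measurable => [|i].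
  exact: countableP.
by case: ifP => _ //; exact: measurable_cell.
Qed.


Lemma measurable_step dx u : 0 < dx ->
  measurable_fun [set: R] (fun x => u (xindex dx x)).
Proof. exact: measurable_xindex. Qed.

Lemma integral_cells dx (f : R -> \bar R) : 0 < dx ->
  measurable_fun [set: R] f -> (forall x, 0 <= f x)%E ->
  (\int[leb]_x f x = \esum_(i in [set: int]) \int[leb]_(x in cell dx i) f x)%E.
Proof.
move=> dx0 mf f0.
pose F n : set R := if @pickle_inv int n is Some i then cell dx i else set0.
have mF n : measurable (F n).
  by rewrite /F; case: pickle_inv => // i; exact: measurable_cell.
have FT : \bigcup_n F n = [set: R].
  rewrite -subTset => x _; exists (pickle (xindex dx x)); first by [].
  by rewrite /F pickleK_inv; exact: cell_xindex.
have tF : trivIset [set: nat] F.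
  apply/trivIsetP => m n _ _ mn; rewrite -subset0 => x [].
  rewrite /F; case Em : (pickle_inv m) => [i|]//; case En : (pickle_inv n) => [j|]//.
  move=> /(@cellP dx i x dx0) xi /(@cellP dx j x dx0) xj; move/eqP: mn; apply.
  have := @pickle_invK int m; have := @pickle_invK int n.
  by rewrite Em En /= => <- <-; rewrite -xi -xj.
rewrite -[in LHS]FT ge0_integral_bigcup//; last exact: measurable_funTS.
rewrite nneseries_esumT; last by move=> n; exact: integral_ge0.
rewrite (@esumID _ _ (range (@pickle int)))//; last by move=> n _; exact: integral_ge0.
rewrite !setTI [X in (_ + X)%E]esum1 ?adde0; last first.
  move=> n /= Hn; rewrite /F; case E : (pickle_inv n) => [i|]; last exact: integral_set0.
  by exfalso; apply: Hn; exists i => //; have := @pickle_invK int n; rewrite E.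
rewrite (@reindex_esum _ _ _ [set: int] _ pickle).
  by apply: eq_esum => i _; rewrite /F pickleK_inv.
apply: inj_bij => i j _ _; exact: (pcan_inj pickleK).
Qed.

(** The bridge between the discrete sums of the scheme and Lebesgue integrals. *)
Lemma integral_step dx (a : int -> \bar R) : 0 < dx -> (forall i, 0 <= a i)%E ->
  (\int[leb]_x a (xindex dx x) = dx%:E * \esum_(i in [set: int]) a i)%E.
Proof.
move=> dx0 a0; rewrite (integral_cells dx0)//; last exact: measurable_xindex.
rewrite -esumZl//; apply: eq_esum => i _.
transitivity (\int[leb]_(x in cell dx i) (cst (a i) x))%E.
  by apply: eq_integral => x /set_mem /(@cellP dx i x dx0) ->.
rewrite -(lebesgue_cell i dx0) muleC; apply: integral_cst; exact: measurable_cell.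
Qed.

Lemma integral_step_l1Z dx u : 0 < dx ->
  (\int[leb]_x `|u (xindex dx x)|%:E = dx%:E * l1Z u)%E.
Proof.
by move=> dx0; rewrite (@integral_step dx (fun i => `|u i|%:E))// => i; rewrite lee_fin.
Qed.

Lemma integrable_step dx u A : 0 < dx -> (l1Z u <= A%:E)%E ->
  leb.-integrable [set: R] (EFin \o (fun x => u (xindex dx x))).
Proof.
move=> dx0 uA; apply/integrableP; split.
  by apply/measurable_EFinP; exact: measurable_step.
under eq_integral do rewrite /=.
rewrite integral_step_l1Z//.
by rewrite (@le_lt_trans _ _ (dx%:E * A%:E)%E) ?lee_pmul2l// -?EFinM ?ltry.
Qed.

(** Through this identity the linear theory of [zsum] is that of the integral. *)
Lemma Rintegral_step dx u A : 0 < dx -> (l1Z u <= A%:E)%E ->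
  \int[leb]_x u (xindex dx x) = dx * zsum u.
Proof.
move=> dx0 uA; rewrite /Rintegral integralE /zsum.
rewrite (_ : (_)^\+%E = (fun x => (EFin \o u)^\+ (xindex dx x))%E)//.
rewrite (_ : (_)^\-%E = (fun x => (EFin \o u)^\- (xindex dx x))%E)//.
rewrite (@integral_step dx (EFin \o u)^\+%E)//.
rewrite (@integral_step dx (EFin \o u)^\-%E)//.
have us : summable [set: int] (EFin \o u).
  by rewrite /summable (le_lt_trans uA)// ltry.
have fp : (\esum_(i in [set: int]) (EFin \o u)^\+ i)%E \is a fin_num.
  have := summable_funepos us; rewrite summableE.
  by rewrite (@eq_esum _ _ _ _ (EFin \o u)^\+%E)// => i _; rewrite gee0_abs.
have fn : (\esum_(i in [set: int]) (EFin \o u)^\- i)%E \is a fin_num.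
  have := summable_funeneg us; rewrite summableE.
  by rewrite (@eq_esum _ _ _ _ (EFin \o u)^\-%E)// => i _; rewrite gee0_abs.
rewrite -muleBr ?fin_num_adde_defr// fineM//; by rewrite fin_numB fp fn.
all: by apply/funext => x; rewrite ?funeposE ?funenegE.
Qed.

Lemma zsumB (a b : int -> R) A B : (l1Z a <= A%:E)%E -> (l1Z b <= B%:E)%E ->
  zsum (fun i => a i - b i) = zsum a - zsum b.
Proof.
move=> aA bB; have abAB : (l1Z (fun i => a i - b i)%R <= (A + B)%:E)%E.
  by apply: l1Z_leD aA bB => i; exact: ler_normB.
apply: (@mulfI R 1) => //; rewrite -(@Rintegral_step 1 _ (A + B))//.
rewrite mulrBr -(@Rintegral_step 1 _ A)// -(@Rintegral_step 1 _ B)//.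
by rewrite RintegralB//; [exact: integrable_step aA|exact: integrable_step bB].
Qed.

Lemma zsum_le (a : int -> R) A : (l1Z a <= A%:E)%E -> `|zsum a| <= A.
Proof.
move=> aA; have := @Rintegral_step 1 a A ltr01 aA; rewrite mul1r => <-.
apply: le_trans (le_normr_Rintegral _ (integrable_step ltr01 aA)) _ => //.
rewrite /Rintegral /= integral_step_l1Z// mul1e -lee_fin fineK//.
exact: l1Z_fin aA.
Qed.


End StepFunctions.

(** * Increments of functions of several variables *)

Section Calculus.
Context {R : realType}.

(** The mean value theorem along a line. Being derivable in every direction says
nothing about differentiability, so the restriction to the line is
differentiated directly. *)
Lemma directional_MVT (V : normedModType R) (g : V -> R) (v : V) :
  (forall x, derivable g x v) ->
  forall (x : V) (s : R), exists2 r : R, `|r| <= `|s| &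
    g (x + s *: v) - g x = 'D_v g (x + r *: v) * s.
Proof.
move=> dg x s.
pose h (t : R) : R := g (x + t *: v).
have dh t : is_derive t (1 : R) h ('D_v g (x + t *: v)).
  have E : (fun e : R => e^-1 *: ((h \o shift t) (e *: (1 : R)) - h t)) =
      (fun e : R => e^-1 *: ((g \o shift (x + t *: v)) (e *: v) - g (x + t *: v))).
    apply/funext => e /=; rewrite /h /shift /=; congr (_ *: (g _ - _)).
    have -> : e *: (1 : R) = e by rewrite /GRing.scale /= mulr1.
    by rewrite scalerDl addrCA.
  apply: DeriveDef; first by rewrite /derivable E; exact: dg.
  by rewrite /derive E.
have ch (A : set R) : {within A, continuous h}.
  apply: continuous_subspaceT => t.
  by apply: differentiable_continuous; apply/derivable1_diffP; have [] := dh t.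
have [s0|s0|->] := ltgtP s 0.
- have [r rs E] := MVT s0 (fun t _ => dh t) (ch _).
  exists r; first by move: rs; rewrite in_itv/= => /andP[r1 r2]; rewrite !ltr0_norm//; lra.
  by move: E; rewrite {1 2}/h scale0r addr0; lra.
- have [r rs E] := MVT s0 (fun t _ => dh t) (ch _).
  exists r; first by move: rs; rewrite in_itv/= => /andP[r1 r2]; rewrite !gtr0_norm//; lra.
  by move: E; rewrite {1 2}/h scale0r addr0; lra.
- by exists 0; rewrite ?lexx// scale0r addr0 mulr0 subrr.
Qed.

Definition norm1 (n : nat) (c : 'rV[R]_n) : R := \sum_(j < n) `|c 0 j|.

(** Moving from [c] to [c + h] one coordinate at a time only involves partial
derivatives, so continuity of the full differential is never required. *)
Lemma partial_increment (n : nat) (g : 'rV[R]_n -> R) (a : 'I_n -> R) (B : R)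
    (c h : 'rV[R]_n) :
  (forall j x, derivable g x (delta_mx 0 j)) ->
  (forall j y, norm1 (y - c) <= norm1 h ->
     `|'D_(delta_mx 0 j) g y - a j| <= B) ->
  `|g (c + h) - g c - \sum_(j < n) a j * h 0 j| <= B * norm1 h.
Proof.
move=> dg gB.
pose tr (m : nat) : 'rV[R]_n := \row_j (if (j < m)%N then h 0 j else 0).
have trE m j : (tr m) 0 j = if (j < m)%N then h 0 j else 0 by rewrite mxE.
suff H m : (m <= n)%N ->
    `|g (c + tr m) - g c - \sum_(j < n | (j < m)%N) a j * h 0 j| <=
    B * \sum_(j < n | (j < m)%N) `|h 0 j|.
  have := H n (leqnn n).
  have -> : tr n = h by apply/rowP => j; rewrite trE ltn_ord.
  by rewrite /norm1; under eq_bigl do rewrite ltn_ord; under [in leRHS]eq_bigl do rewrite ltn_ord.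
elim: m => [_|m IH mn].
  have -> : tr 0%N = 0 by apply/rowP => j; rewrite trE !mxE.
  by rewrite addr0 subrr !big_pred0// subr0 normr0 mulr0.
pose o := Ordinal mn.
have trS : tr m.+1 = tr m + h 0 o *: delta_mx 0 o.
  apply/rowP => j; rewrite !mxE eqxx/= -[j == o]/(val j == m) ltnS leq_eqVlt.
  by case: eqVneq => [jm|_]/=; rewrite ?mulr0 ?addr0// jm ltnn add0r mulr1;
    congr (h 0 _); apply: val_inj.
have split_o (F : 'I_n -> R) : \sum_(j < n | (j < m.+1)%N) F j =
    F o + \sum_(j < n | (j < m)%N) F j.
  rewrite (bigD1 o)//=; congr (_ + _); apply: eq_bigl => j.
  by rewrite -[j == o]/(val j == m) ltnS ltn_neqAle andbC.
have [r rh E] := directional_MVT (dg o) (c + tr m) (h 0 o).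
rewrite !split_o trS addrA.
have r1 : norm1 (c + tr m + r *: delta_mx 0 o - c) <= norm1 h.
  apply: ler_sum => j _; rewrite !mxE eqxx/=.
  rewrite -(addrA (c 0 j)) addrAC subrr add0r.
  rewrite -[j == o]/(val j == m).
  case: eqVneq => [jm|_]/=; last by rewrite mulr0 addr0; case: ifP => // _; rewrite normr0.
  rewrite jm ltnn mulr1 add0r (le_trans rh)// le_eqVlt; apply/orP; left; apply/eqP.
  by congr (`|h 0 _|); apply: val_inj.
have {}IH := IH (ltnW mn).
have := gB o _ r1; move: E.
set D := 'D_ _ _ _; set S := \sum_(j < n | _) a j * _ in IH *.
set S' := \sum_(j < n | _) _ in IH *.
move=> E DB.
have -> : g (c + tr m + h 0 o *: delta_mx 0 o) - g c - (a o * h 0 o + S) =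
    (D - a o) * h 0 o + (g (c + tr m) - g c - S).
  by move/eqP: E; rewrite subr_eq => /eqP ->; ring.
rewrite mulrDr (le_trans (ler_normD _ _))// lerD// normrM.
by rewrite ler_wpM2r.
Qed.

Lemma bounded_ex (V : Type) (g : V -> R) :
  [bounded g x | x in [set: V]] -> exists M : R, forall x, `|g x| <= M.
Proof.
by move=> [M [_ H]]; exists (M + 1) => x; apply: (H (M + 1)) => //; lra.
Qed.

End Calculus.

(** * Quantitative regularity of kernels and velocities *)

Section Regularity.
Context {R : realType}.

(** What is used of a kernel in C^2 and W^{2,oo}: a bounded Lipschitz function
whose derivative [dm] is bounded and Lipschitz, with a second order Taylor
estimate, all with one constant. *)
Definition regular_kernel (m dm : R -> R) (B : R) :=
  [/\ 0 <= B, forall x, `|m x| <= B, forall x, `|dm x| <= B,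
      forall x y, `|m y - m x| <= B * `|y - x| &
      (forall x y, `|dm y - dm x| <= B * `|y - x|) /\
      (forall x y, `|m y - m x - dm x * (y - x)| <= B * `|y - x| ^+ 2)].

Lemma Ck2_regular_kernel (m : R -> R) : Ck 2 m -> Wkoo 2 m ->
  exists (dm : R -> R) (B : R), regular_kernel m dm B.
Proof.
move=> [_ Cm] [/bounded_ex[B0 mB0] Wm].
have [dm [_ Cm']] := Cm 1; have [ddm _] := Cm' 1.
have [/bounded_ex[B1 mB1] /(_ 1)[/bounded_ex[B2 mB2] _]] := Wm 1.
pose B := Num.max 0 (Num.max B0 (Num.max B1 B2)).
have B0B : B0 <= B by rewrite /B !le_max lexx !orbT.
have B1B : B1 <= B by rewrite /B !le_max lexx !orbT.
have B2B : B2 <= B by rewrite /B !le_max lexx !orbT.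
have B_ge0 : 0 <= B by rewrite /B !le_max lexx.
have mvt (g : R -> R) : (forall x, derivable g x 1) -> forall x y,
    exists2 r, `|r| <= `|y - x| & g y - g x = 'D_1 g (x + r) * (y - x).
  move=> dg x y; have [r rs] := directional_MVT dg x (y - x).
  have s1 (s : R) : s *: (1 : R) = s by rewrite /GRing.scale /= mulr1.
  rewrite !s1 (_ : x + (y - x) = y); last by ring.
  by exists r.
have dml x y : `|'D_1 m y - 'D_1 m x| <= B * `|y - x|.
  have [r _ ->] := mvt _ ddm x y; rewrite normrM ler_wpM2r//.
  exact: le_trans (mB2 _) B2B.
exists ('D_1 m), B; split => //.
- by move=> x; exact: le_trans (mB0 _) B0B.
- by move=> x; exact: le_trans (mB1 _) B1B.
- move=> x y; have [r _ ->] := mvt _ dm x y; rewrite normrM ler_wpM2r//.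
  exact: le_trans (mB1 _) B1B.
split => // x y; have [r rxy ->] := mvt _ dm x y.
rewrite -mulrBl normrM expr2 mulrA ler_wpM2r//.
by apply: le_trans (dml _ _) _; rewrite [x + r]addrC addrK ler_wpM2l.
Qed.

(** The analogue of the previous notion in several variables; [dg] lists the
partial derivatives. *)
Definition regular_field (n : nat) (g : 'rV[R]_n -> R)
    (dg : 'I_n -> 'rV[R]_n -> R) (B : R) :=
  [/\ 0 <= B, forall c, `|g c| <= B, forall j c, `|dg j c| <= B,
      forall c c', `|g c' - g c| <= B * norm1 (c' - c) &
      (forall j c c', `|dg j c' - dg j c| <= B * norm1 (c' - c)) /\
      (forall c c', `|g c' - g c - \sum_(j < n) dg j c * (c' - c) 0 j|
         <= B * norm1 (c' - c) ^+ 2)].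

Lemma partial_lipschitz (n : nat) (g : 'rV[R]_n -> R) (B : R) :
  (forall j x, derivable g x (delta_mx 0 j)) ->
  (forall j y, `|'D_(delta_mx 0 j) g y| <= B) ->
  forall c c', `|g c' - g c| <= B * norm1 (c' - c).
Proof.
move=> dg gB c c'.
have := @partial_increment R n g (fun=> 0) B c (c' - c) dg.
rewrite [c + _]addrC subrK big1 ?subr0; last by move=> j _; rewrite mul0r.
by apply => j y _; rewrite subr0.
Qed.

(** The partial derivatives are Lipschitz because the second ones are bounded, and
by the mean value theorem they stay within [B * norm1 h] of their value at the
centre along any path of coordinate increments of [h]. *)
Lemma Ck2_regular_field (n : nat) (g : 'rV[R]_n -> R) : Ck 2 g -> Wkoo 2 g ->
  exists (dg : 'I_n -> 'rV[R]_n -> R) (B : R), regular_field g dg B.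
Proof.
move=> [_ Cg] [/bounded_ex[B0 gB0] Wg].
pose dg (j : 'I_n) := 'D_(delta_mx 0 j) g.
have dG j x : derivable g x (delta_mx 0 j) by have [+ _] := Cg (delta_mx 0 j); apply.
have ddG j l x : derivable (dg j) x (delta_mx 0 l).
  by have [_ [_ /(_ (delta_mx 0 l))[+ _]]] := Cg (delta_mx 0 j); apply.
have /choice[B1 gB1] : forall j, exists b, forall x, `|dg j x| <= b.
  by move=> j; have [/bounded_ex[b bP] _] := Wg (delta_mx 0 j); exists b.
have /choice[B2 gB2] : forall p : 'I_n * 'I_n, exists b, forall x,
    `|'D_(delta_mx 0 p.2) (dg p.1) x| <= b.
  move=> [j l].
  have [_ /(_ (delta_mx 0 l))[/bounded_ex[b bP] _]] := Wg (delta_mx 0 j).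
  by exists b.
pose B := `|B0| + \sum_j `|B1 j| + \sum_p `|B2 p|.
have s1 : 0 <= \sum_j `|B1 j| by apply: sumr_ge0.
have s2 : 0 <= \sum_p `|B2 p| by apply: sumr_ge0.
have B_ge0 : 0 <= B by rewrite !addr_ge0.
have B0B : B0 <= B.
  by rewrite (le_trans (ler_norm _))// /B -addrA lerDl addr_ge0.
have B1B j : B1 j <= B.
  rewrite (le_trans (ler_norm _))// /B addrAC (bigD1 j)//= addrCA lerDl.
  by rewrite !addr_ge0// sumr_ge0.
have B2B p : B2 p <= B.
  rewrite (le_trans (ler_norm _))// /B (bigD1 p)//= addrCA lerDl.
  by rewrite !addr_ge0// sumr_ge0.
have dgl j c c' : `|dg j c' - dg j c| <= B * norm1 (c' - c).
  apply: partial_lipschitz => l y; first exact: ddG.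
  exact: le_trans (gB2 (j, l) y) (B2B _).
have dgB j y : `|dg j y| <= B by exact: le_trans (gB1 j y) (B1B j).
exists dg, B; split => //.
- by move=> c; exact: le_trans (gB0 c) B0B.
- exact: partial_lipschitz.
split => // c c'.
have := @partial_increment R n g (fun j => dg j c) (B * norm1 (c' - c)) c (c' - c) dG.
rewrite [c + _]addrC subrK expr2 mulrA; apply => j y yc.
by apply: le_trans (dgl _ _ _) _; rewrite ler_wpM2l.
Qed.

Lemma norm1_ge0 n (c : 'rV[R]_n) : 0 <= norm1 c.
Proof. exact: sumr_ge0. Qed.

Lemma norm1N n (c : 'rV[R]_n) : norm1 (- c) = norm1 c.
Proof. by apply: eq_bigr => j _; rewrite mxE normrN. Qed.

(** Second differences along a path are controlled by the second difference of
the path and by the squares of its increments. *)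
Lemma regular_field_diff2 n (g : 'rV[R]_n -> R) dg B (c1 c2 c3 : 'rV[R]_n) :
  regular_field g dg B ->
  `|g c3 - 2 * g c2 + g c1| <=
  B * (norm1 (c3 - 2 *: c2 + c1) + norm1 (c3 - c2) ^+ 2 + norm1 (c1 - c2) ^+ 2).
Proof.
case=> B0 _ dB _ [_ T].
have := T c2 c3; have := T c2 c1.
set S1 := \sum_(j < n) _; set S3 := \sum_(j < n) _ => h1 h3.
have S13 : `|S3 + S1| <= B * norm1 (c3 - 2 *: c2 + c1).
  rewrite /S1 /S3 -big_split/= (le_trans (ler_norm_sum _ _ _))// mulr_sumr.
  apply: ler_sum => j _; rewrite -mulrDr normrM !mxE.
  have -> : c3 0 j - c2 0 j + (c1 0 j - c2 0 j) = c3 0 j - 2 * c2 0 j + c1 0 j by ring.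
  by rewrite ler_wpM2r.
move: h1 h3 S13; rewrite !mulrDr !ler_norml.
move: (B * norm1 _ ^+ 2) (B * norm1 _ ^+ 2) (B * norm1 _) => x y z.
lra.
Qed.

End Regularity.

Section Fluxes.
Context {R : realType}.

Lemma Lip_lipschitz (f : R -> R) : lipschitz f ->
  0 <= Lip f /\ forall x y, `|f y - f x| <= Lip f * `|y - x|.
Proof.
move=> [M [_ HM]].
pose S := [set `|f xy.1 - f xy.2| / `|xy.1 - xy.2| | xy in [set xy : R * R | xy.1 != xy.2]].
have Sub : has_ubound S.
  exists (M + 1) => _ [[x y] /= xy <-].
  have xy0 : 0 < `|x - y| by rewrite normr_gt0 subr_eq0.
  by rewrite ler_pdivrMr//; apply: (HM (M + 1) _ (x, y)) => //; lra.
have L x y : `|f y - f x| <= Lip f * `|y - x|.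
  have [->|xy] := eqVneq x y; first by rewrite !subrr normr0 mulr0.
  rewrite -ler_pdivrMr ?normr_gt0 ?subr_eq0 1?eq_sym//.
  by apply: ub_le_sup => //; exists (y, x) => //=; rewrite eq_sym.
split => //; apply: (@le_trans _ _ (`|f 0 - f 1| / `|0 - 1|)); first by rewrite divr_ge0.
by rewrite ler_pdivrMr; [exact: L|rewrite normr_gt0 sub0r oppr_eq0 oner_eq0].
Qed.

Lemma le_sup_norm (V : Type) (g : V -> R) (B : R) :
  (forall x, `|g x| <= B) -> forall x, `|g x| <= sup_norm g.
Proof.
by move=> gB x; apply: ub_le_sup; [exists B => _ [y _ <-]|exists x].
Qed.

(** The Godunov flux is a value of [f] between [b] and [c], or a limit of such
values. *)
Lemma godunov_near (f : R -> R) (L : R) : 0 <= L ->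
  (forall x y, `|f y - f x| <= L * `|y - x|) ->
  forall b c, `|godunov f b c - f b| <= L * `|c - b| /\
              `|godunov f b c - f c| <= L * `|c - b|.
Proof.
move=> L0 fL b c.
suff H (e x y : R) : (forall z, x <= z <= y -> `|f z - f e| <= L * `|y - x|) ->
    x <= y -> `|inf (f @` `[x, y]) - f e| <= L * `|y - x| /\
              `|sup (f @` `[x, y]) - f e| <= L * `|y - x|.
  have bd e x y : x <= e <= y -> forall z, x <= z <= y -> `|f z - f e| <= L * `|y - x|.
    move=> /andP[xe ey] z /andP[xz zy]; apply: le_trans (fL _ _) _.
    rewrite ler_wpM2l// (ger0_norm (_ : 0 <= y - x)); last by lra.
    by rewrite ler_norml; lra.
  rewrite /godunov; case: ifPn => [bc|]; last rewrite -ltNge => /ltW cb.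
    by split; apply: (H _ b c _ bc).1; apply: bd; rewrite ?lexx ?bc.
  by rewrite [`|c - b|]distrC; split; apply: (H _ c b _ cb).2; apply: bd; rewrite ?lexx ?cb.
move=> fe xy.
have ne : f @` `[x, y] !=set0 by exists (f x), x => //; rewrite /= in_itv/= lexx.
have bnd z : `[x, y]%classic z -> f e - L * `|y - x| <= f z <= f e + L * `|y - x|.
  by rewrite /= in_itv/= => /fe; rewrite ler_norml; lra.
have lbd : has_lbound (f @` `[x, y]).
  by exists (f e - L * `|y - x|) => _ [z /bnd/andP[+ _] <-].
have ubd : has_ubound (f @` `[x, y]).
  by exists (f e + L * `|y - x|) => _ [z /bnd/andP[_ +] <-].
have xin : `[x, y]%classic x by rewrite /= in_itv/= lexx.
have /andP[fx1 fx2] := bnd _ xin.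
have i1 : f e - L * `|y - x| <= inf (f @` `[x, y]).
  by apply: lb_le_inf => // _ [z /bnd/andP[+ _] <-].
have i2 : inf (f @` `[x, y]) <= f x by apply: ge_inf => //; exists x.
have s1 : sup (f @` `[x, y]) <= f e + L * `|y - x|.
  by apply: ge_sup => // _ [z /bnd/andP[_ +] <-].
have s2 : f x <= sup (f @` `[x, y]) by apply: ub_le_sup => //; exists x.
by rewrite !ler_norml; split; lra.
Qed.

End Fluxes.

(** * Bounded variation on the line *)

Section BoundedVariation.
Context {R : realType}.
Local Notation leb := (@lebesgue_measure R).
Implicit Types (g W : R -> R) (V : R).

(** A monotone majorant of the increments. Unlike the variation itself it is
available on the whole line at once, it passes to pointwise limits, and its
increments over consecutive intervals telescope. *)
Definition majorant g V W :=
  (forall x, 0 <= W x <= V) /\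
  (forall x y, x <= y -> `|g y - g x| <= W y - W x).

Definition bv_le g V := exists W, majorant g V W.

Lemma majorant_norm g V W : majorant g V W ->
  forall x y, `|g y - g x| <= `|W y - W x|.
Proof.
move=> [_ gW] x y; have [xy|/ltW yx] := leP x y.
  by apply: le_trans (gW _ _ xy) (ler_norm _).
by rewrite distrC [leRHS]distrC; apply: le_trans (gW _ _ yx) (ler_norm _).
Qed.

Lemma majorant_nd g V W : majorant g V W -> {homo W : x y / x <= y}.
Proof. by move=> [_ gW] x y /gW/(le_trans (normr_ge0 _)); rewrite subr_ge0. Qed.

Lemma bv_le_ge0 g V : bv_le g V -> 0 <= V.
Proof. by move=> [W [/(_ 0)/andP[W0 WV] _]]; exact: le_trans WV. Qed.

Lemma bv_le_weak g V V' : V <= V' -> bv_le g V -> bv_le g V'.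
Proof.
move=> VV' [W [WV gW]]; exists W; split => // x.
by have /andP[-> /le_trans] := WV x; apply.
Qed.

Lemma bv_leD g1 g2 V1 V2 : bv_le g1 V1 -> bv_le g2 V2 ->
  bv_le (fun x => g1 x - g2 x) (V1 + V2).
Proof.
move=> [W1 [b1 m1]] [W2 [b2 m2]]; exists (fun x => W1 x + W2 x); split.
  by move=> x; have := b1 x; have := b2 x; lra.
move=> x y xy; have := m1 _ _ xy; have := m2 _ _ xy; rewrite !ler_norml; lra.
Qed.

Lemma bv_le_TV g V : bv_le g V -> (TV g <= V%:E)%E.
Proof.
move=> [W mW]; apply: ge_ereal_sup => _ [[a b] /= ab <-].
have WE : total_variation a b W = (W b - W a)%:E.
  by apply: nondecreasing_total_variation => // x y _ _; exact: majorant_nd mW _ _.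
apply: (@le_trans _ _ (W b - W a)%:E); last first.
  by rewrite lee_fin; have [WV _] := mW; have := WV a; have := WV b; lra.
rewrite -WE; apply: ge_ereal_sup => _ [_ [s abs <-] <-].
apply: (@le_trans _ _ (variation a b W s)%:E); last first.
  by apply: ereal_sup_ubound; exists (variation a b W s) => //; exists s.
by rewrite lee_fin; apply: ler_sum => i _; exact: majorant_norm mW _ _.
Qed.

(** The majorant at [x] is the variation on the half line that ends at [x]. *)
Lemma TV_bv_le g : (TV g < +oo)%E -> exists V, bv_le g V.
Proof.
move=> gfin.
have TVle a b : a <= b -> (total_variation a b g <= TV g)%E.
  by move=> ab; apply: ereal_sup_ubound; exists (a, b).
have gfn : TV g \is a fin_num.
  rewrite ge0_fin_numE//; apply: le_trans (TVle 0 0 (lexx _)).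
  exact: total_variation_ge0.
pose S x := ereal_sup [set total_variation a x g | a in [set a | a <= x]].
have S0 x : (0 <= S x)%E.
  apply: le_trans (total_variation_ge0 g (lexx x)) _.
  by apply: ereal_sup_ubound; exists x => //=.
have SV x : (S x <= TV g)%E.
  by apply: ge_ereal_sup => _ [a /= ax <-]; exact: TVle.
have Sfn x : S x \is a fin_num.
  by rewrite ge0_fin_numE// (le_lt_trans (SV x)).
exists (fine (TV g)), (fine \o S); split.
  move=> x /=; rewrite fine_ge0//= -lee_fin !fineK//.
move=> x y xy /=; rewrite -lee_fin EFinB !fineK// leeBrDr//.
rewrite -leeBrDl//; apply: ge_ereal_sup => _ [a /= ax <-].
rewrite EFinN leeBrDl//; apply: le_trans (_ : total_variation a y g <= _)%E; last first.
  by apply: ereal_sup_ubound; exists a => //=; exact: le_trans xy.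
by rewrite (total_variationD g ax xy) addeC; apply: leeD => //; exact: total_variation_ge.
Qed.

Lemma bv_le_measurable g V : bv_le g V -> measurable_fun [set: R] g.
Proof.
move=> [W mW].
rewrite (_ : g = (fun x => (g x + W x) - W x)); last by apply/funext => x; ring.
have mW' : measurable_fun [set: R] W.
  by apply: nondecreasing_measurable => // x y; exact: majorant_nd mW _ _.
apply: measurable_funB => //; apply: nondecreasing_measurable => // x y xy.
by have [_ /(_ _ _ xy)] := mW; rewrite ler_norml; lra.
Qed.

Lemma bv_le_bounded g V : bv_le g V -> forall x, `|g x| <= `|g 0| + V.
Proof.
move=> [W mW] x; have [WV _] := mW; have := majorant_norm mW 0 x.
have : `|W x - W 0| <= V by have := WV x; have := WV 0; rewrite ler_norml; lra.
have := ler_normD (g 0) (g x - g 0); rewrite [g 0 + _]addrC subrK; lra.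
Qed.

(** [g] is continuous wherever its monotone majorant is, and a monotone function
has countably many discontinuities. *)
Lemma bv_le_ae_continuous g V : bv_le g V ->
  {ae leb, forall x, {for x, continuous g}}.
Proof.
move=> [W mW]; have ndW := majorant_nd mW; have [WV _] := mW.
pose D := \bigcup_n [set x | x \in (`]- n%:R, n%:R[) /\ discontinuity W x].
have cD : countable D.
  apply: bigcup_countable => [|n _]; first exact: countableP.
  by apply: discontinuity_countable => x y _ _; exact: ndW.
exists D; split.
- exact: countable_measurable.
- exact: countable_lebesgue_measure0.
move=> x /= xg; apply: contrapT => xD; apply: xg.
have cl : cvg (W y @[y --> x^'-]).
  apply: nondecreasing_at_left_is_cvgr; near=> z.
    by move=> a b _ _; exact: ndW.
  by exists V => _ [y _ <-]; have /andP[] := WV y.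
have cr : cvg (W y @[y --> x^'+]).
  apply: nondecreasing_at_right_is_cvgr; near=> z.
    by move=> a b _ _; exact: ndW.
  by exists 0 => _ [y _ <-]; have /andP[] := WV y.
have E : lim (W y @[y --> x^'-]) = lim (W y @[y --> x^'+]).
  apply: contrapT => /eqP ne; apply: xD.
  exists (Num.trunc `|x|).+1 => //=; split; last by split.
  rewrite in_itv/= -ltr_norml; have /andP[_] := truncn_itv (normr_ge0 x).
  by [].
have l1 : lim (W y @[y --> x^'-]) <= W x.
  by apply: limr_le => //; near=> y; apply: ndW; apply: ltW; near: y; exact: nbhs_left_lt.
have l2 : W x <= lim (W y @[y --> x^'+]).
  by apply: limr_ge => //; near=> y; apply: ndW; apply: ltW; near: y; exact: nbhs_right_gt.
have e1 : lim (W y @[y --> x^'-]) = W x by apply/eqP; rewrite eq_le l1 E.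
have e2 : lim (W y @[y --> x^'+]) = W x by rewrite -E.
have cW : W y @[y --> x] --> W x.
  apply/left_right_continuousP; split; first by rewrite -e1.
  by rewrite -e2.
apply/cvgrPdist_le => e e0.
have /cvgrPdist_le/(_ _ e0) := cW; apply: filterS => y.
by apply: le_trans; exact: majorant_norm mW _ _.
Unshelve. all: by end_near. Qed.

Lemma l1Z_telescope (d w : int -> R) V : (forall i, 0 <= w i <= V) ->
  (forall i, `|d i| <= w (i + 1) - w i) -> (l1Z d <= V%:E)%E.
Proof.
move=> wV dw; apply: l1Z_le_windows => n.
suff H m : \sum_(p < m) `|d (p%:Z - n%:Z)| <= w (m%:Z - n%:Z) - w (- n%:Z).
  by apply: le_trans (H _) _; have := wV ((n.*2)%:Z - n%:Z); have := wV (- n%:Z); lra.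
elim: m => [|m IH]; first by rewrite big_ord0 add0r subrr.
rewrite big_ord_recr/=; have := dw (m%:Z - n%:Z).
have -> : m%:Z - n%:Z + 1 = (m.+1)%:Z - n%:Z :> int by rewrite -addn1 PoszD; ring.
by move: IH; lra.
Qed.

(** The majorant at [x] sums the jumps that lie to the left of the cell of [x]. *)
Lemma zTV_bv_le (dx : R) (u : int -> R) V : 0 < dx -> (zTV u <= V%:E)%E ->
  bv_le (fun x => u (xindex dx x)) V.
Proof.
move=> dx0 uV; pose d i := u (i + 1) - u i.
pose cut (i : int) (p : int) : R := if (p < i)%R then d p else 0.
pose W i : R := fine (l1Z (cut i)).
have cutV i : (l1Z (cut i) <= V%:E)%E.
  apply: le_trans uV; apply: l1Z_le => p.
  by rewrite /cut; case: ifP => //; rewrite normr0.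
have cfin i := l1Z_fin (cutV i).
have step (i : int) (n : nat) : `|u (i + n%:Z) - u i| <= W (i + n%:Z) - W i.
  pose mid (p : int) : R := if (i <= p < i + n%:Z)%R then d p else 0.
  have cE : l1Z (cut (i + n%:Z)) = (l1Z (cut i) + l1Z mid)%E.
    apply: l1ZDE => p; rewrite /cut /mid.
    have [pi|pi] := ltP p i; last by rewrite /= normr0 add0r.
    by rewrite /= normr0 addr0 ifT//; lia.
  have mfin : l1Z mid \is a fin_num.
    by have := cfin (i + n%:Z); rewrite cE fin_numD => /andP[].
  have -> : W (i + n%:Z) - W i = fine (l1Z mid).
    by rewrite /W cE fineD// addrC addKr.
  rewrite -lee_fin fineK//; apply: le_trans (l1Z_window mid n i).
  rewrite lee_fin (_ : u (i + n%:Z) - u i = \sum_(p < n) mid (p%:Z + i)).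
    exact: ler_norm_sum.
  rewrite (eq_bigr (fun p : 'I_n => d (p%:Z + i))); last first.
    move=> p _; rewrite /mid ifT//; have := ltn_ord p; lia.
  elim: n {mid cE mfin} => [|n IH]; first by rewrite big_ord0 addr0 subrr.
  rewrite big_ord_recr/= -IH /d.
  rewrite (_ : i + n.+1%:Z = n%:Z + i + 1); last by lia.
  by rewrite [i + n%:Z]addrC; ring.
exists (fun x => W (xindex dx x)); split.
  move=> x; rewrite /W fine_ge0 ?l1Z_ge0//=.
  by rewrite -lee_fin fineK.
move=> x y /(xindex_le dx0) xy.
have -> : xindex dx y = xindex dx x + (absz (xindex dx y - xindex dx x))%:Z by lia.
exact: step.
Qed.

End BoundedVariation.

(** * Almost everywhere statements and essential suprema *)

Section AlmostEverywhere.
Context d (T : measurableType d) (R : realType) (m : {measure set T -> \bar R}).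
Implicit Types P Q : T -> Prop.

Lemma ae_imp P Q : {ae m, forall x, P x} -> (forall x, P x -> Q x) ->
  {ae m, forall x, Q x}.
Proof.
move=> [D [mD D0 PD]] PQ; exists D; split => // x /= nQ.
by apply: PD => /= Px; apply: nQ; exact: PQ.
Qed.

Lemma ae_and P Q : {ae m, forall x, P x} -> {ae m, forall x, Q x} ->
  {ae m, forall x, P x /\ Q x}.
Proof.
move=> [D [mD D0 PD]] [E [mE E0 QE]]; exists (D `|` E); split.
- exact: measurableU.
- exact: null_set_setU.
move=> x /= nPQ; apply: contrapT => /not_orP[nD nE]; apply: nPQ; split.
  by apply: contrapT => nP; apply: nD; exact: PD.
by apply: contrapT => nQ; apply: nE; exact: QE.
Qed.

End AlmostEverywhere.

Section EssentialBounds.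
Context {R : realType}.
Local Notation leb := (@lebesgue_measure R).

Lemma ae_exists (P : R -> Prop) (A : set R) : measurable A -> (0 < leb A)%E ->
  {ae leb, forall x, P x} -> exists2 x, A x & P x.
Proof.
move=> mA A0 [D [mD D0 PD]]; apply: contrapT => nex.
have AD : A `<=` D.
  by move=> x Ax; apply: PD => /= Px; apply: nex; exists x.
have A00 : leb A = 0 :=
  @subset_measure0 _ _ _ (@lebesgue_measure R) A D mA mD AD D0.
by move: A0; rewrite A00 ltxx.
Qed.

Lemma Loo_normP (g : R -> R) y :
  (Loo_norm g <= y)%E <-> {ae leb, forall x, (`|g x|%:E <= y)%E}.
Proof.
rewrite /Loo_norm unlock /= ifT; last first.
  have := @lebesgue_measure_itv R `]-oo, +oo[; rewrite set_itvE /= => ->.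
  by rewrite /= ?ltry.
by split => [/ess_supP|h]; last apply/ess_supP.
Qed.

Lemma Loo_norm_ge0 (g : R -> R) : (0 <= Loo_norm g)%E.
Proof. exact: Lnorm_ge0. Qed.

(** Every cell has positive measure, so none of the values of a step function is
invisible to the essential supremum. *)
Lemma Loo_norm_step (dx : R) (u : int -> R) y : 0 < dx ->
  (Loo_norm (fun x => u (xindex dx x)) <= y)%E <-> forall i, (`|u i|%:E <= y)%E.
Proof.
move=> dx0; split => [/Loo_normP uy i|uy]; last first.
  by apply/Loo_normP; apply: aeW => x; exact: uy.
have [|x /(@cellP R dx i x dx0) <- //] := ae_exists (measurable_cell dx i) _ uy.
by rewrite lebesgue_cell// lte_fin.
Qed.

(** By continuity from the right the bound at almost every point reaches every
point. It is applied to the coefficient [sigma], whose values at the grid points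
enter the scheme. *)
Lemma Loo_norm_le_right (g : R -> R) x y :
  (g z @[z --> x^'+] --> g x) -> (Loo_norm g <= y%:E)%E -> `|g x| <= y.
Proof.
move=> gx /Loo_normP gy; rewrite leNgt; apply/negP => yx.
have gx' : `|g z| @[z --> x^'+] --> `|g x| by apply: cvg_norm.
have : \forall z \near x^'+, y < `|g z| by apply: (cvgr_gt _ gx').
rewrite /at_right near_withinE => /nbhs_ballP.
move=> [e /= e0 He].
have mI : measurable (`]x, (x + e)[ : set R) by exact: measurable_itv.
have [|z xz gz] := ae_exists mI _ gy.
  by rewrite lebesgue_measure_itv/= lte_fin ltrDl e0 -EFinB lte_fin; lra.
move: xz; rewrite /= in_itv/= => /andP[xz zxe].
have := He z; rewrite /ball/= ltr_norml => /(_ _ xz).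
have -> : (- e < x - z < e) by lra.
by move=> /(_ isT); rewrite ltNge -lee_fin gz.
Qed.

Lemma bv_le_Loo_norm_fin (g : R -> R) V : bv_le g V -> Loo_norm g \is a fin_num.
Proof.
move=> gV; rewrite ge0_fin_numE ?Loo_norm_ge0//.
apply: (@le_lt_trans _ _ (`|g 0| + V)%:E); last exact: ltry.
by apply/Loo_normP; apply: aeW => x; rewrite lee_fin; exact: bv_le_bounded.
Qed.

End EssentialBounds.

(** * Distance from the numerical fluxes to the exact flux *)

Section FluxBounds.
Context {R : realType} {N : nat}.
Variables (P : ivp R N) (sch : flux_type R) (lambda : R).
Context (hyp1 : H1 P) (hyp2 : H2 P) (hyp3 : H3 P) (lambda0 : 0 < lambda).
Context (Hcfl : CFL P sch lambda).

Lemma sigma_ge_inf k x : inf (range (sigma P k)) <= sigma P k x.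
Proof.
have [_ _ i0] := hyp3 k.
apply: ge_inf; last by exists x.
have [[[y Sy] lb]|nh] := pselect (has_inf (range (sigma P k))); first exact: lb.
by move: i0; rewrite inf_out// ltxx.
Qed.

Lemma sigma_gt0 k x : 0 < sigma P k x.
Proof. by have [_ _ i0] := hyp3 k; exact: lt_le_trans (sigma_ge_inf _ _). Qed.

Lemma sigma_le_norm k x : sigma P k x <= sigma_norm P k.
Proof.
have [/TV_bv_le[V sV] sr _] := hyp3 k; have sf := bv_le_Loo_norm_fin sV.
apply: le_trans (ler_norm _) _; apply: Loo_norm_le_right; first exact: sr.
by rewrite /sigma_norm fineK.
Qed.

Lemma flux_Lip k : 0 <= Lip (flux P k) /\
  forall x y, `|flux P k y - flux P k x| <= Lip (flux P k) * `|y - x|.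
Proof. by have [h _] := hyp1 k; exact: Lip_lipschitz. Qed.

(** The factor [2 * lambda * sigma] is what makes the incremental coefficients
of the scheme add up to at most one. *)
Lemma numerical_flux_near k : exists C : R,
  [/\ 0 <= C, forall x, 2 * lambda * sigma P k x * C <= 1 &
   forall a, `|a| <= sup_norm (nu P k) -> forall b c,
     `|numerical_flux P sch lambda k a b c - a * flux P k b| <= C * `|c - b| /\
     `|numerical_flux P sch lambda k a b c - a * flux P k c| <= C * `|c - b|].
Proof.
have [L0 fL] := flux_Lip k; set L := Lip _ in L0 fL.
have [_ /= [/bounded_ex[Bn nB] _] _ _ _] := hyp2 k.
set n := sup_norm _.
have n0 : 0 <= n by apply: le_trans (le_sup_norm nB 0).
have sle := sigma_le_norm k; have sgt := sigma_gt0 k.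
set s := sigma_norm P k in sle.
have s0 : 0 < s := lt_le_trans (sgt 0) (sle 0).
have ls y : 0 <= y -> lambda * s * y <= 1 / 2 ->
    forall x, 2 * lambda * sigma P k x * y <= 1.
  move=> y0 lsy x; apply: le_trans (_ : 2 * lambda * s * y <= _); last by lra.
  by rewrite ler_wpM2r// ler_wpM2l// mulr_ge0// ltW.
move: Hcfl; rewrite /CFL /numerical_flux; case: sch => [theta|] /(_ k).
- move=> [/andP[t0 ts]].
  rewrite -/s -/L -/n => cfl.
  (* of the three bounds in the CFL condition, the one that limits the viscosity *)
  have lcfl : lambda * (1 + 6 * s * L * n) <= 4 - 6 * theta * s.
    have d0 : 0 < 1 + 6 * s * L * n.
      by rewrite ltr_wpDr// !mulr_ge0// ltW.
    move: cfl; rewrite ler_pdivlMr// => /le_trans; apply.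
    by rewrite ge_min; apply/orP; right; rewrite ge_min lexx.
  have tl : theta / (2 * lambda) * lambda = theta / 2 by field; rewrite gt_eqF.
  (* the central part and the artificial viscosity of the flux *)
  exists (n * L / 2 + theta / (2 * lambda)); split.
  + by rewrite addr_ge0 ?divr_ge0 ?mulr_ge0// ltW.
  + apply: ls; first by rewrite addr_ge0 ?divr_ge0 ?mulr_ge0// ltW.
    have -> : lambda * s * (n * L / 2 + theta / (2 * lambda)) =
        (lambda * (s * L * n)) / 2 + s * (theta / (2 * lambda) * lambda) by ring.
    rewrite tl; move: lcfl lambda0; rewrite mulrDr mulr1.
    rewrite (_ : lambda * (6 * s * L * n) = 6 * (lambda * (s * L * n))); last by ring.
    rewrite (_ : 6 * theta * s = 6 * (s * theta)); last by ring.
    rewrite (_ : s * (theta / 2) = s * theta / 2); last by ring.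
    move: (lambda * (s * L * n)) (s * theta) => X Y; lra.
  + move=> a an b c; have := fL b c; set D := flux P k c - flux P k b => Dbc.
    have tl0 : 0 <= theta / (2 * lambda) by rewrite divr_ge0 ?mulr_ge0// ltW.
    have aD : `|a / 2 * D| <= n * L / 2 * `|c - b|.
      have -> : n * L / 2 * `|c - b| = (n / 2) * (L * `|c - b|) by ring.
      rewrite normrM ler_pM// normrM [`|2^-1|]ger0_norm ?invr_ge0//.
      by rewrite ler_wpM2r// invr_ge0.
    have tD : `|theta / (2 * lambda) * (c - b)| = theta / (2 * lambda) * `|c - b|.
      by rewrite normrM ger0_norm.
    have -> : a / 2 * (flux P k b + flux P k c) - theta / (2 * lambda) * (c - b) -
       a * flux P k b = a / 2 * D - theta / (2 * lambda) * (c - b).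
      by rewrite /D; field; rewrite gt_eqF.
    have -> : a / 2 * (flux P k b + flux P k c) - theta / (2 * lambda) * (c - b) -
       a * flux P k c = - (a / 2 * D) - theta / (2 * lambda) * (c - b).
      by rewrite /D; field; rewrite gt_eqF.
    rewrite [_ * `|c - b|]mulrDl; split; apply: le_trans (ler_normB _ _) _.
      by rewrite tD lerD2r.
    by rewrite normrN tD lerD2r.
- rewrite -/s -/L -/n => cfl.
  exists (n * L); split; first by rewrite mulr_ge0.
    apply: ls; first by rewrite mulr_ge0.
    rewrite (_ : lambda * s * (n * L) = lambda * (s * L * n)); last by ring.
    by apply: le_trans cfl _; lra.
  move=> a an b c; have [g1 g2] := godunov_near L0 fL b c.
  by rewrite -!mulrBr !normrM -!mulrA; split; rewrite ler_pM.
Qed.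

Lemma numerical_flux_diag k a b : numerical_flux P sch lambda k a b b = a * flux P k b.
Proof.
rewrite /numerical_flux; case: sch => [theta|].
  by field; rewrite gt_eqF.
by rewrite /godunov lexx set_itv1 image_set1 inf1.
Qed.

End FluxBounds.

(** * Constants independent of the mesh *)

Section Constants.
Context {R : realType} {N : nat}.

(** The bounds on the coefficients from which the constants of the estimates are
built. They are chosen before the mesh. *)
Record constants (P : ivp R N) (sch : flux_type R) (lambda : R) := Constants {
  sig_min : R; sig_max : R; sig_var : R;
  lipf : R; visc : 'I_N -> R; reg : R;
  dnu : 'I_N -> 'I_N -> 'rV[R]_N -> R;
  dmu : 'I_N -> 'I_N -> R -> R;
  lam_gt0 : 0 < lambda;
  sig_min_gt0 : 0 < sig_min;
  sig_ge : forall k x, sig_min <= sigma P k x;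
  sig_le : forall k x, sigma P k x <= sig_max;
  sig_bv : forall k, bv_le (sigma P k) sig_var;
  lipf_ge0 : 0 <= lipf;
  flux_lip : forall k x y, `|flux P k y - flux P k x| <= lipf * `|y - x|;
  flux0 : forall k, flux P k 0 = 0;
  nu_reg : forall k, regular_field (nu P k) (dnu k) reg;
  mu_reg : forall k j, regular_kernel (mu P k j) (dmu k j) reg;
  visc_ge0 : forall k, 0 <= visc k;
  visc_small : forall k x, 2 * lambda * sigma P k x * visc k <= 1;
  flux_near : forall k c b b', let a := nu P k c in
    `|numerical_flux P sch lambda k a b b' - a * flux P k b| <= visc k * `|b' - b| /\
    `|numerical_flux P sch lambda k a b b' - a * flux P k b'| <= visc k * `|b' - b|
}.

Lemma sig_max_ge0 (P : ivp R N) sch lambda (C : constants P sch lambda) (k : 'I_N) :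
  0 <= sig_max C.
Proof. exact: le_trans (ltW (sig_min_gt0 C)) (le_trans (sig_ge C k 0) (sig_le C k 0)). Qed.

Lemma uniform_bound (n : nat) (Q : 'I_n -> R -> Prop) :
  (forall k, exists B, Q k B) -> (forall k B B', B <= B' -> Q k B -> Q k B') ->
  exists2 B, 0 <= B & forall k, Q k B.
Proof.
move=> /choice[B QB] mono; exists (\sum_k `|B k|); first exact: sumr_ge0.
move=> k; apply: mono (QB k).
by rewrite (bigD1 k)//= (le_trans (ler_norm _))// lerDl sumr_ge0.
Qed.

Lemma regular_kernel_weak (m dm : R -> R) B B' : B <= B' ->
  regular_kernel m dm B -> regular_kernel m dm B'.
Proof.
move=> BB' [B0 h1 h2 h3 [h4 h5]].
split; [exact: le_trans BB'|move=> x; exact: le_trans BB'|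
  move=> x; exact: le_trans BB'|move=> x y|split => x y].
- by apply: le_trans (h3 x y) _; rewrite ler_wpM2r.
- by apply: le_trans (h4 x y) _; rewrite ler_wpM2r.
- by apply: le_trans (h5 x y) _; rewrite ler_wpM2r// exprn_ge0.
Qed.

Lemma regular_field_weak n (g : 'rV[R]_n -> R) dg B B' : B <= B' ->
  regular_field g dg B -> regular_field g dg B'.
Proof.
move=> BB' [B0 h1 h2 h3 [h4 h5]].
split; [exact: le_trans BB'|move=> x; exact: le_trans BB'|
  move=> j x; exact: le_trans BB'|move=> x y|split=> [j x y|x y]].
- by apply: le_trans (h3 x y) _; rewrite ler_wpM2r// norm1_ge0.
- by apply: le_trans (h4 j x y) _; rewrite ler_wpM2r// norm1_ge0.
- by apply: le_trans (h5 x y) _; rewrite ler_wpM2r// exprn_ge0// norm1_ge0.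
Qed.

(** The components are finitely many, so all bounds can be taken common to them. *)
Lemma exists_constants (P : ivp R N) sch lambda : (0 < N)%N ->
  H1 P -> H2 P -> H3 P -> 0 < lambda -> CFL P sch lambda ->
  inhabited (constants P sch lambda).
Proof.
move=> N0 h1 h2 h3 l0 cfl.
have [smin smin0 smin_le] : exists2 s : R, 0 < s & forall k x, s <= sigma P k x.
  pose inf_ k := inf (range (sigma P k)).
  have i0 k : 0 < inf_ k by have [] := h3 k.
  pose k0 := Ordinal N0; have [k _ kmin] := @arg_minP _ _ _ k0 xpredT inf_ isT.
  by exists (inf_ k) => // l x; apply: le_trans (kmin l isT) _; exact: sigma_ge_inf.
have [smax _ smaxP] : exists2 B, 0 <= B & forall k, forall x, sigma P k x <= B.
  apply: uniform_bound => [k|k B B' BB' h x]; last exact: le_trans BB'.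
  by exists (sigma_norm P k) => x; exact: sigma_le_norm.
have [sV _ sVP] : exists2 B, 0 <= B & forall k, bv_le (sigma P k) B.
  apply: uniform_bound => [k|k B B' BB']; last exact: bv_le_weak.
  by have [/TV_bv_le] := h3 k.
have [L L0 LP] : exists2 B, 0 <= B & forall k, forall x y,
    `|flux P k y - flux P k x| <= B * `|y - x|.
  apply: uniform_bound => [k|k B B' BB' h x y].
    by exists (Lip (flux P k)); have [] := flux_Lip h1 k.
  by apply: le_trans (h x y) _; rewrite ler_wpM2r.
have /choice[dn dnP] : forall k, exists dn : 'I_N -> 'rV[R]_N -> R,
    exists B, regular_field (nu P k) dn B.
  by move=> k; have [c w _ _ _] := h2 k; exact: Ck2_regular_field.
have /choice[dm dmP] : forall kj : 'I_N * 'I_N, exists dm : R -> R,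
    exists B, regular_kernel (mu P kj.1 kj.2) dm B.
  by move=> [k j]; have [_ _ _ _ /(_ j)[c w _]] := h2 k; exact: Ck2_regular_kernel.
have [B1 _ B1P] := uniform_bound dnP (fun k B B' => @regular_field_weak N _ _ B B').
have [B2 _ B2P] : exists2 B, 0 <= B & forall k, forall j, regular_kernel (mu P k j) (dm (k, j)) B.
  apply: uniform_bound => [k|k B B' BB' h j]; last exact: regular_kernel_weak (h j).
  have [B _ BP] := uniform_bound (fun j => dmP (k, j))
    (fun j B B' => @regular_kernel_weak _ _ B B').
  by exists B.
have /choice[C CP] := numerical_flux_near h1 h2 h3 l0 cfl.
have B12 : B1 <= `|B1| + `|B2| by rewrite (le_trans (ler_norm _))// lerDl.
have B21 : B2 <= `|B1| + `|B2| by rewrite (le_trans (ler_norm _))// lerDr.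
constructor; apply: (@Constants _ _ _ smin smax sV L C (`|B1| + `|B2|) dn
  (fun k j => dm (k, j))) => //.
- by move=> k; have [] := h1 k.
- by move=> k; exact: regular_field_weak (B1P k).
- by move=> k j; exact: regular_kernel_weak (B2P k j).
- by move=> k; have [] := CP k.
- by move=> k; have [] := CP k.
- move=> k c b b' /=; have [_ _] := CP k; apply; apply: le_sup_norm.
  by have [_ nB _ _ _] := B1P k; exact: nB.
Qed.

End Constants.

Section Kernels.
Context {R : realType}.
Implicit Types (a e : int -> R) (A D : R).

Lemma l1Z_kernel a e D A : 0 <= D -> (forall p, `|a p| <= D) ->
  (l1Z e <= A%:E)%E -> (l1Z (fun p => a p * e p)%R <= (D * A)%:E)%E.
Proof.
by move=> D0 aD; apply: l1Z_leM => // p; rewrite normrM ler_wpM2r.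
Qed.

Lemma zsum_kernel a e D A : 0 <= D -> (forall p, `|a p| <= D) ->
  (l1Z e <= A%:E)%E -> `|zsum (fun p => a p * e p)| <= D * A.
Proof. by move=> D0 aD eA; apply: zsum_le; exact: l1Z_kernel. Qed.

Lemma zsum_kernelB a a' e D A : 0 <= D -> (forall p, `|a p| <= D) ->
  (forall p, `|a' p| <= D) -> (l1Z e <= A%:E)%E ->
  zsum (fun p => a p * e p) - zsum (fun p => a' p * e p) =
  zsum (fun p => (a p - a' p) * e p).
Proof.
move=> D0 aD aD' eA; rewrite -(@zsumB _ _ _ (D * A) (D * A)).
- by congr zsum; apply/funext => p; rewrite mulrBl.
- exact: l1Z_kernel.
- exact: l1Z_kernel.
Qed.

(** The values at the edges are convex combinations of neighbouring cell values. *)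
Lemma l1Z_edge (kappa : R) (u : int -> R) A : 0 <= kappa <= 1 ->
  (l1Z u <= A%:E)%E -> (l1Z (edge kappa u) <= A%:E)%E.
Proof.
move=> /andP[k0 k1] uA; have -> : A = kappa * A + (1 - kappa) * A by ring.
apply: (@l1Z_leD _ (fun p => kappa * u p) (fun p => (1 - kappa) * u (p + 1))).
- by move=> p; exact: ler_normD.
- by apply: l1Z_leM uA => // p; rewrite normrM ger0_norm.
- apply: (@l1Z_leM _ _ (fun p => u (p + 1))); rewrite ?subr_ge0//.
    by move=> p; rewrite normrM ger0_norm// subr_ge0.
  by rewrite l1Z_shift.
Qed.

End Kernels.

(** * The discrete velocities *)

Section Velocity.
Context {R : realType} {N : nat}.
Variables (P : ivp R N) (sch : flux_type R) (lambda kappa dx mass : R).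
Variable C : constants P sch lambda.
Context (kappa01 : 0 <= kappa <= 1) (dx0 : 0 < dx) (mass0 : 0 <= mass).
Implicit Types (u : 'I_N -> int -> R) (k : 'I_N) (i : int).

Let B := reg C.

Lemma reg_ge0 (k : 'I_N) : 0 <= B.
Proof. by have [] := nu_reg C k. Qed.

Definition mass_le u := forall k, (l1Z (u k) <= (mass / dx)%:E)%E.

Context (u : 'I_N -> int -> R) (um : mass_le u).

Let edge_mass j := l1Z_edge kappa01 (um j).

Lemma cvec_diff1 k i j :
  `|cvec P kappa dx u k i 0 j - cvec P kappa dx u k (i - 1) 0 j| <= B * mass * dx.
Proof.
have [B0 mB dmB mL _] := mu_reg C k j; rewrite -/B in B0 mB dmB mL.
rewrite !mxE -mulrBr (@zsum_kernelB _ _ _ _ B (mass / dx))//.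
rewrite normrM (gtr0_norm dx0) [leRHS]mulrC ler_wpM2l ?(ltW dx0)//.
apply: le_trans (zsum_kernel (D := B * dx) _ _ (edge_mass j)) _.
- by rewrite mulr_ge0// ltW.
- move=> p; apply: le_trans (mL _ _) _; rewrite ler_wpM2l//.
  rewrite (_ : xhalf dx (i - p) - xhalf dx (i - 1 - p) = dx) ?gtr0_norm//.
  by rewrite !xhalfE !intrB; ring.
- by rewrite le_eqVlt; apply/orP; left; apply/eqP; field; rewrite gt_eqF.
Qed.

(** The two increments of the kernel differ at second order, by Taylor's formula
at the middle point. *)
Lemma cvec_diff2 k i j :
  `|cvec P kappa dx u k (i + 1) 0 j - 2 * cvec P kappa dx u k i 0 j +
    cvec P kappa dx u k (i - 1) 0 j| <= 2 * B * mass * dx ^+ 2.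
Proof.
have [B0 mB dmB mL [_ mT]] := mu_reg C k j; rewrite -/B in B0 mB dmB mL mT.
have -> : cvec P kappa dx u k (i + 1) 0 j - 2 * cvec P kappa dx u k i 0 j +
    cvec P kappa dx u k (i - 1) 0 j =
  (cvec P kappa dx u k (i + 1) 0 j - cvec P kappa dx u k i 0 j) -
  (cvec P kappa dx u k i 0 j - cvec P kappa dx u k (i - 1) 0 j) by ring.
rewrite !mxE -!mulrBr (@zsum_kernelB _ _ _ _ B (mass / dx))//.
rewrite (@zsum_kernelB _ _ _ _ B (mass / dx))//.
have D0 : 0 <= 2 * B by rewrite mulr_ge0.
have DB x y : `|mu P k j x - mu P k j y| <= 2 * B.
  by apply: le_trans (ler_normB _ _) _; have := mB x; have := mB y; lra.
rewrite (@zsum_kernelB _ _ _ _ (2 * B) (mass / dx))//.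
rewrite normrM (gtr0_norm dx0).
apply: (@le_trans _ _ (dx * (2 * B * dx ^+ 2 * (mass / dx)))); last first.
  by rewrite le_eqVlt; apply/orP; left; apply/eqP; field; rewrite gt_eqF.
rewrite ler_wpM2l ?(ltW dx0)//.
apply: zsum_kernel (edge_mass j); first by rewrite mulr_ge0// exprn_ge0// ltW.
move=> p; set x := xhalf dx (i - p).
have -> : xhalf dx (i + 1 - p) = x + dx.
  by rewrite /x !xhalfE !intrB intrD; ring.
have -> : xhalf dx (i - 1 - p) = x - dx.
  by rewrite /x !xhalfE !intrB; ring.
have := mT x (x + dx); have := mT x (x - dx).
have -> : x + dx - x = dx by ring.
have -> : x - dx - x = - dx by ring.
rewrite normrN (gtr0_norm dx0) !ler_norml.
rewrite -[2 * B * dx ^+ 2]mulrA mulrN.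
move: (B * dx ^+ 2) (dmu C k j x * dx) => Y z; lra.
Qed.

Definition vel1 : R := B * (N%:R * (B * mass)).
Definition vel2 : R := B * (N%:R * (2 * B * mass) + 2 * (N%:R * (B * mass)) ^+ 2).

Lemma vel1_ge0 (k : 'I_N) : 0 <= vel1.
Proof. by rewrite /vel1; have := reg_ge0 k => ?; rewrite !mulr_ge0//. Qed.

Lemma vel2_ge0 (k : 'I_N) : 0 <= vel2.
Proof.
rewrite /vel2; have := reg_ge0 k => B0.
by rewrite mulr_ge0// addr_ge0// !mulr_ge0// exprn_ge0// !mulr_ge0.
Qed.

Lemma norm1_cvec_diff k i :
  norm1 (cvec P kappa dx u k i - cvec P kappa dx u k (i - 1)) <= N%:R * (B * mass) * dx.
Proof.
rewrite /norm1; apply: (@le_trans _ _ (\sum_(j < N) B * mass * dx)).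
  by apply: ler_sum => j _; have := cvec_diff1 k i j; rewrite !mxE.
by rewrite sumr_const card_ord -mulr_natl le_eqVlt; apply/orP; left; apply/eqP; ring.
Qed.

Lemma vel_diff1 k i : `|vel P kappa dx u k i - vel P kappa dx u k (i - 1)| <= vel1 * dx.
Proof.
have [B0 _ _ nL _] := nu_reg C k.
apply: le_trans (nL _ _) _; rewrite /vel1 -mulrA ler_wpM2l//.
exact: norm1_cvec_diff.
Qed.

Lemma vel_diff2 k i :
  `|(vel P kappa dx u k (i + 1) - vel P kappa dx u k i) -
    (vel P kappa dx u k i - vel P kappa dx u k (i - 1))| <= vel2 * dx ^+ 2.
Proof.
have -> : (vel P kappa dx u k (i + 1) - vel P kappa dx u k i) -
    (vel P kappa dx u k i - vel P kappa dx u k (i - 1)) =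
  vel P kappa dx u k (i + 1) - 2 * vel P kappa dx u k i + vel P kappa dx u k (i - 1).
  by ring.
apply: le_trans (regular_field_diff2 _ _ _ (nu_reg C k)) _.
have B0 := reg_ge0 k.
rewrite /vel2 -mulrA ler_wpM2l// mulrDl -addrA lerD//.
  rewrite /norm1; apply: (@le_trans _ _ (\sum_(j < N) 2 * B * mass * dx ^+ 2)).
    by apply: ler_sum => j _; have := cvec_diff2 k i j; rewrite !mxE.
  by rewrite sumr_const card_ord -mulr_natl le_eqVlt; apply/orP; left; apply/eqP; ring.
have h1 := norm1_cvec_diff k (i + 1); rewrite addrK in h1.
have h2 := norm1_cvec_diff k i.
rewrite -opprB norm1N in h2 *.
have -> : 2 * (N%:R * (B * mass)) ^+ 2 * dx ^+ 2 =
  (N%:R * (B * mass) * dx) ^+ 2 + (N%:R * (B * mass) * dx) ^+ 2 by ring.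
have X0 : 0 <= N%:R * (B * mass) * dx by rewrite !mulr_ge0// ltW.
apply: lerD; first by rewrite ler_pXn2r// nnegrE norm1_ge0.
by rewrite ler_pXn2r// ?nnegrE ?norm1_ge0// -norm1N opprB.
Qed.

End Velocity.

(** * One step of the scheme *)

Section OneStep.
Context {R : realType} {N : nat}.
Variables (P : ivp R N) (sch : flux_type R) (lambda kappa dx mass : R).
Variable C : constants P sch lambda.
Context (kappa01 : 0 <= kappa <= 1) (dx0 : 0 < dx) (mass0 : 0 <= mass).
Variable u : 'I_N -> int -> R.
Context (um : mass_le dx mass u) (u0 : forall k i, 0 <= u k i).
Context (umono : forall k i bm b bp bm' b' bp',
  bm <= bm' -> b <= b' -> bp <= bp' ->
  Hfun P sch lambda dx k i (vel P kappa dx u k (i - 1)) (vel P kappa dx u k i) bm b bp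
  <= Hfun P sch lambda dx k i (vel P kappa dx u k (i - 1)) (vel P kappa dx u k i)
     bm' b' bp').

Local Notation v k i := (vel P kappa dx u k i).
Local Notation s k i := (sigma_ P dx k i).
Local Notation b k i := (bar P dx u k i).
Local Notation f k x := (flux P k x).
Local Notation F k i := (Fhalf P sch lambda kappa dx u k i).
Local Notation H k i := (Hfun P sch lambda dx k i (v k (i - 1)) (v k i)).
Local Notation u' := (step P sch lambda kappa dx u).
Let l0 : 0 < lambda := lam_gt0 C.
Let f0 k : flux P k 0 = 0 := flux0 C k.

Lemma s_gt0 k i : 0 < s k i.
Proof. exact: lt_le_trans (sig_min_gt0 C) (sig_ge C k _). Qed.

Lemma s_le k i : s k i <= sig_max C.
Proof. exact: sig_le C k _. Qed.

Lemma bar_ge0 k i : 0 <= b k i.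
Proof. by rewrite mulr_ge0// ltW// s_gt0. Qed.

Lemma bar_div k i : b k i / s k i = u k i.
Proof. by rewrite /bar mulrAC divff ?mul1r// gt_eqF// s_gt0. Qed.

Lemma stepE k i : u' k i = H k i (b k (i - 1)) (b k i) (b k (i + 1)).
Proof. by rewrite /step /Hfun bar_div. Qed.

Lemma F_diag k i x : F k i x x = v k i * f k x.
Proof. exact: numerical_flux_diag. Qed.

Lemma F_near k i x y :
  `|F k i x y - v k i * f k x| <= visc C k * `|y - x| /\
  `|F k i x y - v k i * f k y| <= visc C k * `|y - x|.
Proof. exact: flux_near C k _ x y. Qed.

(** Raising the right neighbour can only raise the update, and it acts on the
update only through this flux. *)
Lemma F_decr k i x y y' : y <= y' -> F k i x y' <= F k i x y.
Proof.
move=> yy; have := umono k i (lexx 0) (lexx x) yy.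
by rewrite /Hfun /Fhalf lerD2l lerN2 ler_pM2l// lerD2r.
Qed.

Lemma F_incr k i x x' y : x <= x' -> F k i x y <= F k i x' y.
Proof.
move=> xx; have := umono k (i + 1) xx (lexx y) (lexx 0).
by rewrite /Hfun /Fhalf addrK lerD2l lerN2 ler_pM2l// lerD2l lerN2.
Qed.

Lemma H_diag k i x : H k i x x x = x / s k i - lambda * f k x * (v k i - v k (i - 1)).
Proof.
have := F_diag k i x; have := F_diag k (i - 1) x; rewrite /Fhalf /Hfun => -> ->.
by ring.
Qed.

Lemma flux_le k x : `|f k x| <= lipf C * `|x|.
Proof. by have := flux_lip C k 0 x; rewrite f0 !subr0. Qed.

(** The zero state is a fixed point of the update, which is monotone. *)
Lemma step_ge0 k i : 0 <= u' k i.
Proof.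
rewrite stepE; apply: le_trans (umono k i (bar_ge0 k (i - 1)) (bar_ge0 k i) (bar_ge0 k (i + 1))).
by rewrite H_diag f0 mulr0 !mul0r subrr.
Qed.

(** With empty neighbours a cell only loses mass, through both edges, and its
updated content is nonnegative; so the loss through one edge is at most the
content, and a nonempty neighbour can only lower it. *)
Lemma F_le_content k i : lambda * F k i (b k i) (b k (i + 1)) <= u k i.
Proof.
apply: (@le_trans _ _ (lambda * F k i (b k i) 0)).
  by rewrite ler_pM2l// F_decr// bar_ge0.
have := umono k i (lexx 0) (bar_ge0 k i) (lexx 0).
rewrite H_diag f0 mulr0 !mul0r subrr /Hfun bar_div.
have : F k (i - 1) 0 (b k i) <= F k (i - 1) 0 0 by rewrite F_decr// bar_ge0.
rewrite F_diag f0 mulr0 /Fhalf.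
move: (numerical_flux _ _ _ _ _ _ _) (numerical_flux _ _ _ _ _ _ _) => X Y.
have := l0; nra.
Qed.

Lemma F_ge_content k i : - (lambda * F k i (b k i) (b k (i + 1))) <= u k (i + 1).
Proof.
apply: (@le_trans _ _ (- (lambda * F k i 0 (b k (i + 1))))).
  by rewrite lerN2 ler_pM2l// F_incr// bar_ge0.
have := umono k (i + 1) (lexx 0) (bar_ge0 k (i + 1)) (lexx 0).
rewrite H_diag f0 mulr0 !mul0r subrr /Hfun bar_div addrK.
have : F k (i + 1) 0 0 <= F k (i + 1) (b k (i + 1)) 0 by rewrite F_incr// bar_ge0.
rewrite F_diag f0 mulr0 /Fhalf.
move: (numerical_flux _ _ _ _ _ _ _) (numerical_flux _ _ _ _ _ _ _) => X Y.
have := l0; nra.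
Qed.

Lemma l1Z_bar k : (l1Z (fun i => b k i) <= (sig_max C * (mass / dx))%:E)%E.
Proof.
apply: l1Z_leM (um k); first exact: (sig_max_ge0 C k).
by move=> i; rewrite normrM (gtr0_norm (s_gt0 _ _)) ler_wpM2r// s_le.
Qed.

Lemma l1Z_F k : exists A : R,
  (l1Z (fun i => lambda * F k i (b k i) (b k (i + 1)))%R <= A%:E)%E.
Proof.
exists (mass / dx + mass / dx); apply: (@l1Z_leD _ (u k) (fun i => u k (i + 1))) => //.
  move=> i; rewrite (ger0_norm (u0 _ _)) (ger0_norm (u0 _ _)) ler_norml.
  have := F_le_content k i; have := F_ge_content k i; have := u0 k i; have := u0 k (i + 1).
  lra.
by rewrite l1Z_shift.
Qed.

Lemma step_mass k : l1Z (u' k) = l1Z (u k).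
Proof.
have [A FA] := l1Z_F k.
apply: (@l1Z_conservation _ (u k) (u' k) _ A _ _ _ FA) => // i; first exact: step_ge0.
by rewrite /step subrK mulrBr.
Qed.

Definition cut (r : nat) (a : int -> R) (i : int) : R :=
  if (r <= absz i)%N then a i else 0.

(** Fluxes through the edges of the cut are replaced by the full content of the
last cell, which turns the update outside the cut into a conservative one. *)
Lemma step_cut k (r : nat) : (0 < r)%N -> (l1Z (cut r.+1 (u' k)) <= l1Z (cut r (u k)))%E.
Proof using C um u0 umono.
clear kappa01 dx0 mass0.
move=> r0.
pose Phi i := lambda * F k i (b k i) (b k (i + 1)).
pose G (i : int) : R := if (r%:Z < i)%R || (i < - (r.+1)%:Z)%R then Phi i
  else if i == r%:Z then u k i else if i == - (r.+1)%:Z then - u k (i + 1) else 0.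
pose w (i : int) : R := cut r (u k) i - (G i - G (i - 1)).
have uE i : u' k i = u k i - (Phi i - Phi (i - 1)).
  by rewrite /step /Phi subrK mulrBr.
have wE i : 0 <= w i /\ cut r.+1 (u' k) i <= w i.
  have := step_ge0 k i; rewrite {1}uE /w /cut /G uE.
  have := F_le_content k i; have := F_ge_content k i.
  have := F_le_content k (i - 1); have := F_ge_content k (i - 1).
  rewrite subrK -/(Phi i) -[lambda * _ k (i - 1) _ _]/(lambda * F k (i - 1) (b k (i - 1)) (b k i)).
  have -> : lambda * F k (i - 1) (b k (i - 1)) (b k i) = Phi (i - 1) by rewrite /Phi subrK.
  have := u0 k i; have := u0 k (i - 1); have := u0 k (i + 1).
  have [ri|ri] := leqP r (absz i); have [ri'|ri'] := leqP r.+1 (absz i);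
  do 2 (case: ifP => ?; [|case: ifP => ?; [|case: ifP => ?]]);
  by [exfalso; lia | lra].
have cut0 i : 0 <= cut r (u k) i by rewrite /cut; case: ifP.
have w0 i : 0 <= w i by have [] := wE i.
rewrite -(@l1Z_conservation _ (cut r (u k)) w G _ cut0 w0 (fun=> erefl)
  (_ : (l1Z G <= (mass / dx + mass / dx)%:E)%E)).
  apply: l1Z_le => i; rewrite (ger0_norm (w0 i)) ger0_norm; first by have [] := wE i.
  by rewrite /cut; case: ifP => // _; exact: step_ge0.
apply: (@l1Z_leD _ (u k) (fun i => u k (i + 1))) => //; last by rewrite l1Z_shift.
move=> i; rewrite (ger0_norm (u0 _ _)) (ger0_norm (u0 _ _)) ler_norml.
have := F_le_content k i; have := F_ge_content k i; have := u0 k i; have := u0 k (i + 1).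
rewrite /G -/(Phi i); case: ifP => _; [lra|case: ifP => _; [lra|case: ifP => _; lra]].
Qed.

(** By monotonicity the update is at most the update of the constant state [M] of
[bar u], which moves only because the velocity is not constant in space. *)
Lemma step_sup k (M : R) : 0 <= M -> (forall i, b k i <= M) -> forall i,
  bar P dx u' k i <= M * (1 + sig_max C * lipf C * vel1 mass C * dt lambda dx).
Proof.
move=> M0 bM i; rewrite {1}/bar stepE.
have V0 := vel1_ge0 C mass0 k; set V := vel1 _ _ in V0 *.
have L0 := lipf_ge0 C; have S0 := sig_max_ge0 C k.
have hH : H k i (b k (i - 1)) (b k i) (b k (i + 1)) <= M / s k i + lambda * (lipf C * M * (V * dx)).
  apply: le_trans (umono k i (bM (i - 1)) (bM i) (bM (i + 1))) _.
  rewrite H_diag lerD2l -mulrA -mulrN ler_wpM2l ?(ltW l0)//.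
  apply: le_trans (ler_norm _) _; rewrite normrN normrM ler_pM//.
    by apply: le_trans (flux_le _ _) _; rewrite (ger0_norm M0).
  exact: vel_diff1.
apply: le_trans (ler_wpM2l (ltW (s_gt0 k i)) hH) _.
have sn0 : s k i != 0 by rewrite gt_eqF// s_gt0.
rewrite (_ : s k i * _ = M + s k i * (lambda * (lipf C * M * (V * dx)))); last by field.
rewrite (_ : M * _ = M + sig_max C * (lambda * (lipf C * M * (V * dx)))); last first.
  by rewrite /dt; ring.
have dxl0 := ltW dx0; have ll0 := ltW l0; clearbody V.
by rewrite lerD2l ler_wpM2r ?s_le// !mulr_ge0//.
Qed.

(** Incremental form: the flux is compared at the edge [i + 1/2] with the exact
flux of the left and of the right state. Both differences are multiples of the
jump [d], with nonnegative coefficients by monotonicity of the flux and with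
sum at most one after multiplication by [sigma], by the CFL condition. *)
Let A k i := lambda * (v k i * f k (b k i) - F k i (b k i) (b k (i + 1))).
Let B k i := lambda * (v k i * f k (b k (i + 1)) - F k i (b k i) (b k (i + 1))).
Let d k i := b k (i + 1) - b k i.

Let A_le k i : `|A k i| <= lambda * visc C k * `|d k i|.
Proof.
rewrite normrM (gtr0_norm l0) -mulrA ler_wpM2l ?(ltW l0)// distrC.
by have [] := F_near k i (b k i) (b k (i + 1)).
Qed.

Let B_le k i : `|B k i| <= lambda * visc C k * `|d k i|.
Proof.
rewrite normrM (gtr0_norm l0) -mulrA ler_wpM2l ?(ltW l0)// distrC.
by have [] := F_near k i (b k i) (b k (i + 1)).
Qed.

Let AB_sign k i : (0 <= d k i /\ 0 <= A k i /\ 0 <= B k i) \/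
  (d k i <= 0 /\ A k i <= 0 /\ B k i <= 0).
Proof.
rewrite /A /B /d; rewrite -!F_diag; have [h|/ltW h] := leP (b k i) (b k (i + 1)).
  left; rewrite subr_ge0; split => //.
  by split; rewrite mulr_ge0 ?subr_ge0 ?(ltW l0)//; [exact: F_decr|exact: F_incr].
right; rewrite subr_le0; split => //.
by split; rewrite pmulr_rle0// subr_le0; [exact: F_decr|exact: F_incr].
Qed.

Let g k i := v k i - v k (i - 1).

Let step_incr k i : u' k i = u k i + A k i - B k (i - 1) - lambda * f k (b k i) * g k i.
Proof. by rewrite /step /A /B /g subrK; ring. Qed.

Let bar_step k i : bar P dx u' k i =
  b k i + s k i * A k i - s k i * B k (i - 1) - lambda * s k i * f k (b k i) * g k i.
Proof. by rewrite {1}/bar step_incr /bar; ring. Qed.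

Definition bv_rate : R := sig_max C * lipf C * vel1 mass C.
(** The variation created, per unit of time, by the coefficient [sigma] and by the
curvature of the velocity. *)
Definition bv_source (M : R) : R := sig_var C * (lipf C * M * vel1 mass C) +
  sig_max C * lipf C * vel2 mass C * (sig_max C * mass).

Lemma zTV_sigma k : (zTV (fun i => s k i) <= (sig_var C)%:E)%E.
Proof using dx0.
clear kappa01 mass0.
have [W [WV gW]] := sig_bv C k.
apply: (@l1Z_telescope _ _ (fun i => W (xgrid dx i))) => [i|i]; first exact: WV.
by apply: gW; rewrite /xgrid ler_pM2r// ler_int; lia.
Qed.

(** Fractions of each jump of [bar u] are passed on to the neighbouring edges, which
does not create variation; the remaining part is a discrete
derivative of the product of coefficient, flux and increment of the velocity. *)
Lemma step_TV k (M V : R) : 0 <= M -> (forall i, b k i <= M) ->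
  (zTV (bar P dx u k) <= V%:E)%E ->
  (zTV (bar P dx u' k) <=
   (V + (bv_rate * V + bv_source M) * dt lambda dx)%:E)%E.
Proof.
move=> M0 bM bV.
have V10 := vel1_ge0 C mass0 k; have V20 := vel2_ge0 C mass0 k.
have L0 := lipf_ge0 C; have S0 := sig_max_ge0 C k.
rewrite /bv_rate /bv_source; set V1 := vel1 _ _ in V10 *; set V2 := vel2 _ _ in V20 *.
have gV i : `|g k (i + 1)| <= V1 * dx by exact: vel_diff1.
have gV2 i : `|g k (i + 1) - g k i| <= V2 * dx ^+ 2.
  by have := vel_diff2 C kappa01 dx0 mass0 um k i; rewrite /g addrK.
clearbody V1 V2.
pose S i := lambda * (s k (i + 1) * f k (b k (i + 1)) * g k (i + 1) -
  s k i * f k (b k i) * g k i).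
pose p i := s k i * `|A k i|.
pose q i := s k (i + 1) * `|B k i|.
have p0 i : 0 <= p i by rewrite mulr_ge0// ltW// s_gt0.
have q0 i : 0 <= q i by rewrite mulr_ge0// ltW// s_gt0.
have half i : s k i * (lambda * visc C k) <= 1 / 2.
  by have := visc_small C k (xgrid dx i); rewrite -/(s k i) => h; lra.
have pq i : p i + q i <= `|d k i|.
  rewrite [leRHS](_ : _ = 1 / 2 * `|d k i| + 1 / 2 * `|d k i|); last by field.
  apply: lerD.
    apply: (@le_trans _ _ (s k i * (lambda * visc C k * `|d k i|))).
      by rewrite ler_wpM2l ?A_le// ltW// s_gt0.
    by rewrite mulrA ler_wpM2r.
  apply: (@le_trans _ _ (s k (i + 1) * (lambda * visc C k * `|d k i|))).
    by rewrite ler_wpM2l ?B_le// ltW// s_gt0.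
  by rewrite mulrA ler_wpM2r.
rewrite mulrDl.
have -> : V + (sig_max C * lipf C * V1 * V * dt lambda dx +
   (sig_var C * (lipf C * M * V1) + sig_max C * lipf C * V2 * (sig_max C * mass)) * dt lambda dx) =
   V + ((lambda * (sig_max C * lipf C * (V1 * dx))) * V +
   ((lambda * (lipf C * M * (V1 * dx))) * sig_var C +
    (lambda * (sig_max C * lipf C * (V2 * dx ^+ 2))) * (sig_max C * (mass / dx)))).
  by rewrite /dt; field; rewrite gt_eqF.
have dxl0 := ltW dx0; have ll0 := ltW l0.
apply: (@l1Z_transfer _ (d k) p q S) => //; last first.
  (* discrete Leibniz rule: increments of the state, of [sigma], of the velocity *)
  pose S1 i := lambda * (s k (i + 1) * (f k (b k (i + 1)) - f k (b k i)) * g k (i + 1)).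
  pose S2 i := lambda * ((s k (i + 1) - s k i) * f k (b k i) * g k (i + 1)).
  pose S3 i := lambda * (s k i * f k (b k i) * (g k (i + 1) - g k i)).
  apply: (@l1Z_leD _ S1 (fun i => S2 i + S3 i)).
  - move=> i; rewrite [S i](_ : _ = S1 i + (S2 i + S3 i)); last first.
      by rewrite /S /S1 /S2 /S3; ring.
    exact: ler_normD.
  - apply: (@l1Z_leM _ _ (d k)) => //; first by rewrite !mulr_ge0//.
    move=> i; rewrite normrM (gtr0_norm l0) -[leRHS]mulrA ler_wpM2l//.
    rewrite normrM (_ : _ * _ * `|d k i| = (sig_max C * (lipf C * `|d k i|)) * (V1 * dx)); last by ring.
    rewrite ler_pM// normrM (gtr0_norm (s_gt0 _ _)) ler_pM// ?s_le//.
      by rewrite ltW// s_gt0.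
    exact: flux_lip.
  apply: (@l1Z_leD _ S2 S3); first by move=> i; exact: ler_normD.
  - apply: (@l1Z_leM _ _ _ _ _ _ _ (zTV_sigma k)); first by rewrite !mulr_ge0//.
    move=> i; rewrite normrM (gtr0_norm l0) -[leRHS]mulrA ler_wpM2l//.
    rewrite normrM (_ : _ * `|s k (i + 1) - s k i| = (`|s k (i + 1) - s k i| * (lipf C * M)) * (V1 * dx)); last by ring.
    rewrite ler_pM// normrM ler_wpM2l//.
    apply: le_trans (flux_le _ _) _; rewrite ler_wpM2l//.
    by rewrite ger0_norm// bar_ge0.
  - apply: (@l1Z_leM _ _ _ _ _ _ _ (l1Z_bar k)); first by rewrite !mulr_ge0// exprn_ge0.
    move=> i; rewrite normrM (gtr0_norm l0) -[leRHS]mulrA ler_wpM2l//.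
    rewrite normrM (_ : _ * `|b k i| = (sig_max C * (lipf C * `|b k i|)) * (V2 * dx ^+ 2)); last by ring.
    rewrite ler_pM//.
      rewrite normrM (gtr0_norm (s_gt0 _ _)) ler_pM// ?s_le//.
        by rewrite ltW// s_gt0.
      exact: flux_le.
move=> i; rewrite !bar_step !addrK.
rewrite /p /q subrK.
have -> : b k (i + 1) + s k (i + 1) * A k (i + 1) - s k (i + 1) * B k i -
   lambda * s k (i + 1) * f k (b k (i + 1)) * g k (i + 1) -
   (b k i + s k i * A k i - s k i * B k (i - 1) - lambda * s k i * f k (b k i) * g k i) =
   (d k i - s k i * A k i - s k (i + 1) * B k i) + s k (i + 1) * A k (i + 1) +
   s k i * B k (i - 1) - S i by rewrite /S /d; ring.
apply: le_trans (ler_normB _ _) _; rewrite lerD2r.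
apply: le_trans (ler_normD _ _) _; apply: lerD; last by rewrite normrM (gtr0_norm (s_gt0 _ _)).
apply: le_trans (ler_normD _ _) _; apply: lerD; last by rewrite normrM (gtr0_norm (s_gt0 _ _)).
have := pq i; rewrite /p /q; have := s_gt0 k i; have := s_gt0 k (i + 1).
have [[d0 [A0 B0]]|[d0 [A0 B0]]] := AB_sign k i.
  by rewrite (ger0_norm d0) (ger0_norm A0) (ger0_norm B0) => _ _ h; rewrite ger0_norm//; lra.
by rewrite (ler0_norm d0) (ler0_norm A0) (ler0_norm B0) => _ _ h; rewrite ler0_norm; lra.
Qed.

Lemma step_time k (V : R) : (zTV (bar P dx u k) <= V%:E)%E ->
  (l1Z (fun i => u' k i - u k i)%R <=
   (lambda * (2 * visc C k * V + lipf C * vel1 mass C * (sig_max C * mass)))%:E)%E.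
Proof.
move=> bV; have V10 := vel1_ge0 C mass0 k; set V1 := vel1 _ _ in V10 *.
have gV i : `|g k i| <= V1 * dx by exact: vel_diff1.
clearbody V1.
have L0 := lipf_ge0 C; have vc := visc_ge0 C k.
have dxl0 := ltW dx0; have ll0 := ltW l0.
have -> : lambda * (2 * visc C k * V + lipf C * V1 * (sig_max C * mass)) =
  lambda * visc C k * V + (lambda * visc C k * V +
    (lambda * (lipf C * (V1 * dx))) * (sig_max C * (mass / dx))).
  by field; rewrite gt_eqF.
apply: (@l1Z_leD _ (A k) (fun i => - B k (i - 1) - lambda * f k (b k i) * g k i)).
- by move=> i; rewrite step_incr; apply: le_trans (ler_normD _ _); rewrite le_eqVlt;
    apply/orP; left; apply/eqP; congr (`|_|); ring.
- by apply: (@l1Z_leM _ _ (d k)) => //; rewrite mulr_ge0.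
apply: (@l1Z_leD _ (fun i => B k (i - 1)) (fun i => lambda * f k (b k i) * g k i)).
- by move=> i; apply: le_trans (ler_normB _ _) _; rewrite normrN.
- by rewrite (l1Z_shift (B k)); apply: (@l1Z_leM _ _ (d k)) => //; rewrite mulr_ge0.
apply: (@l1Z_leM _ _ _ _ _ _ _ (l1Z_bar k)); first by rewrite !mulr_ge0//.
move=> i; rewrite normrM normrM (gtr0_norm l0) -!mulrA ler_wpM2l//.
rewrite (_ : lipf C * _ = (lipf C * `|b k i|) * (V1 * dx)); last by ring.
by rewrite ler_pM// flux_le.
Qed.

(** Monotonicity compares the update of the data with the updates of its maximum
and of its minimum with the profile [alpha / sigma]. The profile itself is moved
by the variation of the velocity, which gives the last term. *)
Lemma step_entropy k i (alpha : R) :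
  let G := entropy_flux P sch lambda kappa dx u k in
  let a := alpha / s k i in
  `|u' k i - a| - `|u k i - a|
  + lambda * (G i (u k i) (u k (i + 1)) alpha - G (i - 1) (u k (i - 1)) (u k i) alpha)
  + lambda * Num.sg (u' k i - a) * f k alpha * (v k i - v k (i - 1)) <= 0.
Proof.
cbv zeta; set G := entropy_flux _ _ _ _ _ _ k; set a := alpha / s k i.
have maxE j : s k j * Num.max (u k j) (alpha / s k j) = Num.max (b k j) alpha.
  by rewrite maxr_pMr ?(ltW (s_gt0 _ _))// mulrCA divff ?mulr1// gt_eqF// s_gt0.
have minE j : s k j * Num.min (u k j) (alpha / s k j) = Num.min (b k j) alpha.
  by rewrite minr_pMr ?(ltW (s_gt0 _ _))// mulrCA divff ?mulr1// gt_eqF// s_gt0.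
pose X := H k i (Num.max (b k (i - 1)) alpha) (Num.max (b k i) alpha) (Num.max (b k (i + 1)) alpha).
pose Y := H k i (Num.min (b k (i - 1)) alpha) (Num.min (b k i) alpha) (Num.min (b k (i + 1)) alpha).
have X1 : u' k i <= X by rewrite stepE; apply: umono; rewrite le_max lexx.
have X2 : H k i alpha alpha alpha <= X by apply: umono; rewrite le_max lexx orbT.
have Y1 : Y <= u' k i by rewrite stepE; apply: umono; rewrite ge_min lexx.
have Y2 : Y <= H k i alpha alpha alpha by apply: umono; rewrite ge_min lexx orbT.
have XY : X - Y = `|u k i - a| -
    lambda * (G i (u k i) (u k (i + 1)) alpha - G (i - 1) (u k (i - 1)) (u k i) alpha).
  rewrite /X /Y /Hfun /G /entropy_flux subrK !maxE !minE.
  rewrite -!maxE -!minE.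
  have -> : `|u k i - a| = Num.max (u k i) a - Num.min (u k i) a.
    by case: (leP (u k i) a) => h; [rewrite ler0_norm|rewrite gtr0_norm]; lra.
  have ss : s k i != 0 by rewrite gt_eqF// s_gt0.
  by rewrite /Fhalf !maxE !minE -!maxE -!minE; field.
rewrite H_diag -/a in X2 Y2.
have key : `|u' k i - a + lambda * f k alpha * (v k i - v k (i - 1))| <= X - Y.
  by rewrite ler_norml; lra.
move: key; rewrite XY.
set w := u' k i - a; set z := lambda * f k alpha * _.
set GG := lambda * (_ - _).
have -> : lambda * Num.sg w * f k alpha * (v k i - v k (i - 1)) = Num.sg w * z.
  by rewrite /z; ring.
rewrite ler_norml.
have [w0|w0|w0] := ltrgtP w 0.
- by rewrite ltr0_sg// (ltr0_norm w0); lra.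
- by rewrite gtr0_sg// (gtr0_norm w0); lra.
- by rewrite w0 sgr0 normr0; lra.
Qed.

End OneStep.

(** * Cell averages of the initial data *)

Section CellAverages.
Context {R : realType}.
Local Notation leb := (@lebesgue_measure R).

Lemma lebesgue_integral_cst (A : set R) (r : \bar R) : measurable A ->
  (\int[leb]_(x in A) cst r x = r * leb A)%E.
Proof. by move=> mA; exact: integral_cst. Qed.

Lemma lebesgue_Rintegral_cst (A : set R) (r : R) : measurable A ->
  \int[leb]_(x in A) r = r * fine (leb A).
Proof. by move=> mA; exact: Rintegral_cst. Qed.

Lemma integrable_lebesgue_cst (A : set R) (r : R) : measurable A ->
  (leb A < +oo)%E -> leb.-integrable A (EFin \o cst r).
Proof.
move=> mA Afin; apply/integrableP; split.
  by apply/measurable_EFinP; exact: measurable_cst.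
rewrite (eq_integral (cst `|r|%:E))// lebesgue_integral_cst//.
by rewrite lte_mul_pinfty.
Qed.

Lemma average_near (dx : R) (i : int) (f : R -> R) (a w : R) : 0 < dx ->
  leb.-integrable [set: R] (EFin \o f) ->
  {ae leb, forall x, cell dx i x -> `|f x - a| <= w} ->
  `|(\int[leb]_(x in cell dx i) f x) / dx - a| <= w.
Proof.
move=> dx0 fi fw; have mc := measurable_cell dx i; have lc := lebesgue_cell i dx0.
have fic : leb.-integrable (cell dx i) (EFin \o f).
  by apply: integrableS fi.
have ai : leb.-integrable (cell dx i) (EFin \o cst a).
  by apply: integrable_lebesgue_cst; rewrite ?lc ?ltry.
have E : (\int[leb]_(x in cell dx i) f x) / dx - a =
    (\int[leb]_(x in cell dx i) (f x - a)) / dx.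
  rewrite RintegralB// lebesgue_Rintegral_cst// lc /=; field; rewrite gt_eqF//.
have bi : leb.-integrable (cell dx i) (EFin \o (fun x => f x - a)).
  have h := integrableB _ fic ai; exact: h.
rewrite E normrM (gtr0_norm (_ : 0 < dx^-1)) ?invr_gt0// ler_pdivrMr//.
apply: le_trans (le_normr_Rintegral _ bi) _ => //.
rewrite -lee_fin /Rintegral fineK; last first.
  by apply: integrable_fin_num => //; exact: (integrable_norm bi).
have -> : (w * dx)%:E = (\int[leb]_(x in cell dx i) (cst w%:E x))%E.
  by rewrite lebesgue_integral_cst// lc.
have w0 : 0 <= w.
  have [|x xc] := ae_exists mc _ fw; first by rewrite lc lte_fin.
  by move=> /(_ xc); apply: le_trans.
apply: ae_ge0_le_integral => //.
by apply/measurable_EFinP; apply: measurableT_comp => //; case/integrableP: bi => /measurable_EFinP.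
Qed.

End CellAverages.

Section InitialData.
Context {R : realType} {N : nat}.
Local Notation leb := (@lebesgue_measure R).

(** A representative of bounded variation is chosen for each initial component; it
has bounded values at every point, not only at almost every one. *)
Record data (P : ivp R N) := Data {
  U0v : R; U0s : R; mass : R;
  rep : 'I_N -> R -> R;
  U0v_ge0 : 0 <= U0v; U0s_ge0 : 0 <= U0s; mass_ge0 : 0 <= mass;
  rep_ae : forall k, {ae leb, forall x, rep k x = U0 P k x};
  rep_bv : forall k, bv_le (rep k) U0v;
  rep_le : forall k x, `|rep k x| <= U0s;
  U0_int : forall k, leb.-integrable [set: R] (EFin \o U0 P k);
  U0_ge0 : forall k, {ae leb, forall x, 0 <= U0 P k x};
  U0_mass : forall k, (L1_norm (U0 P k) <= mass%:E)%E }.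

Lemma exists_data (P : ivp R N) : nonneg_initial_data P -> inhabited (data P).
Proof.
move=> h.
have /choice[r rP] : forall k, exists r : R -> R, {ae leb, forall x, r x = U0 P k x} /\
    exists V, bv_le r V.
  move=> k; have [[_ /ereal_inf_lt[_ [r rae <-] rV]] _] := h k.
  by exists r; split => //; exact: TV_bv_le.
have [V V0 VP] := uniform_bound (fun k => (rP k).2) (fun k B B' => @bv_le_weak _ _ B B').
have [S S0 SP] : exists2 B, 0 <= B & forall k, forall x, `|r k x| <= B.
  apply: uniform_bound => [k|k B B' BB' H x]; last exact: le_trans BB'.
  by exists (`|r k 0| + V); exact: bv_le_bounded.
have [M M0 MP] : exists2 B, 0 <= B & forall k, (L1_norm (U0 P k) <= B%:E)%E.
  apply: uniform_bound => [k|k B B' BB' H]; last by rewrite (le_trans H)// lee_fin.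
  have [[/integrableP[_ fin] _] _] := h k.
  exists (fine (L1_norm (U0 P k))); rewrite fineK// ge0_fin_numE ?Lnorm_ge0//.
  by rewrite /L1_norm Lnorm1.
constructor; apply: (@Data P V S M r) => //.
- by move=> k; have [] := rP k.
- by move=> k; have [[]] := h k.
- by move=> k; have [] := h k.
Qed.

Variables (P : ivp R N) (D : data P) (dx : R).
Context (dx0 : 0 < dx).

Lemma initial_near k i a w :
  {ae leb, forall x, cell dx i x -> `|U0 P k x - a| <= w} ->
  `|initial P dx k i - a| <= w.
Proof. by apply: average_near => //; exact: U0_int D k. Qed.

Lemma initial_near_rep k i a w : (forall x, cell dx i x -> `|rep D k x - a| <= w) ->
  `|initial P dx k i - a| <= w.
Proof.
by move=> h; apply: initial_near; apply: ae_imp (rep_ae D k) _ => x <-; exact: h.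
Qed.

Lemma cell_integral_abs k i : (\int[leb]_(x in cell dx i) (U0 P k x)%:E =
  \int[leb]_(x in cell dx i) `|(U0 P k x)%:E|)%E.
Proof.
have mc := measurable_cell dx i.
have fi : leb.-integrable (cell dx i) (EFin \o U0 P k).
  by apply: integrableS (U0_int D k).
have /integrableP[mU _] := fi.
apply: ae_eq_integral => //; first exact: measurableT_comp.
by apply: ae_imp (U0_ge0 D k) _ => x h _ /=; rewrite ger0_norm.
Qed.

Lemma initial_ge0 k i : 0 <= initial P dx k i.
Proof.
rewrite /initial divr_ge0 ?(ltW dx0)// /Rintegral cell_integral_abs.
by rewrite fine_ge0// integral_ge0.
Qed.

Lemma initial_le_ess k i : (`|initial P dx k i|%:E <= Loo_norm (U0 P k))%E.
Proof.
have [fin|/negbTE] := boolP (Loo_norm (U0 P k) \is a fin_num); last first.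
  rewrite ge0_fin_numE ?Loo_norm_ge0// => /negbT; rewrite -leNgt leye_eq => /eqP ->.
  by rewrite leey.
rewrite -(fineK fin) lee_fin -[initial _ _ _ _]subr0; apply: initial_near.
have /Loo_normP : (Loo_norm (U0 P k) <= (fine (Loo_norm (U0 P k)))%:E)%E by rewrite fineK.
by move=> /ae_imp; apply => x h _; rewrite subr0 -lee_fin.
Qed.

Lemma initial_le k i : `|initial P dx k i| <= U0s D.
Proof.
rewrite -[initial _ _ _ _]subr0; apply: initial_near_rep => x _.
by rewrite subr0; exact: rep_le.
Qed.

Lemma initial_L1 k : (dx%:E * l1Z (initial P dx k) = L1_norm (U0 P k))%E.
Proof.
rewrite /L1_norm Lnorm1 (integral_cells dx0)//; last first.
  have /integrableP[mU _] := U0_int D k.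
  exact: (@measurableT_comp _ _ _ _ _ _ abse).
rewrite /l1Z -esumZl//; apply: eq_esum => i _.
have mc := measurable_cell dx i.
have fi : leb.-integrable (cell dx i) (EFin \o U0 P k).
  by apply: integrableS (U0_int D k).
rewrite ger0_norm ?initial_ge0// /initial -EFinM mulrCA divff ?gt_eqF// mulr1.
rewrite /Rintegral fineK ?cell_integral_abs//.
by rewrite -cell_integral_abs; exact: integrable_fin_num.
Qed.

(** Two neighbouring averages both differ from the value at the common end of the
cells by at most the variation on their own cell. *)
Lemma initial_zTV k : (zTV (initial P dx k) <= (U0v D + U0v D)%:E)%E.
Proof.
have [W mW] := rep_bv D k; have [WV gW] := mW; have ndW := majorant_nd mW.
pose w (i : int) := W (xhalf dx (i - 1)).
have ww i : xhalf dx (i - 1) <= xhalf dx i.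
  by rewrite xhalfB1 xhalfE ler_pM2r//; lra.
have wV i : (0 <= w i <= U0v D) by exact: WV.
pose c i := w (i + 1) - w i.
have cE i : c i = W (xhalf dx i) - W (xhalf dx (i - 1)) by rewrite /c /w addrK.
have c0 i : 0 <= c i by rewrite cE subr_ge0; exact: ndW.
have cV : (l1Z c <= (U0v D)%:E)%E.
  by apply: l1Z_telescope wV _ => i; rewrite ger0_norm.
apply: (@l1Z_leD _ c (fun i => c (i + 1))); [|exact: cV|by rewrite l1Z_shift].
move=> i; rewrite (ger0_norm (c0 i)) (ger0_norm (c0 (i + 1))).
set a := rep D k (xhalf dx i).
have h1 : `|initial P dx k i - a| <= c i.
  apply: initial_near_rep => x; rewrite /cell/= in_itv/= => /andP[x1 x2].
  rewrite distrC cE; apply: le_trans (gW _ _ (ltW x2)) _.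
  by rewrite lerD2l lerN2; exact: ndW.
have h2 : `|initial P dx k (i + 1) - a| <= c (i + 1).
  apply: initial_near_rep => x; rewrite /cell/= in_itv/= addrK => /andP[x1 x2].
  rewrite cE addrK; apply: le_trans (gW _ _ x1) _.
  by rewrite lerD2r; apply: ndW; exact: ltW.
by move: h1 h2; rewrite !ler_norml; lra.
Qed.

End InitialData.

(** * A priori bounds *)

Section APriori.
Context {R : realType} {N : nat}.
Variables (P : ivp R N) (sch : flux_type R) (lambda kappa T : R).
Variables (C : constants P sch lambda) (D : data P).
Context (kappa01 : 0 <= kappa <= 1) (T0 : 0 < T).

Definition growth : R := sig_max C * lipf C * vel1 (mass D) C.
Definition bar_bound : R := sig_max C * U0s D * expR (growth * T).
Definition source : R := bv_source (mass D) C bar_bound.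
Definition bar_TV0 : R := sig_max C * (U0v D + U0v D) + U0s D * sig_var C.
Definition bar_TV : R := expR (growth * T) * (bar_TV0 + source * T).
(** The sum over the components makes the rate common to all of them. *)
Definition time_rate : R :=
  2 * (\sum_k visc C k) * bar_TV + lipf C * vel1 (mass D) C * (sig_max C * mass D).

Lemma growth_ge0 (k : 'I_N) : 0 <= growth.
Proof.
have h1 := lipf_ge0 C; have h2 := sig_max_ge0 C k; have h3 := vel1_ge0 C (mass_ge0 D) k.
by rewrite /growth mulr_ge0// mulr_ge0.
Qed.

Lemma sig_var_ge0 (k : 'I_N) : 0 <= sig_var C.
Proof. exact: bv_le_ge0 (sig_bv C k). Qed.

Lemma bar_bound_ge0 (k : 'I_N) : 0 <= bar_bound.
Proof.
by rewrite /bar_bound mulr_ge0 ?expR_ge0// mulr_ge0 ?U0s_ge0// (sig_max_ge0 C k).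
Qed.

Lemma source_ge0 (k : 'I_N) : 0 <= source.
Proof.
have h1 := lipf_ge0 C; have h2 := sig_max_ge0 C k; have h3 := vel1_ge0 C (mass_ge0 D) k.
have h4 := vel2_ge0 C (mass_ge0 D) k; have h5 := bar_bound_ge0 k; have h6 := mass_ge0 D.
have h7 := sig_var_ge0 k.
rewrite /source /bv_source; apply: addr_ge0.
  exact: mulr_ge0 h7 (mulr_ge0 (mulr_ge0 h1 h5) h3).
exact: mulr_ge0 (mulr_ge0 (mulr_ge0 h2 h1) h4) (mulr_ge0 h2 h6).
Qed.

Lemma bar_TV0_ge0 (k : 'I_N) : 0 <= bar_TV0.
Proof.
have h2 := sig_max_ge0 C k; have h3 := U0v_ge0 D; have h4 := U0s_ge0 D.
have h7 := sig_var_ge0 k.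
by rewrite /bar_TV0 addr_ge0// mulr_ge0// addr_ge0.
Qed.

Lemma bar_TV_ge0 (k : 'I_N) : 0 <= bar_TV.
Proof.
have h1 := bar_TV0_ge0 k; have h2 := source_ge0 k.
by rewrite /bar_TV mulr_ge0 ?expR_ge0// addr_ge0// mulr_ge0// ltW.
Qed.

Lemma le_time_rate k : 2 * visc C k * bar_TV +
  lipf C * vel1 (mass D) C * (sig_max C * mass D) <= time_rate.
Proof.
rewrite /time_rate lerD2r ler_wpM2r ?(bar_TV_ge0 k)// ler_wpM2l//.
by rewrite (bigD1 k)//= lerDl sumr_ge0// => j _; exact: visc_ge0.
Qed.

Variables (dx : R) (NT : nat).
Context (M : mesh P sch lambda kappa dx T NT).

Lemma dx_gt0 : 0 < dx. Proof. by case: M. Qed.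
Let dx0 := dx_gt0.

Lemma dt_gt0 : 0 < dt lambda dx.
Proof. by rewrite mulr_gt0// (lam_gt0 C). Qed.

Lemma NT_dt : T = NT%:R * dt lambda dx. Proof. by case: M. Qed.

Lemma tn_le n : (n <= NT)%N -> n%:R * dt lambda dx <= T.
Proof. by move=> nN; rewrite NT_dt ler_pM2r ?dt_gt0// ler_nat. Qed.

Local Notation U := (Un P sch lambda kappa dx).

Lemma UnS n : U n.+1 = step P sch lambda kappa dx (U n).
Proof. by []. Qed.

Lemma Un_inv n : (n <= NT)%N ->
  (forall k i, 0 <= U n k i) /\
  (forall k, (dx%:E * l1Z (U n k))%E = L1_norm (U0 P k)).
Proof.
elim: n => [_|n IH nN].
  by split => [k i|k]; [exact: initial_ge0|exact: initial_L1].
have [Upos Umass] := IH (ltnW nN).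
have Um : mass_le dx (mass D) (U n).
  move=> k; rewrite -(@lee_pmul2l _ dx%:E) ?lte_fin// Umass -EFinM.
  rewrite (_ : dx * _ = mass D); first exact: U0_mass.
  by field; rewrite gt_eqF.
have mono := fun k i => let: And3 _ _ h := M in h n k i nN.
split => [k i|k]; first exact: (step_ge0 C).
by rewrite -Umass UnS (step_mass C Um Upos mono).
Qed.

Lemma Un_ge0 n k i : (n <= NT)%N -> 0 <= U n k i.
Proof. by move=> /Un_inv[+ _]; apply. Qed.

Lemma Un_L1 n k : (n <= NT)%N -> (dx%:E * l1Z (U n k))%E = L1_norm (U0 P k).
Proof. by move=> /Un_inv[_]; apply. Qed.

Lemma Un_mass n : (n <= NT)%N -> mass_le dx (mass D) (U n).
Proof.
move=> nN k; rewrite -(@lee_pmul2l _ dx%:E) ?lte_fin// (Un_L1 k nN) -EFinM.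
rewrite (_ : dx * _ = mass D); first exact: U0_mass.
by field; rewrite gt_eqF.
Qed.

Lemma Un_mono n k i bm b bp bm' b' bp' : (n < NT)%N ->
  bm <= bm' -> b <= b' -> bp <= bp' ->
  Hfun P sch lambda dx k i (vel P kappa dx (U n) k (i - 1)) (vel P kappa dx (U n) k i) bm b bp
  <= Hfun P sch lambda dx k i (vel P kappa dx (U n) k (i - 1)) (vel P kappa dx (U n) k i)
     bm' b' bp'.
Proof. by case: M => _ _ + nN; apply. Qed.

Local Notation tn n := (n%:R * dt lambda dx).

(** Gronwall's lemma for one step, from [1 + y <= expR y]. *)
Lemma expR_step (n : nat) (g : R) : 0 <= g ->
  expR (g * tn n) * (1 + g * dt lambda dx) <= expR (g * tn n.+1).
Proof.
move=> g0; rewrite -natr1 mulrDl mul1r mulrDr expRD ler_wpM2l ?expR_ge0//.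
exact: expR_ge1Dx.
Qed.

Lemma Un_sup (M0 : R) n k : 0 <= M0 -> (forall i, bar P dx (U 0%N) k i <= M0) ->
  (n <= NT)%N -> forall i, bar P dx (U n) k i <= expR (growth * tn n) * M0.
Proof.
move=> M00 UM; elim: n => [_ i|n IH nN i]; first by rewrite mul0r mulr0 expR0 mul1r.
have E0 : 0 <= expR (growth * tn n) * M0 by rewrite mulr_ge0 ?expR_ge0.
apply: le_trans (step_sup C kappa01 dx0 (mass_ge0 D) (Un_mass (ltnW nN))
  (fun k i _ _ _ _ _ _ => Un_mono k i nN) E0 (IH (ltnW nN)) i) _.
rewrite -/growth mulrAC ler_wpM2r//; apply: expR_step; exact: growth_ge0.
Qed.

Lemma bar0_le k i : bar P dx (U 0%N) k i <= sig_max C * U0s D.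
Proof.
rewrite /bar ler_pM ?(initial_ge0 D)//; first exact: ltW (s_gt0 dx C k i).
  exact: s_le.
by rewrite (le_trans (ler_norm _))// (initial_le D).
Qed.

Lemma Un_bar_le n k i : (n <= NT)%N -> bar P dx (U n) k i <= bar_bound.
Proof.
move=> nN; have S0 : 0 <= sig_max C * U0s D by rewrite mulr_ge0 ?U0s_ge0// (sig_max_ge0 C k).
apply: le_trans (Un_sup S0 (bar0_le k) nN i) _.
rewrite /bar_bound mulrC ler_wpM2l// ler_expR ler_wpM2l ?(growth_ge0 k)//.
exact: tn_le.
Qed.

Lemma zTV_bar (u : 'I_N -> int -> R) (Us V : R) k : 0 <= V ->
  (forall i, `|u k i| <= Us) -> (zTV (u k) <= V%:E)%E ->
  (zTV (bar P dx u k) <= (sig_max C * V + Us * sig_var C)%:E)%E.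
Proof.
move=> V0 uU uV; have Us0 : 0 <= Us := le_trans (normr_ge0 _) (uU 0).
apply: (@l1Z_leD _ (fun i => sigma_ P dx k (i + 1) * (u k (i + 1) - u k i))
  (fun i => u k i * (sigma_ P dx k (i + 1) - sigma_ P dx k i))).
- move=> i; rewrite /bar; apply: le_trans (ler_normD _ _).
  by rewrite le_eqVlt; apply/orP; left; apply/eqP; congr (`|_|); ring.
- apply: l1Z_leM uV => [|i]; first exact: (sig_max_ge0 C k).
  by rewrite normrM (gtr0_norm (s_gt0 dx C k _)) ler_wpM2r// s_le.
- apply: l1Z_leM (zTV_sigma C dx0 k) => // i.
  by rewrite normrM ler_wpM2r.
Qed.

Lemma Un_TV0 k : (zTV (bar P dx (U 0%N) k) <= bar_TV0%:E)%E.
Proof.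
apply: zTV_bar; first by rewrite addr_ge0 ?U0v_ge0.
  by move=> i; exact: initial_le.
exact: initial_zTV.
Qed.

Lemma Un_TV n k (V0 : R) : (zTV (bar P dx (U 0%N) k) <= V0%:E)%E -> 0 <= V0 ->
  (n <= NT)%N ->
  (zTV (bar P dx (U n) k) <= (expR (growth * tn n) * (V0 + source * tn n))%:E)%E.
Proof.
move=> UV V00; elim: n => [_|n IH nN].
  by rewrite mul0r !mulr0 expR0 mul1r addr0.
have g0 := growth_ge0 k; have s0 := source_ge0 k; have d0 := ltW dt_gt0.
have tn0 m : 0 <= tn m by rewrite mulr_ge0.
apply: le_trans (step_TV C kappa01 dx0 (mass_ge0 D) (Un_mass (ltnW nN))
  (fun k i => Un_ge0 k i (ltnW nN)) (fun k i _ _ _ _ _ _ => Un_mono k i nN)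
  (bar_bound_ge0 k) (fun i => Un_bar_le k i (ltnW nN)) (IH (ltnW nN))) _.
rewrite lee_fin -/(bv_rate _ C) -/source.
have -> : bv_rate (mass D) C = growth by [].
have E := expR_step n g0; have E1 : 1 <= expR (growth * tn n.+1).
  by rewrite -[leLHS]expR0 ler_expR mulr_ge0.
set X := expR (growth * tn n) in E *; set Y := expR (growth * tn n.+1) in E E1 *.
have -> : X * (V0 + source * tn n) + (growth * (X * (V0 + source * tn n)) + source) * dt lambda dx =
  X * (1 + growth * dt lambda dx) * (V0 + source * tn n) + source * dt lambda dx by ring.
have -> : Y * (V0 + source * tn n.+1) = Y * (V0 + source * tn n) + Y * (source * dt lambda dx).
  by rewrite -natr1; ring.
apply: lerD; first by rewrite ler_wpM2r// addr_ge0// mulr_ge0.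
by rewrite -[leLHS]mul1r ler_wpM2r// mulr_ge0.
Qed.

Lemma Un_TV_le n k : (n <= NT)%N -> (zTV (bar P dx (U n) k) <= bar_TV%:E)%E.
Proof.
move=> nN; have b0 := bar_TV0_ge0 k; have s0 := source_ge0 k; have g0 := growth_ge0 k.
apply: le_trans (Un_TV (Un_TV0 k) b0 nN) _.
have t0 : 0 <= tn n by rewrite mulr_ge0// ltW// dt_gt0.
rewrite lee_fin /bar_TV ler_pM ?expR_ge0//; first by rewrite addr_ge0// mulr_ge0.
  by rewrite ler_expR ler_wpM2l// tn_le.
by rewrite lerD2l ler_wpM2l// tn_le.
Qed.

Lemma Un_time n k : (n < NT)%N ->
  (l1Z (fun i => U n.+1 k i - U n k i)%R <= (lambda * time_rate)%:E)%E.
Proof.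
move=> nN; apply: le_trans (step_time C kappa01 dx0 (mass_ge0 D) (Un_mass (ltnW nN))
  (Un_TV_le k (ltnW nN))) _.
by rewrite lee_fin ler_wpM2l ?le_time_rate// ltW// (lam_gt0 C).
Qed.

(** A cell receives mass from its two neighbours only, so the tails can be
followed for finite time at the finite speed [dx / dt]. *)
Lemma Un_cut n (r : nat) k : (0 < r)%N -> (n <= NT)%N ->
  (l1Z (cut (r + n) (U n k)) <= l1Z (cut r (U 0%N k)))%E.
Proof.
move=> r0; elim: n => [_|n IH nN]; first by rewrite addn0.
apply: le_trans (IH (ltnW nN)); rewrite addnS UnS.
apply: (step_cut C (Un_mass (ltnW nN)) (fun k i => Un_ge0 k i (ltnW nN))
  (fun k i _ _ _ _ _ _ => Un_mono k i nN)).
by rewrite addn_gt0 r0.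
Qed.

End APriori.

(** * Distances in mean and ultralimits *)

Section L1Tools.
Context {R : realType}.
Local Notation leb := (@lebesgue_measure R).
Implicit Types (f g h : R -> R) (D : set R) (A B : R).

Definition L1on D f : \bar R := (\int[leb]_(x in D) `|f x|%:E)%E.

Lemma measurable_norm D f : measurable_fun [set: R] f ->
  measurable_fun D (fun x => `|f x|%:E).
Proof.
move=> mf; apply: measurable_funTS; apply/measurable_EFinP.
exact: measurableT_comp.
Qed.

Lemma L1on_ge0 D f : (0 <= L1on D f)%E.
Proof. by apply: integral_ge0 => x _; rewrite lee_fin. Qed.

Lemma L1on_le D f g : measurable D -> measurable_fun [set: R] f ->
  measurable_fun [set: R] g -> (forall x, D x -> `|f x| <= `|g x|) ->
  (L1on D f <= L1on D g)%E.
Proof.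
move=> mD mf mg fg; apply: ge0_le_integral => //; try exact: measurable_norm.
Qed.

Lemma L1onD D f g h : measurable D -> measurable_fun [set: R] f ->
  measurable_fun [set: R] g -> measurable_fun [set: R] h ->
  (forall x, D x -> `|h x| <= `|f x| + `|g x|) ->
  (L1on D h <= L1on D f + L1on D g)%E.
Proof.
move=> mD mf mg mh hfg; rewrite /L1on -ge0_integralD//; try exact: measurable_norm;
  try by move=> x _; rewrite lee_fin.
apply: ge0_le_integral => //; try exact: measurable_norm.
by apply: emeasurable_funD; exact: measurable_norm.
Qed.

Lemma L1on_leD D f g h A B : measurable D -> measurable_fun [set: R] f ->
  measurable_fun [set: R] g -> measurable_fun [set: R] h ->
  (forall x, D x -> `|h x| <= `|f x| + `|g x|) ->
  (L1on D f <= A%:E)%E -> (L1on D g <= B%:E)%E -> (L1on D h <= (A + B)%:E)%E.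
Proof.
move=> mD mf mg mh hfg fA gB; rewrite EFinD.
by apply: le_trans (L1onD mD mf mg mh hfg) _; exact: leeD.
Qed.

Lemma L1on_subset D D' f : measurable D -> measurable D' ->
  measurable_fun [set: R] f -> D `<=` D' -> (L1on D f <= L1on D' f)%E.
Proof.
move=> mD mD' mf DD'; apply: ge0_subset_integral => //; exact: measurable_norm.
Qed.

Lemma L1on_split D D' f : measurable D -> measurable D' ->
  measurable_fun [set: R] f -> [disjoint D & D'] ->
  L1on (D `|` D') f = (L1on D f + L1on D' f)%E.
Proof.
by move=> mD mD' mf DD'; apply: ge0_integral_setU => //; exact: measurable_norm.
Qed.

Lemma L1on_cst D f (c l : R) : measurable D -> measurable_fun [set: R] f ->
  leb D = l%:E -> (forall x, D x -> `|f x| <= c) -> (L1on D f <= (c * l)%:E)%E.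
Proof.
move=> mD mf Dl fc; rewrite EFinM -Dl -lebesgue_integral_cst//.
by apply: ge0_le_integral => //; exact: measurable_norm.
Qed.

(** A function of bounded variation is known, in mean, from its values on a
fine grid: on each grid interval it moves by at most the local variation. *)
Lemma L1on_sampling g V W (a h0 eta : R) (n : nat) : majorant g V W ->
  measurable_fun [set: R] g -> 0 < h0 ->
  (forall b, (b < n)%N -> `|g (a + b%:R * h0)| <= eta) ->
  (L1on `[a, (a + n%:R * h0)%R[%classic g <=
    (n%:R * h0 * eta + h0 * (W (a + n%:R * h0) - W a))%:E)%E.
Proof.
move=> mW mg h00; elim: n => [_|n IH gn].
  rewrite mul0r addr0 set_itvco0 /L1on integral_set0 lee_fin.
  by rewrite !mul0r subrr mulr0 addr0.
have xn : a + n%:R * h0 <= a + n.+1%:R * h0 by rewrite lerD2l ler_pM2r// ler_nat.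
have ax : a <= a + n%:R * h0 by rewrite lerDl mulr_ge0// ltW.
have -> : `[a, a + n.+1%:R * h0[%classic =
  `[a, a + n%:R * h0[%classic `|` `[a + n%:R * h0, a + n.+1%:R * h0[%classic.
  by apply: itv_bndbnd_setU; rewrite bnd_simp.
rewrite L1on_split//; last first.
  apply/eqP/seteqP; split => // x /=; rewrite !in_itv/=.
  by move=> [/andP[_ x1] /andP[x2 _]]; move: x1; rewrite ltNge x2.
set y := a + n%:R * h0 in xn ax *; set z := a + n.+1%:R * h0 in xn *.
have zy : z - y = h0 by rewrite /z /y -natr1; ring.
have lst : (L1on `[y, z[%classic g <= ((eta + (W z - W y)) * h0)%:E)%E.
  apply: L1on_cst => //.
    rewrite lebesgue_measure_itv/= lte_fin ifT; last by rewrite -subr_gt0 zy.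
    by rewrite -EFinB zy.
  move=> x; rewrite /= in_itv/= => /andP[yx xz].
  have gy : `|g y| <= eta by apply: gn.
  have gyx : `|g x - g y| <= W z - W y.
    have [_ /(_ _ _ yx)] := mW; move/le_trans; apply.
    by rewrite lerD2r; apply: (majorant_nd mW); exact: ltW.
  by rewrite -[g x](subrK (g y)) (le_trans (ler_normD _ _))//; lra.
have IH' := IH (fun b bn => gn b (ltnW bn)).
apply: le_trans (leeD IH' lst) _.
rewrite -EFinD lee_fin le_eqVlt; apply/orP; left; apply/eqP.
by rewrite -[n.+1%:R]natr1; ring.
Qed.

End L1Tools.

Section Ultralimits.
Context {R : realType}.

Lemma free_ultrafilter : exists F : set_system nat, UltraFilter F /\ \oo `<=` F.
Proof. exact: ultraFilterLemma. Qed.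

(** A bounded sequence converges along an ultrafilter, because closed bounded
intervals are compact. *)
Lemma ultralimit (F : set_system nat) (f : nat -> R) (M : R) : UltraFilter F ->
  (forall m, `|f m| <= M) -> exists l : R, f @ F --> l.
Proof.
move=> FU fM; have FP : ProperFilter F := @ultra_proper _ F FU.
have fF : (f @ F) `[- M, M]%classic.
  by apply: (@filterS _ F _ setT) => [m _ /=|]; [rewrite in_itv/= -ler_norml|exact: filterT].
have [l [_ cl]] := @segment_compact R (- M) M (f @ F) _ fF.
exists l => A Al; have [//|nA] := in_ultra_setVsetC (f @^-1` A) FU.
by have [x [nAx Ax]] := cl (~` A) A nA Al.
Qed.

End Ultralimits.

(** * Compactness, uniformly in time *)

Definition outside {R : realType} (X : R) : set R := ~` `[- X, X[%classic.

Section Compactness.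
Context {R : realType} {N : nat}.
Local Notation leb := (@lebesgue_measure R).
Variables (T M V K : R) (delta : nat -> R) (w : nat -> 'I_N -> R -> R -> R).
Context (T0 : 0 < T) (V0 : 0 <= V) (K0 : 0 <= K).
Context (w_bnd : forall m k (t x : R), 0 <= t <= T -> `|w m k t x| <= M).
Context (w_bv : forall m k (t : R), 0 <= t <= T -> bv_le (w m k t) V).
Context (w_time : forall m k (s t : R), 0 <= s <= T -> 0 <= t <= T ->
  (L1on [set: R] (fun x => w m k s x - w m k t x)%R
    <= (K * (`|s - t| + delta m))%:E)%E).
Context (delta0 : delta @ \oo --> (0 : R)).
Context (w_tail : forall e : R, 0 < e -> exists2 X : R, 0 <= X &
  forall m k (t : R), 0 <= t <= T -> (L1on (outside X) (w m k t) <= e%:E)%E).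

Let w_meas m k t : 0 <= t <= T -> measurable_fun [set: R] (w m k t).
Proof. by move=> tT; exact: bv_le_measurable (w_bv m k tT). Qed.

Variable F : set_system nat.
Context (FU : UltraFilter F) (ooF : \oo `<=` F).

Let FP : ProperFilter F := @ultra_proper _ F FU.

(** Total boundedness: a member is determined up to [e], uniformly in time, by
its approximate values at finitely many points of space-time. The ultrafilter
decides these values, which replaces all extractions of subsequences. *)
Lemma uniform_cluster (e : R) : 0 < e -> exists2 E : set nat, F E &
  forall m m', E m -> E m' -> forall k (t : R), 0 <= t <= T ->
    (L1on [set: R] (fun x => w m k t x - w m' k t x)%R <= e%:E)%E.
Proof.
move=> e0.
(* [K * (tau + tau)] bounds the change in mean over one sampling step; one [tau] is
for the time discretization of the members themselves *)
pose tau := e / (8 * (K + 1)).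
have K1 : 0 < K + 1 by rewrite ltr_wpDl.
have tau0 : 0 < tau by rewrite divr_gt0// mulr_gt0.
have Ktau : K * (tau + tau) <= e / 4.
  have -> : e / 4 = (K + 1) * (tau + tau) by rewrite /tau; field; rewrite gt_eqF.
  by rewrite ler_wpM2r ?addr_ge0 ?(ltW tau0)// lerDl.
have e16 : 0 < e / 16 by rewrite divr_gt0.
have [X X0 XP] := w_tail e16.
(* [h0 * (V + V)] bounds the sampling error for the difference of two members *)
pose h0 := e / (16 * (V + 1)).
have V1 : 0 < V + 1 by rewrite ltr_wpDl.
have h00 : 0 < h0 by rewrite divr_gt0// mulr_gt0.
have hV : h0 * (V + V) <= e / 8.
  have -> : e / 8 = h0 * ((V + 1) + (V + 1)) by rewrite /h0; field; rewrite gt_eqF.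
  by rewrite ler_wpM2l ?(ltW h00)// lerD// lerDl.
pose n := (Num.truncn (2 * X / h0)).+1.
have nh : X <= - X + n%:R * h0.
  have : 2 * X / h0 < n%:R by exact: truncnS_gt.
  by rewrite ltr_pdivrMr//; lra.
(* accuracy of the samples: summed over the window [[-X, X]] it costs [e / 8] *)
pose eta := e / (8 * (n%:R * h0)).
have n0 : 0 < n%:R * h0 by rewrite mulr_gt0// ltr0n.
have eta0 : 0 < eta by rewrite divr_gt0// mulr_gt0.
have neta : n%:R * h0 * eta = e / 8 by rewrite /eta; field; rewrite !gt_eqF ?ltr0n.
pose A := (Num.truncn (T / tau)).+1.
have A0 : 0 < A%:R :> R by rewrite ltr0n.
have TA : T / A%:R <= tau.
  have : T / tau < A%:R by exact: truncnS_gt.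
  by rewrite ltr_pdivrMr// ler_pdivrMr//; nra.
pose tg (a : nat) : R := a%:R * (T / A%:R).
pose xg (b : nat) : R := - X + b%:R * h0.
have TA0 : 0 < T / A%:R by rewrite divr_gt0.
have tgT a : (a <= A)%N -> 0 <= tg a <= T.
  move=> aA; rewrite /tg mulr_ge0 ?(ltW TA0)//=.
  rewrite -[leRHS](_ : A%:R * (T / A%:R) = T); last by field; rewrite gt_eqF.
  by rewrite ler_pM2r// ler_nat.
pose I := ('I_N * 'I_A.+1 * 'I_n)%type.
have /choice[l lP] : forall p : I, exists l : R,
    (fun m => w m p.1.1 (tg p.1.2) (xg p.2)) @ F --> l.
  move=> p; apply: (@ultralimit _ F _ M) => // m; apply: w_bnd; apply: tgT.
  by have := ltn_ord p.1.2; rewrite ltnS.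
pose E := [set m | delta m <= tau /\
  forall p : I, `|l p - w m p.1.1 (tg p.1.2) (xg p.2)| <= eta / 2].
exists E.
  apply: filterI.
    by apply: ooF; apply: (cvgr_le _ delta0).
  apply: filter_forall => p; have /cvgrPdist_le := lP p; apply.
  by rewrite divr_gt0.
move=> m m' [dm lm] [dm' lm'] k t tT.
have /andP[t0 tT'] := tT.
pose a := Num.truncn (t / (T / A%:R)).
have /andP[a1 a2] : a%:R <= t / (T / A%:R) < a.+1%:R.
  by apply: truncn_itv; rewrite divr_ge0// ltW.
rewrite ler_pdivlMr// in a1; rewrite ltr_pdivrMr// in a2.
have aA : (a <= A)%N.
  rewrite -(ler_nat R) -(ler_pM2r TA0); apply: le_trans a1 _.
  by rewrite (_ : A%:R * (T / A%:R) = T)//; field; rewrite gt_eqF.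
have ta := tgT a aA.
have tta : `|t - tg a| <= tau.
  rewrite ger0_norm ?subr_ge0//; apply: le_trans TA; move: a2; rewrite -natr1 /tg.
  by rewrite mulrDl mul1r; lra.
(* [t] is replaced by the sampling time just before it *)
have close j : E j -> (L1on [set: R] (fun x => w j k t x - w j k (tg a) x)%R <= (e / 4)%:E)%E.
  move=> [dj _]; apply: le_trans (w_time j k tT ta) _; rewrite lee_fin.
  apply: le_trans Ktau; rewrite ler_wpM2l// lerD//.
pose g x := w m k (tg a) x - w m' k (tg a) x.
have mwa j := w_meas j k ta; have mwt j := w_meas j k tT.
have mg : measurable_fun [set: R] g by exact: measurable_funB.
pose D : set R := `[- X, - X + n%:R * h0[%classic.
have mD : measurable D by exact: measurable_itv.
have mDC : measurable (~` D) by exact: measurableC.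
have gD : (L1on D g <= (e / 8 + e / 8)%:E)%E.
  have [W mW] := bv_leD (w_bv m k ta) (w_bv m' k ta).
  apply: le_trans (L1on_sampling (eta := eta) (n := n) mW mg h00 _) _.
    move=> b bn; pose p : I := (k, inord a, Ordinal bn).
    have := lm p; have := lm' p; rewrite /p /= inordK ?ltnS//.
    rewrite -/(xg b) /g !ler_norml; lra.
  rewrite lee_fin neta lerD2l; apply: le_trans hV; rewrite ler_wpM2l ?(ltW h00)//.
  by have [WV _] := mW; have := WV (- X + n%:R * h0); have := WV (- X); lra.
have DX : ~` D `<=` outside X.
  apply: subsetC => x; rewrite /D /= !in_itv/= => /andP[-> xX] /=.
  exact: lt_le_trans nh.
have tailD j : (L1on (~` D) (w j k (tg a)) <= (e / 16)%:E)%E.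
  apply: le_trans (XP j k _ ta); apply: L1on_subset => //.
  by apply: measurableC; exact: measurable_itv.
have gT : (L1on [set: R] g <= (e / 4 + e / 8)%:E)%E.
  rewrite -(setUv D) L1on_split//; last by apply/eqP; exact: setICr.
  have -> : e / 4 + e / 8 = (e / 8 + e / 8) + (e / 16 + e / 16) by field.
  rewrite EFinD; apply: leeD => //.
  apply: (L1on_leD mDC (mwa m) (mwa m') mg) => // x _; exact: ler_normB.
have -> : e = e / 4 + ((e / 4 + e / 8) + (e / 4 + e / 8)) by field.
apply: (@L1on_leD _ _ (fun x => w m k t x - w m k (tg a) x)
  (fun x => g x + (w m' k (tg a) x - w m' k t x))) => //.
- exact: measurable_funB.
- by apply: measurable_funD => //; exact: measurable_funB.
- exact: measurable_funB.
- move=> x _; rewrite (_ : w m k t x - w m' k t x = (w m k t x - w m k (tg a) x) +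
   (g x + (w m' k (tg a) x - w m' k t x))); last by rewrite /g; ring.
  exact: ler_normD.
- by apply: close; split.
apply: (@L1on_leD _ _ g (fun x => w m' k t x - w m' k (tg a) x)) => //.
- exact: measurable_funB.
- by apply: measurable_funD => //; exact: measurable_funB.
- by move=> x _; rewrite [`|w m' k t x - _|]distrC; exact: ler_normD.
have : (L1on [set: R] (fun x => w m' k t x - w m' k (tg a) x)%R <= (e / 4)%:E)%E.
  by apply: close; split.
by move/le_trans; apply; rewrite lee_fin; lra.
Qed.

(** The clusters of radius [(1 / 2) ^+ j] belong to one ultrafilter, so that finitely
many of them always meet, arbitrarily far out. *)
Lemma uniform_subsequence : exists s : nat -> nat,
  (forall m n, (m < n)%N -> (s m < s n)%N) /\
  forall j i i', (j <= i)%N -> (j <= i')%N -> forall k (t : R), 0 <= t <= T ->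
    (L1on [set: R] (fun x => w (s i) k t x - w (s i') k t x)%R <= ((1 / 2) ^+ j)%:E)%E.
Proof.
have half0 j : 0 < (1 / 2 : R) ^+ j by rewrite exprn_gt0// divr_gt0.
have /choice[E EP] : forall j : nat, exists E : set nat, F E /\
  forall m m', E m -> E m' -> forall k (t : R), 0 <= t <= T ->
    (L1on [set: R] (fun x => w m k t x - w m' k t x)%R <= ((1 / 2) ^+ j)%:E)%E.
  by move=> j; have [E FE EP] := uniform_cluster (half0 j); exists E.
have FD j : F [set m | forall i : 'I_j.+1, E i m].
  by apply: filter_forall => i; have [] := EP i.
have /choice[c cP] : forall nj : nat * nat, exists m, (nj.1 < m)%N /\
    forall i, (i <= nj.2)%N -> E i m.
  move=> [n j] /=.
  have Fn : F [set m | (n < m)%N] by apply: ooF; exists n.+1.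
  have [m [nm Em]] := @filter_ex _ F FP _ (filterI Fn (FD j)).
  by exists m; split => // i ij; exact: (Em (Ordinal (ij : (i < j.+1)%N))).
pose s := fix s j := if j is j'.+1 then c (s j', j) else c (0%N, 0%N).
have sE j i : (i <= j)%N -> E i (s j).
  by case: j => [|j] /= ij; [have [_] := cP (0%N, 0%N)|have [_] := cP (s j, j.+1)]; apply.
exists s; split.
  have sS j : (s j < s j.+1)%N by have [] := cP (s j, j.+1).
  move=> m n; elim: n => // n IH; rewrite ltnS leq_eqVlt => /predU1P[->//|/IH].
  by move/ltn_trans; apply.
by move=> j i i' ji ji' k t tT; have [_] := EP j; apply => //; exact: sE.
Qed.

End Compactness.

(** * Limits of rapidly convergent sequences *)

Section RapidLimit.
Context {R : realType} {N : nat}.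
Local Notation leb := (@lebesgue_measure R).
Variables (T M V : R) (v : nat -> 'I_N -> R -> R -> R).
Context (v_bnd : forall j k (t x : R), 0 <= t <= T -> `|v j k t x| <= M).
Context (v_bv : forall j k (t : R), 0 <= t <= T -> bv_le (v j k t) V).
Context (v_meas : forall j k,
  measurable_fun [set: R * R] (fun z : R * R => v j k z.1 z.2)).
Context (v_cauchy : forall j i i', (j <= i)%N -> (j <= i')%N ->
  forall k (t : R), 0 <= t <= T ->
    (L1on [set: R] (fun x => v i k t x - v i' k t x)%R <= ((1 / 2) ^+ j)%:E)%E).

Let v_measx j k t : measurable_fun [set: R] (v j k t).
Proof. exact: (measurableT_comp (v_meas j k) (measurable_pair1 t)). Qed.

Let incr j k (z : R * R) : \bar R := `|v j.+1 k z.1 z.2 - v j k z.1 z.2|%:E.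

(** The total length of the path of the sequence at a point; it has finite integral
in space, hence it is finite almost everywhere, at every single time. *)
Definition total_incr k (z : R * R) : \bar R := (\sum_(0 <= j <oo) incr j k z)%E.

Let incr_ge0 j k z : (0 <= incr j k z)%E.
Proof. by rewrite lee_fin. Qed.

Let incr_meas j k : measurable_fun [set: R * R] (incr j k).
Proof.
apply/measurable_EFinP; apply: measurableT_comp => //.
exact: measurable_funB.
Qed.

Lemma total_incr_meas k : measurable_fun [set: R * R] (total_incr k).
Proof. by apply: ge0_emeasurable_sum => *; [exact: incr_ge0|exact: incr_meas]. Qed.

Lemma geometric_half_le n : \sum_(0 <= i < n) (1 / 2 : R) ^+ i <= 2.
Proof.
suff -> : \sum_(0 <= i < n) (1 / 2 : R) ^+ i = 2 - 2 * (1 / 2) ^+ n.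
  by rewrite gerBl mulr_ge0// exprn_ge0// divr_ge0.
elim: n => [|n IH]; first by rewrite big_nil expr0; ring.
by rewrite big_nat_recr//= IH exprS; field.
Qed.

Lemma total_incr_int k t : 0 <= t <= T ->
  (\int[leb]_x total_incr k (t, x) <= 2%:E)%E.
Proof.
move=> tT; rewrite integral_nneseries//; last first.
  by move=> j; exact: measurable_fun_pair2 (incr_meas j k).
apply: lime_le.
  by apply: is_cvg_nneseries => j _ _; apply: integral_ge0 => x _; exact: incr_ge0.
apply: nearW => n; apply: le_trans (_ : ((\sum_(0 <= i < n) (1 / 2 : R) ^+ i)%:E <= _)%E).
  rewrite -sumEFin; apply: lee_sum => j _.
  by apply: v_cauchy tT; rewrite ?leqnSn.
by rewrite lee_fin geometric_half_le.
Qed.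

Lemma total_incr_ae k t : 0 <= t <= T ->
  {ae leb, forall x, (total_incr k (t, x) < +oo)%E}.
Proof.
move=> tT.
have mt : measurable_fun [set: R] (fun x => total_incr k (t, x)).
  exact: measurable_fun_pair2 (total_incr_meas k).
have t0 x : (0 <= total_incr k (t, x))%E by apply: nneseries_ge0 => *.
have it : leb.-integrable [set: R] (fun x => total_incr k (t, x)).
  apply/integrableP; split => //.
  under eq_integral do rewrite gee0_abs//.
  by apply: le_lt_trans (total_incr_int k tT) _; exact: ltry.
apply: ae_imp (integrable_ae _ it) _ => // x /(_ I).
by rewrite ge0_fin_numE.
Qed.

Lemma cvg_of_total_incr k z : (total_incr k z < +oo)%E ->
  cvgn (fun j => v j k z.1 z.2).
Proof.
move=> fin.
have fn : total_incr k z \is a fin_num.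
  by rewrite ge0_fin_numE//; apply: nneseries_ge0 => *.
pose u j : R := v j.+1 k z.1 z.2 - v j k z.1 z.2.
have us n : series u n = v n k z.1 z.2 - v 0%N k z.1 z.2.
  rewrite /series /=; elim: n => [|n IH]; first by rewrite big_nil subrr.
  by rewrite big_nat_recr//= IH /u; ring.
have : cvgn (series u).
  apply: normed_cvg; apply: nondecreasing_is_cvgn.
    by apply: nondecreasing_series => n _ _; exact: normr_ge0.
  exists (fine (total_incr k z)) => _ [n _ <-].
  rewrite -lee_fin fineK// /series /= -sumEFin.
  exact: (nneseries_lim_ge n (fun i _ _ => incr_ge0 i k z)).
move=> cu; rewrite (_ : (fun j => _) = (fun j => series u j + v 0%N k z.1 z.2)).
  by apply: is_cvgD => //; exact: is_cvg_cst.
by apply/funext => j; rewrite us subrK.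
Qed.

Definition space_time_limit k t x : R :=
  if (0 <= t <= T) && (total_incr k (t, x) < +oo)%E
  then limn (fun j => v j k t x) else 0.

Local Notation U := space_time_limit.

Lemma space_time_limit_cvg k t x : 0 <= t <= T -> (total_incr k (t, x) < +oo)%E ->
  v j k t x @[j --> \oo] --> U k t x.
Proof. by move=> tT ft; rewrite /U tT ft; exact: (@cvg_of_total_incr k (t, x)). Qed.

Lemma space_time_limit_ae k t : 0 <= t <= T ->
  {ae leb, forall x, v j k t x @[j --> \oo] --> U k t x}.
Proof.
move=> tT; apply: ae_imp (total_incr_ae k tT) _ => x.
exact: space_time_limit_cvg.
Qed.

Lemma space_time_limit_meas k :
  measurable_fun [set: R * R] (fun z : R * R => U k z.1 z.2).
Proof.
pose c (z : R * R) : bool := (0 <= z.1 <= T) && (total_incr k z < +oo)%E.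
have mc : measurable_fun [set: R * R] c.
  have m1 : measurable_fun [set: R * R] (fun z : R * R => z.1).
    exact: measurable_fst.
  apply: measurable_and.
    apply: measurable_and; first by apply: measurable_fun_ler => //.
    by apply: measurable_fun_ler.
  apply: (@measurable_fun_lte _ _ _ _ _ _) => //; exact: total_incr_meas.
apply: (@measurable_fun_cvg _ _ _ _ (fun j z => if c z then v j k z.1 z.2 else 0)).
  by move=> j; apply: measurable_fun_ifT => //; exact: measurable_cst.
move=> [t x] _; rewrite /U /c /=; case: ifPn => [/andP[tT ft]|_].
  exact: (@cvg_of_total_incr k (t, x)).
exact: cvg_cst.
Qed.

Lemma space_time_limit_measx k t : measurable_fun [set: R] (U k t).
Proof. exact: (measurableT_comp (space_time_limit_meas k) (measurable_pair1 t)). Qed.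

Lemma space_time_limit_bnd k t x : 0 <= M -> `|U k t x| <= M.
Proof.
move=> M0; rewrite /U; case: ifPn => [/andP[tT ft]|_]; last by rewrite normr0.
have cv : v j k t x @[j --> \oo] --> limn (fun j => v j k t x).
  exact: (@cvg_of_total_incr k (t, x)).
apply: (cvgr_to_le (cvg_norm cv)).
by apply: nearW => j; exact: v_bnd.
Qed.

(** Fatou's lemma, applied to the distances to the later terms. *)
Lemma space_time_limit_L1 k t j : 0 <= t <= T ->
  (L1on [set: R] (fun x => v j k t x - U k t x)%R <= ((1 / 2) ^+ j)%:E)%E.
Proof.
move=> tT.
pose d i x : \bar R := `|v j k t x - v i k t x|%:E.
have md i : measurable_fun [set: R] (d i).
  by apply: measurable_norm; exact: measurable_funB.
have mU := space_time_limit_measx k t.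
have -> : L1on [set: R] (fun x => v j k t x - U k t x) =
    (\int[leb]_x limn_einf (d^~ x))%E.
  apply: ae_eq_integral => //.
  - by apply: measurable_norm; exact: measurable_funB.
  - rewrite (_ : (fun x => _) = (fun x => - limn_esup (fun i => - d i x))%E).
      apply: measurableT_comp => //; apply: measurable_fun_limn_esup => i.
      by apply: measurableT_comp (md i).
    by apply/funext => x; rewrite -[LHS]oppeK -limn_esupN.
  apply: ae_imp (space_time_limit_ae k tT) _ => x cv _.
  have : d i x @[i --> \oo] --> `|v j k t x - U k t x|%:E.
    apply: cvg_EFin; first exact: nearW.
    by apply: cvg_norm; apply: cvgB => //; exact: cvg_cst.
  by move=> /cvg_limn_einf_sup[-> _].
have d0 i x : [set: R] x -> (0 <= d i x)%E by move=> _; rewrite lee_fin.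
apply: le_trans (@fatou _ _ _ (@lebesgue_measure R) setT measurableT d md d0) _.
apply: le_trans (limn_einf_sup _) _.
rewrite limn_esup_lim; apply: lime_le; first exact: is_cvg_esups.
near=> n; apply: ge_ereal_sup => _ [i /= ni <-].
apply: v_cauchy tT => //; apply: leq_trans ni; near: n; exact: nbhs_infty_ge.
Unshelve. all: by end_near. Qed.

(** The extraction of ultralimits is defined at every point, so it provides a
representative of bounded variation of the almost everywhere limit. *)
Lemma space_time_limit_bv k t : 0 <= t <= T ->
  exists2 r : R -> R, bv_le r V & {ae leb, forall x, r x = U k t x}.
Proof.
move=> tT; have [F [FU ooF]] := free_ultrafilter.
have FP : ProperFilter F := @ultra_proper _ F FU.
have /choice[W WP] : forall j, exists W, majorant (v j k t) V W.
  by move=> j; exact: v_bv.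
have /choice[r rP] : forall x, exists l : R, v j k t x @[j --> F] --> l.
  by move=> x; apply: (@ultralimit _ F _ M) => // j; exact: v_bnd.
have /choice[W' W'P] : forall x, exists l : R, W j x @[j --> F] --> l.
  move=> x; apply: (@ultralimit _ F _ V) => // j.
  by have [/(_ x) /andP[W0 WV] _] := WP j; rewrite ger0_norm.
exists r.
  exists W'; split => [x|x y xy].
    apply/andP; split.
      apply: (cvgr_to_ge (W'P x)); apply: nearW => j.
      by have [/(_ x)/andP[W0 WV] _] := WP j.
    apply: (cvgr_to_le (W'P x)); apply: nearW => j.
    by have [/(_ x)/andP[W0 WV] _] := WP j.
  have c1 : `|v j k t y - v j k t x| @[j --> F] --> `|r y - r x|.
    by apply: cvg_norm; exact: cvgB.
  have c2 : W j y - W j x @[j --> F] --> W' y - W' x by exact: cvgB.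
  by apply: (ler_cvg_to c1 c2); apply: nearW => j; have [_] := WP j; apply.
apply: ae_imp (space_time_limit_ae k tT) _ => x cv.
have cF : v j k t x @[j --> F] --> U k t x.
  by move=> A /cv; exact: ooF.
exact: (@cvg_unique _ (@Rhausdorff R) _ _ _ _ (rP x) cF).
Qed.

(** The exceptional set is a measurable subset of the plane whose sections at fixed
times are all null. *)
Lemma space_time_limit_ae2 k : {ae leb2, forall z : R * R, QTbar T z ->
  v j k z.1 z.2 @[j --> \oo] --> U k z.1 z.2}.
Proof.
pose B : set (R * R) := QTbar T `&` [set z | total_incr k z = +oo%E].
have mB : measurable B.
  apply: measurableI.
    by apply: measurableX => //; exact: measurable_itv.
  have := @total_incr_meas k measurableT _ (emeasurable_set1 +oo%E).
  by rewrite setTI.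
exists B; split => //.
  apply: integral0_eq => t _ /=.
  have [tT|tT] := boolP (0 <= t <= T); last first.
    rewrite (_ : xsection B t = set0) ?measure0//.
    apply/seteqP; split => // x; rewrite /xsection /= inE => -[[+ _] _].
    by rewrite /= in_itv/= (negbTE tT).
  have [D [mD D0 DP]] := total_incr_ae k tT.
  apply: (@subset_measure0 _ _ _ (@lebesgue_measure R) _ D) => //.
    exact: (measurable_xsection t mB).
  move=> x; rewrite /xsection /= inE => -[_ /= E]; apply: DP => /=.
  by rewrite E ltxx.
move=> [t x] /= h; apply: contrapT => nB; apply: h => -[tT _].
rewrite /= in_itv/= in tT.
apply: space_time_limit_cvg => //; rewrite ltey; apply/eqP => E.
by apply: nB; split => //; split => //=; rewrite in_itv.
Qed.

End RapidLimit.

(** * The approximations as functions of time and space *)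

Section TailsOfIntegrable.
Context {R : realType}.
Local Notation leb := (@lebesgue_measure R).

Lemma measurable_outside (X : R) : measurable (outside X).
Proof. by apply: measurableC; exact: measurable_itv. Qed.

(** Monotone convergence of the integrals over the growing intervals. *)
Lemma L1on_outside_cvg0 (f : R -> R) (e : R) :
  leb.-integrable [set: R] (EFin \o f) -> 0 < e ->
  exists2 X : R, 0 <= X & (L1on (outside X) f <= e%:E)%E.
Proof.
move=> fi e0; have /integrableP[/measurable_EFinP mf ffin] := fi.
pose I (n : nat) : set R := `[- n%:R, n%:R[%classic.
have mI n : measurable (I n) by exact: measurable_itv.
have IT : \bigcup_n I n = [set: R].
  rewrite -subTset => x _; exists (Num.truncn `|x|).+1 => //.
  have : `|x| < (Num.truncn `|x|).+1%:R by exact: truncnS_gt.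
  rewrite /I /= in_itv/= ltr_norml => /andP[x1 ->]; rewrite andbT; exact: ltW.
have cv : (L1on (I n) f @[n --> \oo] --> L1on [set: R] f)%E.
  rewrite -IT; apply: ge0_nondecreasing_set_cvg_integral => //.
  - apply/nondecreasing_seqP => n; apply/subsetPset => x.
    rewrite /I /= !in_itv/= => /andP[x1 x2].
    have nn : (n%:R : R) <= n.+1%:R by rewrite ler_nat.
    by apply/andP; split; lra.
  - by move=> n; exact: measurable_norm.
have tfin : L1on [set: R] f \is a fin_num.
  by rewrite ge0_fin_numE ?L1on_ge0.
apply: contrapT => H.
have : (L1on [set: R] f <= L1on [set: R] f - e%:E)%E.
  rewrite -[leLHS](cvg_lim _ cv)//; apply: lime_le; first exact: cvgP cv.
  apply: nearW => n; rewrite leeBrDr//.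
  rewrite -[in leRHS](setUv (I n)) L1on_split//; first last.
  - by apply/eqP; exact: setICr.
  - exact: measurableC.
  apply: leeD => //; rewrite leNgt; apply/negP => /ltW h.
  by apply: H; exists n%:R.
by rewrite leeBrDr// leNgt lteDl// lte_fin e0.
Qed.

End TailsOfIntegrable.

Lemma le_absz_pos (r : nat) (i : int) : (r <= absz i)%N -> 0 <= i -> r%:Z <= i.
Proof. lia. Qed.

Lemma le_absz_neg (r : nat) (i : int) : (r <= absz i)%N -> i < 0 -> r%:Z <= - i.
Proof. lia. Qed.

Lemma le_absz_posW (r : nat) (i : int) : r%:Z <= i -> (r <= absz i)%N.
Proof. lia. Qed.

Lemma le_absz_negW (r : nat) (i : int) : r%:Z <= - i -> (r <= absz i)%N.
Proof. lia. Qed.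

Section MeshFunctions.
Context {R : realType} {N : nat}.
Local Notation leb := (@lebesgue_measure R).
Variables (P : ivp R N) (sch : flux_type R) (lambda kappa T : R).
Variables (C : constants P sch lambda) (D : data P).
Context (kappa01 : 0 <= kappa <= 1) (T0 : 0 < T).

Definition U_sup : R := bar_bound T C D / sig_min C.
(** Division by [sigma] costs the variation of [1 / sigma]. *)
Definition U_TV : R :=
  bar_TV T C D / sig_min C + bar_bound T C D / sig_min C ^+ 2 * sig_var C.

Lemma U_sup_ge0 (k : 'I_N) : 0 <= U_sup.
Proof. by rewrite divr_ge0 ?(bar_bound_ge0 T C D k)// ltW// sig_min_gt0. Qed.

Lemma U_TV_ge0 (k : 'I_N) : 0 <= U_TV.
Proof.
have h0 := ltW (sig_min_gt0 C); have h1 := bar_bound_ge0 T C D k.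
have h2 := bar_TV_ge0 C D T0 k; have h3 := sig_var_ge0 C k.
by rewrite addr_ge0 ?divr_ge0// mulr_ge0// divr_ge0// exprn_ge0.
Qed.

Lemma time_rate_ge0 (k : 'I_N) : 0 <= time_rate T C D.
Proof.
apply: le_trans (le_time_rate C D T0 k).
have h1 := lipf_ge0 C; have h2 := sig_max_ge0 C k; have h3 := vel1_ge0 C (mass_ge0 D) k.
have h4 := bar_TV_ge0 C D T0 k; have h5 := mass_ge0 D; have h6 := visc_ge0 C k.
apply: addr_ge0; first by rewrite mulr_ge0// mulr_ge0.
exact: mulr_ge0 (mulr_ge0 h1 h3) (mulr_ge0 h2 h5).
Qed.

Lemma data_tail (e : R) : 0 < e ->
  exists2 X : R, 0 <= X & forall k, (L1on (outside X) (U0 P k) <= e%:E)%E.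
Proof.
move=> e0; apply: uniform_bound => [k|k X X' XX' h].
  by have [X _ XP] := L1on_outside_cvg0 (U0_int D k) e0; exists X.
apply: le_trans h; apply: L1on_subset; [exact: measurable_outside..| |].
  by have /integrableP[/measurable_EFinP] := U0_int D k.
apply: subsetC => x /=; rewrite !in_itv/= => /andP[x1 x2].
by apply/andP; split; lra.
Qed.

Variables (dx : R) (NT : nat).
Context (Mh : mesh P sch lambda kappa dx T NT).

Let dx0 : 0 < dx := dx_gt0 Mh.
Let l0 : 0 < lambda := lam_gt0 C.
Let dt0 : 0 < dt lambda dx := dt_gt0 C Mh.

Local Notation U := (Un P sch lambda kappa dx).
Local Notation UD := (Udelta P sch lambda kappa dx).
Local Notation n_ t := (tindex lambda dx t).

Lemma tindex_itv (t : R) : 0 <= t ->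
  (n_ t)%:R * dt lambda dx <= t < (n_ t).+1%:R * dt lambda dx.
Proof.
move=> t0; rewrite -ler_pdivlMr// -ltr_pdivrMr//.
by apply: truncn_itv; rewrite divr_ge0// ltW.
Qed.

Lemma tindex_le t : 0 <= t <= T -> (n_ t <= NT)%N.
Proof.
move=> /andP[t0 tT]; have /andP[h _] := tindex_itv t0.
rewrite -(ler_nat R) -(ler_pM2r dt0) -(NT_dt Mh); exact: le_trans tT.
Qed.

Lemma dt_le_T : dt lambda dx <= T.
Proof.
rewrite (NT_dt Mh) -[leLHS]mul1r ler_pM2r// ler1n.
by have := T0; rewrite (NT_dt Mh) lt0n; case: (NT =P 0%N) => // ->; rewrite mul0r ltxx.
Qed.

Lemma Un_le n k i : (n <= NT)%N -> U n k i <= U_sup.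
Proof.
move=> nN; have s0 := sig_min_gt0 C.
rewrite -(bar_div dx C (U n) k i) /U_sup ler_pM//.
- by apply: (bar_ge0 dx C) => k' i'; exact: (Un_ge0 C D Mh).
- by rewrite invr_ge0 ltW// (s_gt0 dx C).
- exact: (Un_bar_le C D kappa01 Mh).
- rewrite lef_pV2 ?posrE//; [exact: sig_ge|exact: (s_gt0 dx C)].
Qed.

Lemma Un_zTV n k : (n <= NT)%N -> (zTV (U n k) <= U_TV%:E)%E.
Proof.
move=> nN; have s0 := sig_min_gt0 C; have B0 := bar_bound_ge0 T C D k.
pose s i := sigma_ P dx k i; pose b i := bar P dx (U n) k i.
have sp i : 0 < s i by exact: (s_gt0 dx C).
have sm i : sig_min C <= s i by exact: sig_ge.
have U0n := fun k i => Un_ge0 C D Mh k i nN.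
have b0 i : 0 <= b i by rewrite mulr_ge0// ltW// sp.
have vs i : (s i)^-1 <= (sig_min C)^-1 by rewrite lef_pV2// posrE.
apply: (@l1Z_leD _ (fun i => (b (i + 1) - b i) / s (i + 1))
   (fun i => b i / (s i * s (i + 1)) * (s (i + 1) - s i))).
- move=> i; rewrite -!(bar_div dx C (U n)) -[bar _ _ _ _ i]/(b i) -[bar _ _ _ _ (i + 1)]/(b (i + 1)).
  rewrite -[sigma_ _ _ _ i]/(s i) -[sigma_ _ _ _ (i + 1)]/(s (i + 1)).
  rewrite -[`|b i / _ * _|]normrN; apply: le_trans (ler_normD _ _).
  rewrite le_eqVlt; apply/orP; left; apply/eqP; congr (`|_|).
  by field; rewrite !gt_eqF.
- rewrite [bar_TV _ _ _ / _]mulrC; apply: (@l1Z_leM _ _ (fun i => b (i + 1) - b i)).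
  + by rewrite invr_ge0 ltW.
  + by move=> i; rewrite normrM mulrC ler_wpM2r// ger0_norm// invr_ge0 ltW.
  + exact: (Un_TV_le C D kappa01 Mh).
- apply: (@l1Z_leM _ _ (fun i => s (i + 1) - s i)).
  + by rewrite divr_ge0// exprn_ge0// ltW.
  + move=> i; rewrite normrM ler_wpM2r// ger0_norm; last first.
      by rewrite divr_ge0// ltW// mulr_gt0.
    rewrite ler_pM ?invr_ge0 ?(Un_bar_le C D kappa01 Mh)//; first by rewrite ltW// mulr_gt0.
    by rewrite lef_pV2 ?posrE ?mulr_gt0// expr2 ler_pM// ltW.
  + exact: zTV_sigma.
Qed.

Lemma Un_time_le n m k : (n + m <= NT)%N ->
  (l1Z (fun i => U (n + m) k i - U n k i)%R <= (m%:R * (lambda * time_rate T C D))%:E)%E.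
Proof.
elim: m => [_|m IH nm].
  rewrite addn0 mul0r; apply: (@l1Z_le_windows _ _ 0) => j.
  by rewrite big1// => p _; rewrite subrr normr0.
rewrite addnS in nm *.
rewrite -natr1 mulrDl mul1r.
apply: (@l1Z_leD _ (fun i => U (n + m) k i - U n k i) (fun i => U (n + m).+1 k i - U (n + m) k i)).
- move=> i; rewrite -(subrK (U (n + m) k i) (U (n + m).+1 k i)) -addrA addrC.
  by rewrite addrK; exact: ler_normD.
- exact: IH (ltnW nm).
- exact: (Un_time C D kappa01 T0 Mh).
Qed.

Lemma grid_meas (A : nat -> int -> R) :
  measurable_fun [set: R * R] (fun z : R * R => A (n_ z.1) (xindex dx z.2)).
Proof.
pose tau := dt lambda dx.
have tE t : n_ t = if (0 <= xindex tau (t - tau / 2))%R then absz (xindex tau (t - tau / 2)) else 0%N.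
  have -> : xindex tau (t - tau / 2) = Num.floor (t / tau).
    by rewrite /xindex; congr Num.floor; field; rewrite gt_eqF.
  rewrite /tindex truncn_floor -/tau floor_ge0.
  by case: ifP.
pose B (i j : int) : R := A (if (0 <= i)%R then absz i else 0%N) j.
rewrite (_ : (fun z => _) = fun z : R * R =>
   B (xindex tau (z.1 - tau / 2)) (xindex dx z.2)); last first.
  by apply/funext => z; rewrite /B tE.
move=> _ Y mY; rewrite setTI.
have -> : (fun z : R * R => B (xindex tau (z.1 - tau / 2)) (xindex dx z.2)) @^-1` Y =
    \bigcup_(ij in [set: int * int]) (if `[< Y (B ij.1 ij.2) >]
      then [set t | cell tau ij.1 (t - tau / 2)] `*` cell dx ij.2 else set0).
  apply/seteqP; split => [[t x] /= Yz|[t x] [[i j] _ /=]].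
    exists (xindex tau (t - tau / 2), xindex dx x) => //=.
    by rewrite asboolT//; split; exact: cell_xindex.
  case: asboolP => // Yij [/= /(@cellP R tau i _ dt0) -> /(@cellP R dx j x dx0) ->].
  exact: Yij.
apply: countable_bigcupT_measurable => [|[i j]]; first exact: countableP.
case: asboolP => // _; apply: measurableX; last exact: measurable_cell.
rewrite (_ : [set t | _] = `[xhalf tau (i - 1) + tau / 2, xhalf tau i + tau / 2[%classic).
  exact: measurable_itv.
by apply/seteqP; split => t; rewrite /cell /= !in_itv/= => /andP[? ?]; apply/andP; split; lra.
Qed.

Lemma Udelta_meas k : measurable_fun [set: R * R] (fun z : R * R => UD k z.1 z.2).
Proof. exact: (grid_meas (fun n i => U n k i)). Qed.

Lemma Udelta_ge0 k t x : 0 <= t <= T -> 0 <= UD k t x.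
Proof. by move=> tT; apply: (Un_ge0 C D Mh); exact: tindex_le. Qed.

Lemma Udelta_le k t x : 0 <= t <= T -> `|UD k t x| <= U_sup.
Proof.
by move=> tT; rewrite ger0_norm ?Udelta_ge0//; apply: Un_le; exact: tindex_le.
Qed.

Lemma Udelta_bv k t : 0 <= t <= T -> bv_le (UD k t) U_TV.
Proof. by move=> tT; apply: zTV_bv_le => //; apply: Un_zTV; exact: tindex_le. Qed.

Lemma Udelta_mass k t : 0 <= t <= T -> L1on [set: R] (UD k t) = L1_norm (U0 P k).
Proof.
move=> tT; rewrite /L1on /Udelta integral_step_l1Z//.
by apply: (Un_L1 C D Mh); exact: tindex_le.
Qed.

Lemma Udelta_time k s t : 0 <= s <= T -> 0 <= t <= T ->
  (L1on [set: R] (fun x => UD k s x - UD k t x)%R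
    <= (time_rate T C D * (`|s - t| + dt lambda dx))%:E)%E.
Proof.
wlog st : s t / s <= t => [H sT tT|].
  have [st|/ltW ts] := leP s t; first exact: H.
  rewrite distrC; apply: le_trans (H _ _ ts tT sT); apply: L1on_le => //.
  - apply: measurable_funB; exact: measurable_step.
  - apply: measurable_funB; exact: measurable_step.
  - by move=> x _; rewrite distrC.
move=> sT tT; have nt := tindex_le tT.
have ns : (n_ s <= n_ t)%N by apply: le_truncn; rewrite ler_pM2r ?invr_gt0.
rewrite /L1on /Udelta.
rewrite (integral_step_l1Z (fun i => U (n_ s) k i - U (n_ t) k i))//.
have -> : l1Z (fun i => U (n_ s) k i - U (n_ t) k i) =
    l1Z (fun i => U (n_ s + (n_ t - n_ s)) k i - U (n_ s) k i).
  by rewrite subnKC//; apply: eq_esum => i _; rewrite distrC.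
have h : (n_ s + (n_ t - n_ s) <= NT)%N by rewrite subnKC.
apply: (@le_trans _ _ (dx%:E * ((n_ t - n_ s)%:R * (lambda * time_rate T C D))%:E)%E).
  by rewrite lee_pmul2l// Un_time_le.
rewrite -EFinM lee_fin.
have -> : dx * ((n_ t - n_ s)%:R * (lambda * time_rate T C D)) =
  time_rate T C D * ((n_ t - n_ s)%:R * dt lambda dx) by rewrite /dt; ring.
apply: ler_wpM2l; first exact: time_rate_ge0.
have /andP[s0 _] := sT; have /andP[t0 _] := tT.
have /andP[s1 s2] := tindex_itv s0; have /andP[t1 t2] := tindex_itv t0.
rewrite natrB// mulrBl distrC ger0_norm ?subr_ge0//.
by move: s2; rewrite -natr1 mulrDl mul1r; lra.
Qed.

Lemma dx_le : dx <= T / lambda.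
Proof. by rewrite ler_pdivlMr// mulrC; exact: dt_le_T. Qed.

Lemma initial_tail k (r : nat) (Y : R) : Y <= (r%:R - 1 / 2) * dx ->
  (dx%:E * l1Z (cut r (U 0%N k)) <= L1on (outside Y) (U0 P k))%E.
Proof.
move=> Yr; have /integrableP[/measurable_EFinP mU _] := U0_int D k.
rewrite /L1on integral_mkcond (integral_cells dx0)//; first last.
- by move=> x; rewrite patchE; case: ifP.
- by apply/(measurable_restrictT _ _).1; [exact: measurable_outside|exact: measurable_norm].
rewrite /l1Z -esumZl//.
apply: le_esum => i _; rewrite /cut; case: ifPn => [ri|_]; last first.
  by rewrite normr0 mule0 integral_ge0// => x _; rewrite patchE; case: ifP.
have -> : (\int[leb]_(x in cell dx i) ((fun x => `|U0 P k x|%:E) \_ (outside Y)) x =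
   \int[leb]_(x in cell dx i) `|U0 P k x|%:E)%E.
  apply: eq_integral => x /set_mem; rewrite /cell/= in_itv/= xhalfB1 xhalfE patchE.
  move=> /andP[x1 x2]; rewrite ifT//; apply/mem_set; rewrite /outside /= in_itv/=.
  move=> /andP[y1 y2].
  have [i0|i0] := leP 0 i.
    have : (r%:Z <= i)%R by exact: le_absz_pos.
    rewrite -(ler_int R) -pmulrn; move: (i%:~R) (r%:R : R) x1 x2 y1 y2 Yr => a b.
    nra.
  have : (r%:Z <= - i)%R by exact: le_absz_neg.
  rewrite -(ler_int R) -pmulrn mulrNz.
  move: (i%:~R) (r%:R : R) x1 x2 y1 y2 Yr => a b; nra.
rewrite ger0_norm ?(initial_ge0 D)//.
have mc := measurable_cell dx i.
have fi : leb.-integrable (cell dx i) (EFin \o U0 P k).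
  by apply: integrableS (U0_int D k).
rewrite /U /= /initial -EFinM mulrCA divff ?gt_eqF// mulr1.
rewrite /Rintegral fineK; last exact: integrable_fin_num.
by rewrite (cell_integral_abs D).
Qed.

(** After [n] steps mass has travelled at most [n * dx <= T / lambda]; the rest of
the margin absorbs a few cells, as [dx <= T / lambda]. *)
Lemma Udelta_tail k t (Y : R) : 0 <= Y -> 0 <= t <= T ->
  (L1on (outside (Y + 4 * (T / lambda))) (UD k t) <= L1on (outside Y) (U0 P k))%E.
Proof.
move=> Y0 tT; have nN := tindex_le tT.
pose r := (Num.truncn (Y / dx)).+2.
have r1 : Y < (r%:R - 1) * dx.
  rewrite -ltr_pdivrMr// /r -natr1 addrK; exact: truncnS_gt.
have r2 : (r%:R - 2) * dx <= Y.
  rewrite -ler_pdivlMr// /r -2!natr1.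
  have Yd : 0 <= Y / dx by rewrite divr_ge0// ltW.
  have /andP[h _] := truncn_itv Yd.
  by move: h; lra.
have nT : (n_ t)%:R * dx <= T / lambda.
  rewrite ler_pdivlMr// -mulrA [dx * _]mulrC; have /andP[t0 tT'] := tT.
  by have /andP[h _] := tindex_itv t0; exact: le_trans h tT'.
apply: le_trans (initial_tail k (r := r) _); last by nra.
apply: (@le_trans _ _ (dx%:E * l1Z (cut (r + n_ t) (U (n_ t) k)))%E); last first.
  by rewrite lee_pmul2l// (Un_cut C D Mh).
rewrite -integral_step_l1Z//.
have ms := measurable_step (cut (r + n_ t) (U (n_ t) k)) dx0.
apply: (@le_trans _ _ (L1on (outside (Y + 4 * (T / lambda)))
   (fun x => cut (r + n_ t) (U (n_ t) k) (xindex dx x)))); last first.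
  by apply: L1on_subset => //; exact: measurable_outside.
apply: L1on_le => //; [exact: measurable_outside|exact: measurable_step|].
move=> x xo; rewrite /cut ifT//.
have xn := xindex_near x dx0; rewrite /xgrid in xn.
have dl := dx_le.
have rn : ((r + n_ t)%:R : R) * dx <= Y + 4 * (T / lambda) - dx / 2.
  by rewrite natrD; lra.
move: xo; rewrite /outside /= in_itv/= => /negP; rewrite negb_and -ltNge -leNgt.
set i := xindex dx x in xn *.
rewrite ler_norml in xn.
have key (j : int) : ((r + n_ t)%:R : R) * dx <= j%:~R * dx -> ((r + n_ t)%:Z <= j)%R.
  by rewrite ler_pM2r// pmulrn ler_int.
move=> /orP[x1|x1].
  apply: le_absz_negW; apply: key; rewrite mulrNz mulNr.
  by move: rn xn x1; move: (i%:~R * dx) (_ * dx) => p q; lra.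
apply: le_absz_posW; apply: key.
by move: rn xn x1; move: (i%:~R * dx) (_ * dx) => p q; lra.
Qed.

End MeshFunctions.

(** * Consistency of the nonlocal velocity *)

Section NonlocalKernel.
Context {R : realType}.
Local Notation leb := (@lebesgue_measure R).

Lemma edge_near (kappa : R) (u : int -> R) V : 0 <= kappa <= 1 ->
  (zTV u <= V%:E)%E -> (l1Z (fun p => edge kappa u p - u p)%R <= V%:E)%E.
Proof.
move=> /andP[k0 k1] uV; rewrite -[V]mul1r.
apply: (@l1Z_leM _ _ (fun p => u (p + 1) - u p)) => // p.
rewrite (_ : edge kappa u p - u p = (1 - kappa) * (u (p + 1) - u p)); last first.
  by rewrite /edge; ring.
by rewrite normrM ger0_norm ?subr_ge0// ler_wpM2r// gerBl.
Qed.

Lemma integrable_L1on (f : R -> R) A : measurable_fun [set: R] f ->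
  (L1on [set: R] f <= A%:E)%E -> leb.-integrable [set: R] (EFin \o f).
Proof.
move=> mf fA; apply/integrableP; split; first exact/measurable_EFinP.
by apply: le_lt_trans fA _; exact: ltry.
Qed.

Lemma Rintegral_le_L1on (f : R -> R) A : measurable_fun [set: R] f ->
  (L1on [set: R] f <= A%:E)%E -> `|\int[leb]_x f x| <= A.
Proof.
move=> mf fA; have fi := integrable_L1on mf fA.
apply: le_trans (le_normr_Rintegral _ fi) _ => //.
rewrite -lee_fin /Rintegral fineK//.
by apply: integrable_fin_num => //; exact: (integrable_norm fi).
Qed.

Lemma L1on_kernel (m f : R -> R) B A : 0 <= B ->
  measurable_fun [set: R] m -> measurable_fun [set: R] f ->
  (forall y, `|m y| <= B) -> (L1on [set: R] f <= A%:E)%E ->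
  (L1on [set: R] (fun y => m y * f y)%R <= (B * A)%:E)%E.
Proof.
move=> B0 mm mf mB fA.
apply: (@le_trans _ _ (B%:E * L1on [set: R] f)%E); last by rewrite EFinM lee_wpmul2l.
rewrite /L1on -ge0_integralZl_EFin//; last exact: measurable_norm.
apply: ge0_le_integral => //.
- by apply: measurable_norm; exact: measurable_funM.
- by apply: measurable_funeM; exact: measurable_norm.
by move=> y _; rewrite -EFinM lee_fin normrM ler_wpM2r.
Qed.

(** The error splits into the error of the kernel, weighted by the mass, the error of
the interpolation at the edges, controlled by the variation, and the distance
from [u] to [f]. *)
Lemma kernel_near (kappa dx M V B dl e : R) (m : int -> R) (Mf f : R -> R)
    (u : int -> R) : 0 <= kappa <= 1 -> 0 < dx -> 0 <= M -> 0 <= V -> 0 <= B -> 0 <= dl ->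
  (forall p, `|m p| <= B) -> measurable_fun [set: R] Mf -> (forall y, `|Mf y| <= B) ->
  (forall y, `|m (xindex dx y) - Mf y| <= dl) ->
  (l1Z u <= (M / dx)%:E)%E -> (zTV u <= V%:E)%E ->
  measurable_fun [set: R] f -> leb.-integrable [set: R] (EFin \o f) ->
  (L1on [set: R] (fun y => u (xindex dx y) - f y)%R <= e%:E)%E ->
  `|dx * zsum (fun p => m p * edge kappa u p) - \int[leb]_y (Mf y * f y)| <=
  dl * M + (B * (dx * V) + B * e).
Proof.
move=> k01 dx0 M0 V0 B0 dl0 mB mMf MfB mMf_near uM uV mf fi fe.
have eM := l1Z_edge k01 uM.
have meM := l1Z_kernel B0 mB eM.
rewrite -(@Rintegral_step _ dx _ _ dx0 meM).
pose g y := m (xindex dx y) * edge kappa u (xindex dx y).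
have gi : leb.-integrable [set: R] (EFin \o g) by exact: integrable_step meM.
have mg : measurable_fun [set: R] g by exact: (measurable_step (fun p => m p * edge kappa u p)).
have mmf : measurable_fun [set: R] (fun y => Mf y * f y) by exact: measurable_funM.
have mfi : leb.-integrable [set: R] (EFin \o (fun y => Mf y * f y)).
  have /integrableP[_ ffin] := fi.
  have ffn : L1on [set: R] f \is a fin_num by rewrite ge0_fin_numE ?L1on_ge0.
  apply: (@integrable_L1on _ (B * fine (L1on [set: R] f))) => //.
  by apply: L1on_kernel => //; rewrite fineK.
rewrite -RintegralB//.
apply: Rintegral_le_L1on; first exact: measurable_funB.
have me : measurable_fun [set: R] (fun y => edge kappa u (xindex dx y)).
  exact: (measurable_step (edge kappa u)).
have mu : measurable_fun [set: R] (fun y => u (xindex dx y)) by exact: measurable_step.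
have mm : measurable_fun [set: R] (fun y => m (xindex dx y)) by exact: measurable_step.
have mmM := measurable_funB mm mMf.
apply: (@L1on_leD _ _ (fun y => (m (xindex dx y) - Mf y) * edge kappa u (xindex dx y))
  (fun y => Mf y * (edge kappa u (xindex dx y) - u (xindex dx y)) +
            Mf y * (u (xindex dx y) - f y))) => //.
- exact: measurable_funM.
- by apply: measurable_funD; apply: measurable_funM => //; exact: measurable_funB.
- exact: measurable_funB.
- move=> y _; apply: le_trans (ler_normD _ _); rewrite le_eqVlt; apply/orP; left.
  by apply/eqP; congr (`|_|); rewrite /g; ring.
- apply: L1on_kernel => //.
  rewrite /L1on (integral_step_l1Z (edge kappa u))//.
  apply: (@le_trans _ _ (dx%:E * (M / dx)%:E)%E); first by rewrite lee_pmul2l.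
  by rewrite -EFinM lee_fin le_eqVlt; apply/orP; left; apply/eqP; field; rewrite gt_eqF.
apply: (@L1on_leD _ _ (fun y => Mf y * (edge kappa u (xindex dx y) - u (xindex dx y)))
  (fun y => Mf y * (u (xindex dx y) - f y))) => //.
- by apply: measurable_funM => //; exact: measurable_funB.
- by apply: measurable_funM => //; exact: measurable_funB.
- by apply: measurable_funD; apply: measurable_funM => //; exact: measurable_funB.
- by move=> y _; exact: ler_normD.
- apply: L1on_kernel => //; first exact: measurable_funB.
  rewrite /L1on (integral_step_l1Z (fun p => edge kappa u p - u p))//.
  by rewrite EFinM lee_pmul2l// edge_near.
- by apply: L1on_kernel => //; exact: measurable_funB.
Qed.

End NonlocalKernel.

Section NonlocalLimit.
Context {R : realType} {N : nat}.
Local Notation leb := (@lebesgue_measure R).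
Variables (P : ivp R N) (sch : flux_type R) (lambda kappa : R).
Variable C : constants P sch lambda.
Context (kappa01 : 0 <= kappa <= 1).
Variables (M V : R) (f : 'I_N -> R -> R).
Context (M0 : 0 <= M) (V0 : 0 <= V).
Context (mf : forall j, measurable_fun [set: R] (f j)).
Context (fi : forall j, leb.-integrable [set: R] (EFin \o f j)).
Local Notation B := (reg C).

Definition dconvol (k j : 'I_N) (x : R) : R := \int[leb]_y (dmu C k j (x - y) * f j y).

Definition conv_row (k : 'I_N) (x : R) : 'rV[R]_N := \row_j convol (mu P k j) (f j) x.

Definition dnonlocal (k : 'I_N) (x : R) : R :=
  \sum_(j < N) dnu C k j (conv_row k x) * dconvol k j x.

Lemma lipschitz_continuous (g : R -> R) (L : R) :
  (forall x y, `|g y - g x| <= L * `|y - x|) -> continuous g.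
Proof.
move=> gL x; apply/cvgrPdist_le => e e0.
have L0 : 0 < `|L| + 1 by rewrite ltr_wpDl.
near=> y; rewrite distrC; apply: le_trans (gL _ _) _.
apply: (@le_trans _ _ ((`|L| + 1) * `|y - x|)).
  by rewrite ler_wpM2r// (le_trans (ler_norm _))// lerDl.
rewrite mulrC -ler_pdivlMr// distrC; near: y.
have := @cvgr_dist_le _ _ _ (nbhs x) _ id x cvg_id _ (divr_gt0 e0 L0).
exact.
Unshelve. all: by end_near. Qed.

Lemma mu_meas k j x : measurable_fun [set: R] (fun y => mu P k j (x - y)).
Proof.
have [_ _ _ mL _] := mu_reg C k j.
apply: measurableT_comp; last exact: measurable_funB.
by apply: continuous_measurable_fun; exact: lipschitz_continuous mL.
Qed.

Lemma dmu_meas k j x : measurable_fun [set: R] (fun y => dmu C k j (x - y)).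
Proof.
have [_ _ _ _ [mL _]] := mu_reg C k j.
apply: measurableT_comp; last exact: measurable_funB.
by apply: continuous_measurable_fun; exact: lipschitz_continuous mL.
Qed.

Let f_mass j : exists2 A : R, 0 <= A & (L1on [set: R] (f j) <= A%:E)%E.
Proof.
have /integrableP[_ ffin] := fi j.
have ffn : L1on [set: R] (f j) \is a fin_num by rewrite ge0_fin_numE ?L1on_ge0.
by exists (fine (L1on [set: R] (f j))); rewrite ?fineK// fine_ge0// L1on_ge0.
Qed.

Let kernel_int j (g : R -> R) (b : R) : 0 <= b -> measurable_fun [set: R] g ->
  (forall y, `|g y| <= b) -> leb.-integrable [set: R] (EFin \o (fun y => g y * f j y)).
Proof.
move=> b0 mg gb; have [A A0 fA] := f_mass j.
apply: (@integrable_L1on _ _ (b * A)); first exact: measurable_funM.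
exact: L1on_kernel.
Qed.

Let kernel_le j (g : R -> R) (b A : R) : 0 <= b -> measurable_fun [set: R] g ->
  (forall y, `|g y| <= b) -> (L1on [set: R] (f j) <= A%:E)%E ->
  `|\int[leb]_y (g y * f j y)| <= b * A.
Proof.
move=> b0 mg gb fA; apply: Rintegral_le_L1on; first exact: measurable_funM.
exact: L1on_kernel.
Qed.

(** The second order Taylor estimate of the kernel is integrated against [f], which
replaces differentiation under the integral sign. *)
Lemma convol_taylor k j : exists2 A : R, 0 <= A & forall x h,
  [/\ `|dconvol k j x| <= A,
   `|convol (mu P k j) (f j) (x + h) - convol (mu P k j) (f j) x| <= A * `|h| &
   `|convol (mu P k j) (f j) (x + h) - convol (mu P k j) (f j) x - h * dconvol k j x|
     <= A * h ^+ 2].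
Proof.
have [A A0 fA] := f_mass j.
have [B0 mB dmB mL [dmL mT]] := mu_reg C k j.
exists (B * A) => [|x h]; first by rewrite mulr_ge0.
have mh := mu_meas k j (x + h); have m0 := mu_meas k j x; have md := dmu_meas k j x.
have i1 := kernel_int j B0 mh (fun y => mB (x + h - y)).
have i2 := kernel_int j B0 m0 (fun y => mB (x - y)).
have i3 := kernel_int j B0 md (fun y => dmB (x - y)).
have h0 : forall y, x + h - y - (x - y) = h by move=> y; ring.
have D : convol (mu P k j) (f j) (x + h) - convol (mu P k j) (f j) x =
    \int[leb]_y ((mu P k j (x + h - y) - mu P k j (x - y)) * f j y).
  rewrite /convol -RintegralB//; apply: eq_Rintegral => y _; ring.
split.
- by apply: kernel_le => // y; exact: dmB.
- rewrite D mulrAC; apply: kernel_le => //; first by rewrite mulr_ge0.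
    exact: measurable_funB.
  by move=> y; apply: le_trans (mL _ _) _; rewrite h0.
have -> : convol (mu P k j) (f j) (x + h) - convol (mu P k j) (f j) x - h * dconvol k j x =
    \int[leb]_y ((mu P k j (x + h - y) - mu P k j (x - y) - dmu C k j (x - y) * h) * f j y).
  rewrite D /dconvol -RintegralZl// -RintegralB//.
  - by apply: eq_Rintegral => y _; ring.
  - apply: (@kernel_int j (fun y => mu P k j (x + h - y) - mu P k j (x - y)) (B * `|h|)).
    + by rewrite mulr_ge0.
    + exact: measurable_funB.
    + by move=> y; apply: le_trans (mL _ _) _; rewrite h0.
  - by have := integrableZl measurableT h i3.
rewrite mulrAC; apply: kernel_le => //; first by rewrite mulr_ge0// sqr_ge0.
  by apply: measurable_funB; [exact: measurable_funB|exact: measurable_funM].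
move=> y; have := mT (x - y) (x + h - y); rewrite h0 => /le_trans; apply.
by rewrite real_normK ?num_real.
Qed.

Lemma derive1_of_taylor (g : R -> R) (x d K : R) :
  (forall h, `|g (x + h) - g x - h * d| <= K * h ^+ 2) -> derive1 g x = d.
Proof.
move=> T; apply: cvg_lim => //; apply/cvgrPdist_le => e e0.
have K0 : 0 < `|K| + 1 by rewrite ltr_wpDl.
have eK := divr_gt0 e0 K0.
near=> h.
have hn0 : h != 0 by near: h; exact: nbhs_dnbhs_neq.
have he : `|h| <= e / (`|K| + 1).
  near: h; apply: nbhs_dnbhs; exists (e / (`|K| + 1)) => //= z /=.
  by rewrite sub0r normrN => /ltW.
have h0 : 0 < `|h| by rewrite normr_gt0.
rewrite distrC (_ : _ - d = h^-1 * (g (x + h) - g x - h * d)); last first.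
  by rewrite /GRing.scale /= [h + x]addrC; field.
rewrite normrM normfV -(ler_pM2l h0) mulrA divff ?gt_eqF// mul1r.
apply: le_trans (T h) _.
apply: (@le_trans _ _ ((`|K| + 1) * `|h| ^+ 2)).
  rewrite real_normK ?num_real// ler_wpM2r ?sqr_ge0//.
  by rewrite (le_trans (ler_norm _))// lerDl.
rewrite expr2 mulrCA ler_wpM2l ?(ltW h0)//.
by rewrite mulrC -ler_pdivlMr.
Unshelve. all: by end_near. Qed.

Lemma derive1_nonlocal k x :
  derive1 (fun x => nu P k (conv_row k x)) x = dnonlocal k x.
Proof.
have /choice[A AP] : forall j, exists A : R, 0 <= A /\ forall x h,
  [/\ `|dconvol k j x| <= A,
   `|convol (mu P k j) (f j) (x + h) - convol (mu P k j) (f j) x| <= A * `|h| &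
   `|convol (mu P k j) (f j) (x + h) - convol (mu P k j) (f j) x - h * dconvol k j x|
     <= A * h ^+ 2].
  by move=> j; have [A A0 AP] := convol_taylor k j; exists A.
have [B0 nB dnB nL [dnL nT]] := nu_reg C k.
pose S := \sum_j A j.
apply: (@derive1_of_taylor _ _ _ (B * S ^+ 2 + B * S)) => h.
have T := nT (conv_row k x) (conv_row k (x + h)).
have n1 : norm1 (conv_row k (x + h) - conv_row k x) <= S * `|h|.
  rewrite /norm1 /S mulr_suml; apply: ler_sum => j _; rewrite !mxE.
  by have [_ /(_ x h)[_ -> _]] := AP j.
have n2 : `|\sum_(j < N) dnu C k j (conv_row k x) * (conv_row k (x + h) - conv_row k x) 0 j
    - h * dnonlocal k x| <= B * S * h ^+ 2.
  rewrite /dnonlocal mulr_sumr -sumrB; apply: le_trans (ler_norm_sum _ _ _) _.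
  rewrite /S -mulrA mulr_suml mulr_sumr; apply: ler_sum => j _.
  rewrite mulrCA -mulrBr normrM !mxE ler_pM//.
  by have [_ /(_ x h)[_ _ ->]] := AP j.
set Sg := \sum_(j < N) _ in T n2.
rewrite (_ : _ - h * dnonlocal k x =
  (nu P k (conv_row k (x + h)) - nu P k (conv_row k x) - Sg) + (Sg - h * dnonlocal k x));
  last by ring.
rewrite mulrDl; apply: le_trans (ler_normD _ _) _; apply: lerD => //.
apply: le_trans T _; rewrite -mulrA ler_wpM2l// -(real_normK (num_real h)) -exprMn.
by rewrite ler_pXn2r// ?nnegrE ?norm1_ge0//; apply: le_trans n1; exact: norm1_ge0.
Qed.

Lemma mu_cell_near k j (dx x y : R) (i : int) : 0 < dx -> `|x - xgrid dx i| <= dx / 2 ->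
  `|mu P k j (xhalf dx (i - xindex dx y)) - mu P k j (x - y)| <= B * (3 / 2 * dx).
Proof.
move=> dx0 xi; have [B0 mB dmB mL [dmL mT]] := mu_reg C k j.
apply: le_trans (mL _ _) _; rewrite ler_wpM2l//.
have yi := xindex_near y dx0; move: xi yi; rewrite xhalfE /xgrid intrB.
set a := i%:~R; set b := (xindex dx y)%:~R.
rewrite (_ : (a - b + 1 / 2) * dx = a * dx - b * dx + dx / 2); last by field.
by move: (a * dx) (b * dx) => p q; rewrite !ler_norml; lra.
Qed.

Lemma dmu_cell_near k j (dx x y : R) (i : int) : 0 < dx -> `|x - xgrid dx i| <= dx / 2 ->
  `|(mu P k j (xhalf dx (i - xindex dx y)) - mu P k j (xhalf dx (i - 1 - xindex dx y))) / dx
    - dmu C k j (x - y)| <= B * (5 / 2 * dx).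
Proof.
move=> dx0 xi; have [B0 mB dmB mL [dmL mT]] := mu_reg C k j.
have -> : xhalf dx (i - xindex dx y) = xhalf dx (i - 1 - xindex dx y) + dx.
  by rewrite !xhalfE !intrB; ring.
set a := xhalf dx (i - 1 - xindex dx y).
have ay : `|a - (x - y)| <= 3 / 2 * dx.
  have yi := xindex_near y dx0; move: xi yi; rewrite /a xhalfE /xgrid !intrB.
  set p := i%:~R; set q := (xindex dx y)%:~R.
  rewrite (_ : (p - 1 - q + 1 / 2) * dx = p * dx - q * dx - dx / 2); last by field.
  by move: (p * dx) (q * dx) => p' q'; rewrite !ler_norml; lra.
have h1 := mT a (a + dx); rewrite (_ : a + dx - a = dx) in h1; last by ring.
have h2 := dmL (x - y) a.
have -> : (mu P k j (a + dx) - mu P k j a) / dx - dmu C k j (x - y) =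
  (mu P k j (a + dx) - mu P k j a - dmu C k j a * dx) / dx + (dmu C k j a - dmu C k j (x - y)).
  by field; rewrite gt_eqF.
have -> : B * (5 / 2 * dx) = B * dx + B * (3 / 2 * dx) by field.
apply: le_trans (ler_normD _ _) _; apply: lerD; last first.
  by apply: le_trans h2 _; rewrite ler_wpM2l.
rewrite normrM normfV (gtr0_norm dx0) ler_pdivrMr// (le_trans h1)//.
by rewrite (gtr0_norm dx0) expr2 mulrA.
Qed.

(** The kernel is sampled within [dx] of the exact points; the regularity of [nu]
carries the error of [kernel_near] over to the velocity. For the difference
quotient the same is done with the derivative of the kernel, after a second
order expansion of [nu]. The constant depends on [x] and [f] but not on the
mesh. *)
Lemma vel_near k x : exists2 K : R, 0 <= K &
  forall (dx e : R) (u : 'I_N -> int -> R), 0 < dx -> 0 <= e ->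
    mass_le dx M u -> (forall j, (zTV (u j) <= V%:E)%E) ->
    (forall j, (L1on [set: R] (fun y => u j (xindex dx y) - f j y)%R <= e%:E)%E) ->
    let i := xindex dx x in
    `|vel P kappa dx u k i - nu P k (conv_row k x)| <= K * (dx + e) /\
    `|(vel P kappa dx u k i - vel P kappa dx u k (i - 1)) / dx - dnonlocal k x|
      <= K * (dx + e).
Proof.
have [B0 nB dnB nL [dnL nT]] := nu_reg C k.
pose c1 := B * (3 / 2) * M + B * V + B.
pose c2 := B * (5 / 2) * M + B * V + B.
have c10 : 0 <= c1 by rewrite !addr_ge0// !mulr_ge0// divr_ge0.
have c20 : 0 <= c2 by rewrite !addr_ge0// !mulr_ge0// divr_ge0.
pose Q := \sum_(j < N) `|dconvol k j x|.
have Q0 : 0 <= Q by apply: sumr_ge0.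
pose K1 := B * (N%:R * c1).
pose K2 := B * (N%:R * (B * M)) ^+ 2 + (N%:R * (B * c2) + B * (N%:R * c1) * Q).
have K10 : 0 <= K1 by rewrite !mulr_ge0.
have K20 : 0 <= K2 by rewrite !addr_ge0// ?mulr_ge0// ?sqr_ge0// !mulr_ge0.
exists (K1 + K2); first exact: addr_ge0.
move=> dx e u dx0 e0 um uV ue i.
have dxe : 0 <= dx + e by rewrite addr_ge0// ltW.
have xi := xindex_near x dx0; rewrite -/i in xi.
have cn j : `|cvec P kappa dx u k i 0 j - convol (mu P k j) (f j) x| <= c1 * (dx + e).
  have [_ mB dmB mL [dmL mT]] := mu_reg C k j.
  have h := @kernel_near _ kappa dx M V B (B * (3 / 2 * dx)) e
    (fun p => mu P k j (xhalf dx (i - p))) (fun y => mu P k j (x - y)) (f j) (u j)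
    kappa01 dx0 M0 V0 B0 _ (fun p => mB _) (mu_meas k j x) (fun y => mB _)
    (fun y => mu_cell_near k j y dx0 xi) (um j) (uV j) (mf j) (fi j) (ue j).
  rewrite mxE; apply: le_trans (h _) _.
    by rewrite mulr_ge0// mulr_ge0// ?divr_ge0// ltW.
  rewrite /c1 -subr_ge0 (_ : _ - _ = B * (3 / 2) * M * e + B * V * e + B * dx); last by ring.
  by rewrite !addr_ge0// !mulr_ge0// ?divr_ge0// ltW.
have dn j : `|(cvec P kappa dx u k i 0 j - cvec P kappa dx u k (i - 1) 0 j) / dx -
    dconvol k j x| <= c2 * (dx + e).
  have [_ mB dmB mL [dmL mT]] := mu_reg C k j.
  have eM := l1Z_edge kappa01 (um j).
  pose q p := (mu P k j (xhalf dx (i - p)) - mu P k j (xhalf dx (i - 1 - p))) / dx.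
  have qB p : `|q p| <= B.
    rewrite /q normrM normfV (gtr0_norm dx0) ler_pdivrMr//.
    apply: le_trans (mL _ _) _; rewrite (_ : _ - _ = dx) ?gtr0_norm//.
    by rewrite !xhalfE !intrB; ring.
  have -> : (cvec P kappa dx u k i 0 j - cvec P kappa dx u k (i - 1) 0 j) / dx =
      dx * zsum (fun p => q p * edge kappa (u j) p).
    rewrite !mxE -mulrBr (@zsum_kernelB _ _ _ _ B (M / dx))//.
    rewrite (_ : (fun p => _) = (fun p => (dx * q p) * edge kappa (u j) p)); last first.
      by apply/funext => p; congr (_ * _); rewrite /q; field; rewrite gt_eqF.
    have qe := l1Z_kernel B0 qB eM.
    rewrite mulrAC mulfV ?gt_eqF// mul1r -(Rintegral_step dx0 qe).
    have dqe : (l1Z (fun p => dx * q p * edge kappa (u j) p)%R <= (dx * (B * (M / dx)))%:E)%E.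
      apply: l1Z_leM qe; first exact: ltW.
      by move=> p; rewrite -mulrA normrM (gtr0_norm dx0).
    apply: (@mulfI _ dx); first by rewrite gt_eqF.
    rewrite -(Rintegral_step dx0 dqe) -RintegralZl//; last exact: integrable_step qe.
    by apply: eq_Rintegral => y _; rewrite mulrA.
  have h := @kernel_near _ kappa dx M V B (B * (5 / 2 * dx)) e
    q (fun y => dmu C k j (x - y)) (f j) (u j)
    kappa01 dx0 M0 V0 B0 _ qB (dmu_meas k j x) (fun y => dmB _)
    (fun y => dmu_cell_near k j y dx0 xi) (um j) (uV j) (mf j) (fi j) (ue j).
  apply: le_trans (h _) _.
    by rewrite mulr_ge0// mulr_ge0// ?divr_ge0// ltW.
  rewrite /c2 -subr_ge0 (_ : _ - _ = B * (5 / 2) * M * e + B * V * e + B * dx); last by ring.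
  by rewrite !addr_ge0// !mulr_ge0// ?divr_ge0// ltW.
have n1 : norm1 (cvec P kappa dx u k i - conv_row k x) <= N%:R * c1 * (dx + e).
  rewrite /norm1; apply: (@le_trans _ _ (\sum_(j < N) c1 * (dx + e))).
    by apply: ler_sum => j _; have := cn j; rewrite !mxE.
  rewrite sumr_const card_ord -[c1 * _ *+ _]mulr_natl le_eqVlt; apply/orP; left.
  by apply/eqP; ring.
split.
  apply: le_trans (nL _ _) _; apply: (@le_trans _ _ (K1 * (dx + e))).
    by rewrite /K1 -mulrA ler_wpM2l.
  by rewrite ler_wpM2r// lerDl.
apply: (@le_trans _ _ (K2 * (dx + e))); last by rewrite ler_wpM2r// lerDr.
have T := nT (cvec P kappa dx u k i) (cvec P kappa dx u k (i - 1)).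
have nd := norm1_cvec_diff C kappa01 dx0 um k i.
set ci := cvec P kappa dx u k i in T nd n1 cn dn *.
set ci' := cvec P kappa dx u k (i - 1) in T nd dn *.
pose Sg := \sum_(j < N) dnu C k j ci * ((ci 0 j - ci' 0 j) / dx).
have SgE : \sum_(j < N) dnu C k j ci * (ci' - ci) 0 j = - (Sg * dx).
  rewrite /Sg mulr_suml -sumrN; apply: eq_bigr => j _; rewrite !mxE.
  by field; rewrite gt_eqF.
rewrite SgE in T.
have t1 : `|(vel P kappa dx u k i - vel P kappa dx u k (i - 1)) / dx - Sg| <=
    B * (N%:R * (B * M)) ^+ 2 * dx.
  rewrite (_ : _ / dx - Sg = - ((vel P kappa dx u k (i - 1) - vel P kappa dx u k i - - (Sg * dx)) / dx)); last first.
    by field; rewrite gt_eqF.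
  rewrite normrN normrM normfV (gtr0_norm dx0) ler_pdivrMr//.
  apply: le_trans T _.
  rewrite (_ : _ * dx * dx = B * (N%:R * (B * M) * dx) ^+ 2); last by ring.
  rewrite ler_wpM2l//.
  rewrite ler_pXn2r// ?nnegrE ?norm1_ge0//.
    by rewrite -norm1N opprB.
  by apply: mulr_ge0; [rewrite !mulr_ge0|exact: ltW].
have t2 : `|Sg - dnonlocal k x| <= (N%:R * (B * c2) + B * (N%:R * c1) * Q) * (dx + e).
  have -> : Sg - dnonlocal k x =
     \sum_(j < N) dnu C k j ci * ((ci 0 j - ci' 0 j) / dx - dconvol k j x) +
     \sum_(j < N) (dnu C k j ci - dnu C k j (conv_row k x)) * dconvol k j x.
    by rewrite /Sg /dnonlocal -sumrB -big_split/=; apply: eq_bigr => j _; ring.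
  rewrite mulrDl; apply: le_trans (ler_normD _ _) _; apply: lerD.
    apply: le_trans (ler_norm_sum _ _ _) _.
    apply: (@le_trans _ _ (\sum_(j < N) B * (c2 * (dx + e)))).
      by apply: ler_sum => j _; rewrite normrM ler_pM.
    rewrite sumr_const card_ord -[B * _ *+ _]mulr_natl le_eqVlt; apply/orP; left.
    by apply/eqP; ring.
  apply: le_trans (ler_norm_sum _ _ _) _.
  rewrite mulrAC /Q mulr_sumr; apply: ler_sum => j _; rewrite normrM ler_wpM2r//.
  by apply: le_trans (dnL _ _ _) _; rewrite -mulrA ler_wpM2l.
rewrite (_ : _ - dnonlocal k x =
  ((vel P kappa dx u k i - vel P kappa dx u k (i - 1)) / dx - Sg) + (Sg - dnonlocal k x));
  last by ring.
apply: le_trans (ler_normD _ _) _; rewrite /K2 [leRHS]mulrDl; apply: lerD => //.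
apply: le_trans t1 _; apply: ler_wpM2l; last by rewrite lerDl.
by apply: mulr_ge0 => //; exact: sqr_ge0.
Qed.

End NonlocalLimit.

(** * The limit of a subsequence *)

Section SpaceTimeIntegrals.
Context {R : realType}.
Local Notation leb := (@lebesgue_measure R).

(** The integral of a nonnegative function is a supremum over simple functions below
it, so it is monotone in the domain even over sets that are not known to be
measurable, such as compact subsets of the plane. *)
Lemma subset_integral_nomeas d (T : measurableType d) (m : {measure set T -> \bar R})
    (A B : set T) (f : T -> \bar R) : A `<=` B -> (forall x, (0 <= f x)%E) ->
  (\int[m]_(x in A) f x <= \int[m]_(x in B) f x)%E.
Proof.
move=> AB f0; rewrite !ge0_integralE//; apply: ereal_sup_le => _ [h hf <-].
exists h => // x; apply: le_trans (hf x) _; rewrite !patchE.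
case: ifPn => [/set_mem/AB/mem_set ->//|_].
by case: ifP.
Qed.

Lemma leb2_slab_integral_le (T c : R) (g : R * R -> R) : 0 <= T -> 0 <= c ->
  measurable_fun [set: R * R] g ->
  (forall t, 0 <= t <= T -> (L1on [set: R] (fun x => g (t, x)) <= c%:E)%E) ->
  (\int[leb2]_(z in QTbar T) `|g z|%:E <= (c * T)%:E)%E.
Proof.
move=> T0 c0 mg gc.
have mQ : measurable (QTbar T : set (R * R)).
  by apply: measurableX => //; exact: measurable_itv.
rewrite integral_mkcond fubini_tonelli1//; first last.
- by move=> z; rewrite patchE; case: ifP.
- apply/(measurable_restrictT _ _).1 => //; apply: measurable_funTS.
  by apply/measurable_EFinP; exact: measurableT_comp.
rewrite /fubini_F.
apply: (@le_trans _ (\bar R) (\int[leb]_(t in (`[0%R, T]%classic : set R)) (c%:E : \bar R))%E); last first.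
  rewrite lebesgue_integral_cst// lebesgue_measure_itv/= lte_fin.
  by case: ltP => h; [rewrite -EFinB subr0|rewrite mule0 lee_fin mulr_ge0].
rewrite [leRHS]integral_mkcond; apply: ge0_le_integral => //.
- by move=> t _; apply: integral_ge0 => x _; rewrite patchE; case: ifP.
- apply: measurable_fun_fubini_tonelli_F => //; last first.
    by move=> z; rewrite patchE; case: ifP.
  apply/(measurable_restrictT _ _).1 => //; apply: measurable_funTS.
  by apply/measurable_EFinP; exact: measurableT_comp.
- by apply/(measurable_restrictT _ _).1 => //; exact: measurable_cst.
move=> t _; rewrite [leRHS]patchE; case: ifPn => tT.
  have tT' : 0 <= t <= T by move/set_mem: tT; rewrite /= in_itv.
  apply: le_trans (gc t tT'); apply: ge0_le_integral => //.
  - by move=> x _; rewrite patchE; case: ifP.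
  - apply: (measurable_fun_pair2 (f := (fun z : R * R => `|g z|%:E) \_ (QTbar T))).
    apply/(measurable_restrictT _ _).1 => //; apply: measurable_funTS.
    by apply/measurable_EFinP; exact: measurableT_comp.
  - by apply: measurable_norm; exact: measurable_fun_pair2.
  - by move=> x _; rewrite patchE; case: ifP => _ //; rewrite lee_fin.
rewrite integral0_eq// => x _; rewrite patchE ifF//.
apply/negbTE; apply: contra tT => /set_mem [tT _]; exact/mem_set.
Qed.

End SpaceTimeIntegrals.

Section SequenceLimit.
Context {R : realType} {N : nat}.
Local Notation leb := (@lebesgue_measure R).
Variables (P : ivp R N) (sch : flux_type R) (lambda kappa T : R).
Variables (C : constants P sch lambda) (D : data P).
Context (kappa01 : 0 <= kappa <= 1) (T0 : 0 < T).

Local Notation w dx := (Udelta P sch lambda kappa dx).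

(** Convergence in mean holds with a uniform rate at every time, not only at almost
every one; the continuity in time of the limit rests on this. *)
Record limit_of (dx : nat -> R) (U : 'I_N -> R -> R -> R) : Prop := LimitOf {
  lim_meas : forall k, measurable_fun [set: R * R] (fun z : R * R => U k z.1 z.2);
  lim_bnd : forall k t x, `|U k t x| <= U_sup T C D;
  lim_L1 : forall j k t, 0 <= t <= T ->
    (L1on [set: R] (fun x => w (dx j) k t x - U k t x)%R <= ((1 / 2) ^+ j)%:E)%E;
  lim_bv : forall k t, 0 <= t <= T ->
    exists2 r : R -> R, bv_le r (U_TV T C D) & {ae leb, forall x, r x = U k t x};
  lim_ae : forall k t, 0 <= t <= T ->
    {ae leb, forall x, w (dx j) k t x @[j --> \oo] --> U k t x};
  lim_ae2 : forall k, {ae leb2, forall z : R * R, QTbar T z ->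
    w (dx j) k z.1 z.2 @[j --> \oo] --> U k z.1 z.2} }.

Lemma dt_cvg0 (dx : nat -> R) : dx @ \oo --> (0 : R) ->
  dt lambda (dx m) @[m --> \oo] --> (0 : R).
Proof.
move=> dx0; rewrite -[X in _ --> X](mulr0 lambda).
by apply: cvgM => //; exact: cvg_cst.
Qed.

Lemma exists_limit (dx : nat -> R) (NT : nat -> nat) : (0 < N)%N ->
  (forall m, mesh P sch lambda kappa (dx m) T (NT m)) -> dx @ \oo --> (0 : R) ->
  exists (s : nat -> nat) (U : 'I_N -> R -> R -> R),
    (forall m n, (m < n)%N -> (s m < s n)%N) /\ limit_of (dx \o s) U.
Proof.
move=> N0 Mh dx0; pose k0 := Ordinal N0.
have [F [FU ooF]] := free_ultrafilter.
have tail e : 0 < e -> exists2 X, 0 <= X & forall m k t, 0 <= t <= T ->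
    (L1on (outside X) (w (dx m) k t) <= e%:E)%E.
  move=> e0; have [Y Y0 YP] := data_tail D e0.
  have l0 := lam_gt0 C.
  exists (Y + 4 * (T / lambda)) => [|m k t tT].
    by rewrite addr_ge0// mulr_ge0// divr_ge0// ltW.
  exact: le_trans (Udelta_tail C D T0 (Mh m) k Y0 tT) (YP k).
have [s [s_incr sP]] := @uniform_subsequence R N T (U_sup T C D) (U_TV T C D)
  (time_rate T C D) (fun m => dt lambda (dx m)) (fun m => w (dx m)) T0
  (U_TV_ge0 C D T0 k0) (time_rate_ge0 C D T0 k0)
  (fun m k t x tT => Udelta_le C D kappa01 (Mh m) k x tT)
  (fun m k t tT => Udelta_bv C D kappa01 (Mh m) k tT)
  (fun m k s t sT tT => Udelta_time C D kappa01 T0 (Mh m) k sT tT)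
  (dt_cvg0 dx0) tail F FU ooF.
exists s, (space_time_limit T (fun j => w (dx (s j)))); split => //.
have bnd j k t x : 0 <= t <= T -> `|w (dx (s j)) k t x| <= U_sup T C D.
  by move=> tT; exact: (Udelta_le C D kappa01 (Mh (s j)) k x tT).
have bv j k t : 0 <= t <= T -> bv_le (w (dx (s j)) k t) (U_TV T C D).
  by move=> tT; exact: (Udelta_bv C D kappa01 (Mh (s j)) k tT).
have meas j k : measurable_fun [set: R * R]
    (fun z : R * R => w (dx (s j)) k z.1 z.2).
  exact: (Udelta_meas C (Mh (s j)) k).
split=> /=.
- by move=> k; exact: (space_time_limit_meas T meas k).
- by move=> k t x; apply: (space_time_limit_bnd bnd); exact: (U_sup_ge0 T C D k).
- by move=> j k t; apply: (space_time_limit_L1 meas sP).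
- by move=> k t; apply: (space_time_limit_bv bnd bv meas sP).
- by move=> k t; apply: (space_time_limit_ae meas sP).
- by move=> k; apply: (space_time_limit_ae2 meas sP).
Qed.

Variables (dx : nat -> R) (NT : nat -> nat) (U : 'I_N -> R -> R -> R).
Context (Mh : forall m, mesh P sch lambda kappa (dx m) T (NT m)).
Context (dx0 : dx @ \oo --> (0 : R)) (UP : limit_of dx U).

Lemma limit_measx k t : measurable_fun [set: R] (U k t).
Proof. exact: (measurableT_comp (lim_meas UP k) (measurable_pair1 t)). Qed.

Let w_meas j k t : measurable_fun [set: R] (w (dx j) k t).
Proof. exact: (measurableT_comp (Udelta_meas C (Mh j) k) (measurable_pair1 t)). Qed.

Lemma limit_L1on k t : 0 <= t <= T ->
  (L1on [set: R] (U k t) <= (mass D + 1)%:E)%E.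
Proof.
move=> tT; apply: (L1on_leD measurableT (w_meas 0 k t)
  (measurable_funB (w_meas 0 k t) (limit_measx k t)) (limit_measx k t)).
- move=> x _; rewrite -[in leLHS](subKr (w (dx 0%N) k t x) (U k t x)).
  exact: ler_normB.
- by rewrite (Udelta_mass C D (Mh 0%N) k tT); exact: U0_mass.
- by have := lim_L1 UP 0 k tT; rewrite expr0.
Qed.

Lemma limit_integrable k t : 0 <= t <= T ->
  leb.-integrable [set: R] (EFin \o U k t).
Proof.
move=> tT; apply/integrableP; split.
  by apply/measurable_EFinP; exact: limit_measx.
exact: le_lt_trans (limit_L1on k tT) (ltry _).
Qed.

(** The time step by which the approximations miss the Lipschitz bound vanishes in
the limit. *)
Lemma limit_time k s t : 0 <= s <= T -> 0 <= t <= T ->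
  (L1on [set: R] (fun x => U k s x - U k t x)%R
    <= (time_rate T C D * `|s - t|)%:E)%E.
Proof.
move=> sT tT; apply/lee_addgt0Pr => e e0.
have c : (1 / 2) ^+ j + (time_rate T C D * dt lambda (dx j) + (1 / 2) ^+ j)
    @[j --> \oo] --> (0 : R).
  have g : (1 / 2 : R) ^+ j @[j --> \oo] --> (0 : R).
    by apply: cvg_expr; rewrite ger0_norm ?divr_ge0// ltr_pdivrMr// mul1r ltr1n.
  rewrite -[X in _ --> X](_ : 0 + (time_rate T C D * 0 + 0) = 0); last by ring.
  by apply: cvgD => //; apply: cvgD => //; apply: cvgM; [exact: cvg_cst|exact: dt_cvg0].
have [j _ /(_ j (leqnn j)) cj] := cvgr_le _ c _ e0.
apply: le_trans (_ : (((1 / 2) ^+ j + (time_rate T C D * (`|s - t|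
   + dt lambda (dx j)) + (1 / 2) ^+ j))%:E <= _)%E); last first.
  by rewrite -EFinD lee_fin mulrDr; move: cj => /=; lra.
have ms := w_meas j k s; have mt := w_meas j k t.
have Us := limit_measx k s; have Ut := limit_measx k t.
have m1 : measurable_fun [set: R] (fun x => w (dx j) k s x - U k s x).
  exact: measurable_funB.
have m2 : measurable_fun [set: R] (fun x => w (dx j) k s x - w (dx j) k t x).
  exact: measurable_funB.
have m3 : measurable_fun [set: R] (fun x => w (dx j) k t x - U k t x).
  exact: measurable_funB.
have m4 : measurable_fun [set: R] (fun x => U k s x - U k t x).
  exact: measurable_funB.
apply: (L1on_leD measurableT m1 (measurable_funD m2 m3) m4) => //.
- move=> x _; rewrite (_ : U k s x - U k t x = - (w (dx j) k s x - U k s x) +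
    ((w (dx j) k s x - w (dx j) k t x) + (w (dx j) k t x - U k t x))); last by ring.
  by rewrite -[in leRHS]normrN; exact: ler_normD.
- exact: lim_L1.
apply: (L1on_leD measurableT m2 m3 (measurable_funD m2 m3)) => //.
- by move=> x _; exact: ler_normD.
- exact: (Udelta_time C D kappa01 T0 (Mh j) k sT tT).
- exact: lim_L1.
Qed.

Lemma limit_solution_space : solution_space T U.
Proof.
have itvT t : t \in `[0, T] = (0 <= t <= T) by rewrite in_itv.
move=> k; split.
- by apply: measurable_funTS; exact: (lim_meas UP k).
- by move=> t; rewrite itvT; exact: limit_integrable.
- move=> t; rewrite itvT => tT.
  have c0 : (time_rate T C D * `|s - t|)%:E @[s --> within `[0, T] (nbhs t)] --> 0%E.
    apply: cvg_EFin; first exact: nearW.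
    apply: cvg_within_filter.
    have h : time_rate T C D * `|s - t| @[s --> t] --> time_rate T C D * `|t - t|.
      apply: cvgM; [exact: cvg_cst|]; apply: cvg_norm.
      by apply: cvgB => //; exact: cvg_cst.
    by rewrite subrr normr0 mulr0 in h.
  apply: squeeze_cvge c0; last exact: cvg_cst.
  rewrite near_withinE; apply: nearW => s; rewrite /= in_itv/= => sT.
  by rewrite /L1_norm Lnorm1 L1on_ge0/= (limit_time k sT tT).
exists (mass D + 1 + U_TV T C D); apply/aeW => t; rewrite itvT => tT.
rewrite EFinD; apply: leeD; first by rewrite /L1_norm Lnorm1; exact: limit_L1on.
have [r rb rU] := lim_bv UP k tT.
by apply: ereal_inf_le; exists (TV r); [exists r|exact: bv_le_TV].
Qed.

Lemma limit_compact k (K : set (R * R)) : K `<=` QTbar T ->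
  (\int[leb2]_(z in K) `|w (dx m) k z.1 z.2 - U k z.1 z.2|%:E)%E @[m --> \oo]
    --> 0%E.
Proof.
move=> KQ.
have c0 : ((1 / 2) ^+ m * T)%:E @[m --> \oo] --> (0 : \bar R).
  apply: cvg_EFin; first exact: nearW.
  rewrite -[X in _ --> X](mul0r T); apply: cvgM; [|exact: cvg_cst].
  by apply: cvg_expr; rewrite ger0_norm ?divr_ge0// ltr_pdivrMr// mul1r ltr1n.
apply: squeeze_cvge c0; last exact: cvg_cst.
apply: nearW => m; apply/andP; split; first exact: integral_ge0.
apply: le_trans (@subset_integral_nomeas R _ _ (@leb2 R) _ _ _ KQ _) _ => //.
apply: (@leb2_slab_integral_le _ T ((1 / 2) ^+ m)
  (fun z => w (dx m) k z.1 z.2 - U k z.1 z.2)) => //.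
- exact: ltW.
- by apply: measurable_funB; [exact: (Udelta_meas C (Mh m) k)|exact: (lim_meas UP k)].
- by move=> t tT /=; exact: lim_L1.
Qed.

End SequenceLimit.

(** * Summation of the discrete entropy inequality *)

Lemma maxr_dist (R : realDomainType) (a b c : R) :
  `|Num.max a c - Num.max b c| <= `|a - b|.
Proof.
rewrite ler_norml; have := ler_norm (a - b); have := ler_norm (- (a - b)).
rewrite normrN; move: `|a - b| => d.
by case: (leP a c); case: (leP b c) => ? ? ? ?; apply/andP; split; lra.
Qed.

Lemma minr_dist (R : realDomainType) (a b c : R) :
  `|Num.min a c - Num.min b c| <= `|a - b|.
Proof.
rewrite ler_norml; have := ler_norm (a - b); have := ler_norm (- (a - b)).
rewrite normrN; move: `|a - b| => d.
by case: (leP a c); case: (leP b c) => ? ? ? ?; apply/andP; split; lra.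
Qed.

Section DiscreteEntropy.
Context {R : realType} {N : nat}.
Variables (P : ivp R N) (sch : flux_type R) (lambda kappa T : R).
Variables (C : constants P sch lambda) (D : data P).
Context (kappa01 : 0 <= kappa <= 1) (T0 : 0 < T).
Variables (dx : R) (NT : nat).
Context (Mh : mesh P sch lambda kappa dx T NT).

Let dx0 : 0 < dx := dx_gt0 Mh.
Let l0 : 0 < lambda := lam_gt0 C.
Let dt0 : 0 < dt lambda dx := dt_gt0 C Mh.

Local Notation U := (Un P sch lambda kappa dx).
Local Notation s := (sigma_ P dx).
Local Notation b n := (bar P dx (U n)).
Local Notation v n := (vel P kappa dx (U n)).

Variables (k : 'I_N) (alpha : R) (p : nat -> int -> R).

Definition entropy_density (n : nat) (i : int) : R :=
  `|U n k i - alpha / s k i| * ((p n i - p n.-1 i) / dt lambda dx)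
  + Num.sg (b n k i - alpha) * v n k i * (flux P k (b n k i) - flux P k alpha)
    * ((p n (i + 1) - p n i) / dx)
  - flux P k alpha * Num.sg (b n k i - alpha)
    * ((v n.-1 k i - v n.-1 k (i - 1)) / dx) * ((n != 0%N)%:R * p n.-1 i).

Variables (I : nat) (B : R).
Context (p_ge0 : forall n i, 0 <= p n i).
Context (p_out : forall n i, (I <= absz i)%N -> p n i = 0).
Context (p_end : forall i, p NT.-1 i = 0).
Context (p_lip : forall n i, `|p n (i + 1) - p n i| <= B * dx).

Local Notation o i := (i%:Z - I%:Z).
Local Notation m := (2 * I).+1.

Let A n i := `|U n k i - alpha / s k i|.
Let G n i := entropy_flux P sch lambda kappa dx (U n) k i (U n k i) (U n k (i + 1)) alpha.
Let Gd n i := v n k i * (Num.sg (b n k i - alpha)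
                         * (flux P k (b n k i) - flux P k alpha)).
Let w n i := v n k i - v n k (i - 1).
Let sgn n i := Num.sg (U n k i - alpha / s k i).

Let sgnE n i : sgn n i = Num.sg (b n k i - alpha).
Proof.
have s0 : 0 < s k i by exact: (s_gt0 dx C).
have -> : b n k i - alpha = s k i * (U n k i - alpha / s k i).
  by rewrite /bar; field; rewrite gt_eqF.
by rewrite sgrM (gtr0_sg s0) mul1r.
Qed.

Let entropy_time i : \sum_(0 <= n < NT) p n i * (A n.+1 i - A n i) =
  - (\sum_(0 <= n < NT) (p n i - p n.-1 i) * A n i) - p 0%N i * A 0%N i.
Proof.
apply/eqP; rewrite -subr_eq0 opprD !opprK addrA -big_split/=.
rewrite (eq_bigr (fun n => p n.+1.-1 i * A n.+1 i - p n.-1 i * A n i)); last first.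
  by move=> n _ /=; ring.
by rewrite (telescope_sumr (fun n => p n.-1 i * A n i))//= p_end mul0r sub0r addNr.
Qed.

Let entropy_sign i :
  \sum_(0 <= n < NT) p n i * (sgn n.+1 i * w n i) =
  \sum_(0 <= n < NT) (n != 0%N)%:R * p n.-1 i * (sgn n i * w n.-1 i).
Proof.
pose h n := (n != 0%N)%:R * p n.-1 i * (sgn n i * w n.-1 i).
apply/eqP; rewrite -subr_eq0 -sumrB.
rewrite (eq_bigr (fun n => h n.+1 - h n)); last by move=> n _; rewrite /h /= mul1r.
by rewrite telescope_sumr// /h p_end eqxx !(mulr0, mul0r) subrr.
Qed.

Let entropy_space (q g : int -> R) : q (o 0%N) = 0 -> q (o m) = 0 ->
  \sum_(0 <= i < m) q (o i) * (g (o i) - g (o i - 1)) =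
  - \sum_(0 <= i < m) (q (o i + 1) - q (o i)) * g (o i).
Proof.
move=> q0 qm; apply/eqP; rewrite -subr_eq0 opprK -big_split/=.
rewrite (eq_bigr (fun i => q (o i.+1) * g (o i.+1 - 1) - q (o i) * g (o i - 1))).
  by rewrite (telescope_sumr (fun i => q (o i) * g (o i - 1)))// q0 qm !mul0r subrr.
move=> i _; have -> : o i.+1 = o i + 1 by lia.
by rewrite addrK; ring.
Qed.

Let flux_error n i : `|G n i - Gd n i| <= 2 * visc C k * `|b n k (i + 1) - b n k i|.
Proof.
have ss j : 0 < s k j by exact: (s_gt0 dx C).
have maxE j : s k j * Num.max (U n k j) (alpha / s k j) = Num.max (b n k j) alpha.
  by rewrite maxr_pMr ?(ltW (ss _))// mulrCA divff ?mulr1// gt_eqF.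
have minE j : s k j * Num.min (U n k j) (alpha / s k j) = Num.min (b n k j) alpha.
  by rewrite minr_pMr ?(ltW (ss _))// mulrCA divff ?mulr1// gt_eqF.
rewrite /G /entropy_flux !maxE !minE.
have -> : Gd n i = v n k i * flux P k (Num.max (b n k i) alpha)
    - v n k i * flux P k (Num.min (b n k i) alpha).
  rewrite /Gd; case: (ltrgtP (b n k i) alpha) => h.
  - by rewrite ltr0_sg ?subr_lt0//; ring.
  - by rewrite gtr0_sg ?subr_gt0//; ring.
  - by rewrite h subrr sgr0; ring.
rewrite (_ : forall x y z t : R, x - y - (z - t) = (x - z) - (y - t)); last by move=> *; ring.
apply: le_trans (ler_normB _ _) _.
rewrite -mulrA mulr2n mulrDl mul1r; apply: lerD.
  have [h _] := F_near kappa dx C (U n) k i (Num.max (b n k i) alpha) (Num.max (b n k (i + 1)) alpha).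
  apply: le_trans h _; rewrite ler_wpM2l ?visc_ge0//; exact: maxr_dist.
have [h _] := F_near kappa dx C (U n) k i (Num.min (b n k i) alpha) (Num.min (b n k (i + 1)) alpha).
apply: le_trans h _; rewrite ler_wpM2l ?visc_ge0//; exact: minr_dist.
Qed.

Let flux_error_sum n : (n < NT)%N ->
  \sum_(0 <= i < m) (p n (o i + 1) - p n (o i)) * G n (o i) <=
  \sum_(0 <= i < m) (p n (o i + 1) - p n (o i)) * Gd n (o i)
    + B * dx * (2 * visc C k * bar_TV T C D).
Proof.
move=> nN; rewrite -lerBlDl -sumrB.
have Bd0 : 0 <= B * dx by apply: le_trans (p_lip 0%N 0).
apply: le_trans (_ : \sum_(0 <= i < m) B * dx * (2 * visc C k *
    `|b n k (o i + 1) - b n k (o i)|) <= _).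
  apply: ler_sum => i _; rewrite -mulrBr.
  apply: le_trans (ler_norm _) _; rewrite normrM.
  by apply: ler_pM => //; exact: flux_error.
rewrite -!mulr_sumr ler_wpM2l// ler_wpM2l ?mulr_ge0 ?visc_ge0//.
have := Un_TV_le C D kappa01 Mh k (ltnW nN); rewrite /zTV => h.
rewrite -lee_fin; apply: le_trans h; rewrite big_mkord.
exact: (l1Z_window (fun i => b n k (i + 1) - b n k i) m (- I%:Z)).
Qed.

(** Summation by parts of the discrete entropy inequality against [p]. The
numerical entropy flux is replaced by its value on the diagonal, at a cost
controlled by the total variation; the time index of the velocity is shifted
so that the sign and the other factors are taken at the same time level. *)
Lemma discrete_entropy :
  0 <= dt lambda dx * dx * (\sum_(0 <= n < NT) \sum_(0 <= i < m) entropy_density n (o i))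
    + dx * (\sum_(0 <= i < m) `|U 0%N k (o i) - alpha / s k (o i)| * p 0%N (o i))
    + T * (B * (2 * visc C k * bar_TV T C D)) * dx.
Proof.
have pm n : p n (o m) = 0 by apply: p_out; lia.
have p0 n : p n (o 0%N) = 0 by apply: p_out; lia.
pose S := \sum_(0 <= n < NT) \sum_(0 <= i < m) p n (o i) * (A n.+1 (o i) - A n (o i)
   + lambda * (G n (o i) - G n (o i - 1)) + lambda * sgn n.+1 (o i) * flux P k alpha * w n (o i)).
have S0 : S <= 0.
  rewrite /S big_nat; apply: sumr_le0 => n /= nN; apply: sumr_le0 => i _.
  rewrite mulr_ge0_le0//.
  have := step_entropy C (fun k' i' bm b0 bp bm' b' bp' => Un_mono Mh k' i' nN) k (o i) alpha.
  by rewrite /G subrK.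
pose S1 := \sum_(0 <= n < NT) \sum_(0 <= i < m) (p n (o i) - p n.-1 (o i)) * A n (o i).
pose S2 := \sum_(0 <= n < NT) \sum_(0 <= i < m) (p n (o i + 1) - p n (o i)) * G n (o i).
pose S2' := \sum_(0 <= n < NT) \sum_(0 <= i < m) (p n (o i + 1) - p n (o i)) * Gd n (o i).
pose S3 := \sum_(0 <= n < NT) \sum_(0 <= i < m)
  (n != 0%N)%:R * p n.-1 (o i) * (sgn n (o i) * w n.-1 (o i)).
pose S4 := \sum_(0 <= i < m) p 0%N (o i) * A 0%N (o i).
have SE : S = - S1 - S4 - lambda * S2 + lambda * flux P k alpha * S3.
  have -> : S = \sum_(0 <= n < NT) \sum_(0 <= i < m) p n (o i) * (A n.+1 (o i) - A n (o i))
      + lambda * (\sum_(0 <= n < NT) \sum_(0 <= i < m) p n (o i) * (G n (o i) - G n (o i - 1)))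
      + lambda * flux P k alpha * (\sum_(0 <= n < NT) \sum_(0 <= i < m) p n (o i) * (sgn n.+1 (o i) * w n (o i))).
    rewrite !mulr_sumr -!big_split/=; apply: eq_bigr => n _.
    by rewrite !mulr_sumr -!big_split/=; apply: eq_bigr => i _; ring.
  congr (_ + _ + _).
  - rewrite [LHS]exchange_big/= /S1 [X in _ = - X - _]exchange_big/= /S4 -opprD -big_split/=.
    by rewrite -sumrN; apply: eq_bigr => i _; rewrite entropy_time opprD.
  - by rewrite -mulrN; congr (_ * _); rewrite /S2 -sumrN; apply: eq_bigr => n _; exact: entropy_space.
  - congr (_ * _); rewrite [LHS]exchange_big/= /S3 [RHS]exchange_big/=.
    by apply: eq_bigr => i _; exact: entropy_sign.
(* the numerical entropy flux is replaced by its diagonal value *)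
have S2le : S2 <= S2' + NT%:R * (B * dx * (2 * visc C k * bar_TV T C D)).
  rewrite /S2 /S2' mulr_natl -[X in _ *+ X]subn0 -sumr_const_nat -big_split/=.
  by rewrite big_nat [leRHS]big_nat; apply: ler_sum => n /= nN; exact: flux_error_sum.
have DE : dt lambda dx * dx * (\sum_(0 <= n < NT) \sum_(0 <= i < m) entropy_density n (o i)) =
    dx * (S1 + lambda * S2' - lambda * flux P k alpha * S3).
  rewrite /S1 /S2' /S3 -mulNr !mulr_sumr -!big_split/= !mulr_sumr; apply: eq_bigr => n _.
  rewrite !mulr_sumr -!big_split/= !mulr_sumr; apply: eq_bigr => i _.
  rewrite /entropy_density -sgnE /Gd -sgnE /A /w /dt; field.
  by rewrite !gt_eqF.
rewrite DE (_ : \sum_(0 <= i < m) _ = S4); last by apply: eq_bigr => i _; rewrite mulrC.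
set V := bar_TV T C D in S2le *.
have -> : T = NT%:R * (lambda * dx) by rewrite (NT_dt Mh).
have h : 0 <= S1 + S4 + lambda * S2 - lambda * flux P k alpha * S3 by move: S0; rewrite SE; lra.
have h2 := ler_wpM2l (ltW l0) S2le.
have h3 : 0 <= dx * (S1 + S4 + lambda * (S2' + NT%:R * (B * dx * (2 * visc C k * V)))
   - lambda * flux P k alpha * S3).
  by apply: mulr_ge0; [exact: ltW|lra].
apply: le_trans h3 _; rewrite le_eqVlt; apply/orP; left; apply/eqP; ring.
Qed.

End DiscreteEntropy.

(** * The entropy integrand *)

Section BoundedConvergence.
Context {d : measure_display} {T : measurableType d} {R : realType}.
Variables (mu : {measure set T -> \bar R}) (D : set T).
Context (mD : measurable D) (Dfin : (mu D < +oo)%E).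

Lemma bounded_integrable (f : T -> R) (c : R) : measurable_fun D f ->
  (forall x, D x -> `|f x| <= c) -> mu.-integrable D (EFin \o f).
Proof.
move=> mf fc; apply: measurable_bounded_integrable => //.
exists c; split; first exact: num_real.
by move=> M cM x Dx /=; apply: le_trans (fc x Dx) (ltW cM).
Qed.

Lemma bounded_cvg_Rintegral (f_ : nat -> T -> R) (f : T -> R) (c : R) :
  (forall n, measurable_fun D (f_ n)) -> measurable_fun D f ->
  (forall n x, D x -> `|f_ n x| <= c) ->
  {ae mu, forall x, D x -> f_ n x @[n --> \oo] --> f x} ->
  \int[mu]_(x in D) f_ n x @[n --> \oo] --> \int[mu]_(x in D) f x.
Proof.
move=> mf_ mf fc cv.
have ic : mu.-integrable D (EFin \o cst c).
  by apply: (@bounded_integrable _ `|c|) => //; exact: measurable_cst.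
have [] := @dominated_convergence _ _ _ mu D mD (fun n => EFin \o f_ n)
  (EFin \o f) (EFin \o cst c) _ _ _ ic _.
- by move=> n; apply/measurable_EFinP.
- exact/measurable_EFinP.
- apply: ae_imp cv _ => x h Dx; apply: cvg_EFin; first exact: nearW.
  exact: h.
- by apply/aeW => x n Dx /=; rewrite lee_fin fc.
move=> fi _ cvI; apply: fine_cvg; rewrite fineK//; exact: integrable_fin_num.
Qed.

End BoundedConvergence.

Section Integrand.
Context {R : realType}.

(** The integrand of the Kruzkov entropy inequality: [u], [s], [v], [vx] stand
for the solution, the coefficient, the nonlocal velocity and its space
derivative, [p], [pt], [px] for the test function and its derivatives. The same
expression, in difference quotients, occurs in the scheme. *)
Definition kruzkov (f : R -> R) (a u s pt v px vx p : R) : R :=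
  `|u - a / s| * pt + Num.sg (s * u - a) * v * (f (s * u) - f a) * px
  - f a * Num.sg (s * u - a) * vx * p.

Lemma measurable_sg : measurable_fun [set: R] (@Num.sg R).
Proof.
apply: nondecreasing_measurable => // x y xy.
have [x0|x0|x0] := ltgtP x 0; have [y0|y0|y0] := ltgtP y 0;
  rewrite ?(ltr0_sg x0) ?(gtr0_sg x0) ?(ltr0_sg y0) ?(gtr0_sg y0) ?x0 ?y0 ?sgr0; lra.
Qed.

Lemma cvg_sg (x : R) : x != 0 -> Num.sg y @[y --> x] --> Num.sg x.
Proof.
move=> x0; apply: (@cvg_near_cst _ _ (Num.sg x)).
have [xn|xp|xE] := ltgtP x 0; last by rewrite xE eqxx in x0.
- near=> y; rewrite !ltr0_sg//; near: y; exact: lt_nbhsl.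
- near=> y; rewrite !gtr0_sg//; near: y; exact: lt_nbhsr.
Unshelve. all: by end_near. Qed.

Variables (f : R -> R) (L : R).
Context (L0 : 0 <= L) (f_lip : forall x y, `|f y - f x| <= L * `|y - x|) (f0 : f 0 = 0).

Let fabs x : `|f x| <= L * `|x|.
Proof. by have := f_lip 0 x; rewrite f0 !subr0. Qed.

Definition kruzkov_bound (c sm sM um pm vm : R) : R :=
  (um + c / sm) * pm + vm * (L * (sM * um + c)) * pm + L * c * vm * pm.

Lemma kruzkov_le (c sm sM um pm vm : R) a u s pt v px vx p :
  `|a| <= c -> 0 < sm -> sm <= s <= sM -> `|u| <= um ->
  `|pt| <= pm -> `|px| <= pm -> `|p| <= pm -> `|v| <= vm -> `|vx| <= vm ->
  `|kruzkov f a u s pt v px vx p| <= kruzkov_bound c sm sM um pm vm.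
Proof.
move=> ac sm0 /andP[s1 s2] uu h1 h2 h3 h4 h5.
have s0 : 0 < s by exact: lt_le_trans s1.
have sg1 (x : R) : `|Num.sg x| <= 1 by rewrite normr_sg lern1 leq_b1.
have c0 : 0 <= c by apply: le_trans ac.
have um0 : 0 <= um by apply: le_trans uu.
have vm0 : 0 <= vm by apply: le_trans h4.
have pm0 : 0 <= pm by apply: le_trans h1.
have sM0 : 0 <= sM by apply: le_trans s2; exact: ltW.
rewrite /kruzkov /kruzkov_bound.
apply: le_trans (ler_normB _ _) _; apply: lerD.
  apply: le_trans (ler_normD _ _) _; apply: lerD; rewrite !normrM.
    rewrite normr_id; apply: ler_pM => //.
    apply: le_trans (ler_normB _ _) _; apply: lerD => //.
    rewrite normrM normfV (gtr0_norm s0).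
    by apply: ler_pM => //; rewrite ?invr_ge0 ?(ltW s0)// lef_pV2 ?posrE.
  apply: ler_pM => //; rewrite ?mulr_ge0//.
  apply: ler_pM; rewrite ?mulr_ge0//.
    by rewrite -[leRHS]mul1r; apply: ler_pM.
  apply: le_trans (f_lip _ _) _; rewrite ler_wpM2l//.
  apply: le_trans (ler_normB _ _) _; apply: lerD => //.
  by rewrite normrM (ger0_norm (ltW s0)); apply: ler_pM => //; exact: ltW.
rewrite !normrM; apply: ler_pM => //; rewrite ?mulr_ge0//.
apply: ler_pM => //; rewrite ?mulr_ge0//.
rewrite -[leRHS]mulr1; apply: ler_pM => //.
by apply: le_trans (fabs a) _; rewrite ler_wpM2l.
Qed.

Lemma kruzkov_meas d (T : measurableType d) (D : set T) a
    (u s pt v px vx p : T -> R) :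
  measurable_fun D u -> measurable_fun D s -> (forall x, 0 < s x) ->
  measurable_fun D pt -> measurable_fun D v -> measurable_fun D px ->
  measurable_fun D vx -> measurable_fun D p ->
  measurable_fun D (fun x => kruzkov f a (u x) (s x) (pt x) (v x) (px x) (vx x) (p x)).
Proof.
move=> mu ms s0 m1 m2 m3 m4 m5.
have mf : measurable_fun [set: R] f.
  by apply: continuous_measurable_fun; exact: lipschitz_continuous f_lip.
have mb : measurable_fun D (fun x => s x * u x) by exact: measurable_funM.
have msg : measurable_fun D (fun x => Num.sg (s x * u x - a)).
  by apply: (measurableT_comp measurable_sg); apply: measurable_funB => //; exact: measurable_cst.
rewrite /kruzkov; apply: measurable_funB; first apply: measurable_funD.
- apply: measurable_funM => //; apply: measurableT_comp => //.
  apply: measurable_funB => //.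
  apply: measurable_funM; first exact: measurable_cst.
  have -> : (fun x => (s x)^-1) = (fun x => expR (- ln (s x))).
    by apply/funext => x; rewrite expRN lnK ?posrE.
  apply: (measurableT_comp (@measurable_expR R)); apply: measurableT_comp => //.
  exact: (measurableT_comp (@measurable_ln R)).
- apply: measurable_funM => //; apply: measurable_funM; first exact: measurable_funM.
  by apply: measurable_funB; [exact: (measurableT_comp mf)|exact: measurable_cst].
- apply: measurable_funM => //; apply: measurable_funM => //.
  by apply: measurable_funM => //; exact: measurable_cst.
Qed.

(** The sign is the only discontinuous factor, and it is continuous away from the
level [a]. *)
Lemma kruzkov_cvg (F : set_system nat) (FF : ProperFilter F)
    (a_ u_ s_ pt_ v_ px_ vx_ p_ : nat -> R) a u s pt v px vx p :
  a_ @ F --> a -> u_ @ F --> u -> s_ @ F --> s -> s != 0 -> s * u - a != 0 ->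
  pt_ @ F --> pt -> v_ @ F --> v -> px_ @ F --> px -> vx_ @ F --> vx -> p_ @ F --> p ->
  kruzkov f (a_ j) (u_ j) (s_ j) (pt_ j) (v_ j) (px_ j) (vx_ j) (p_ j) @[j --> F] -->
  kruzkov f a u s pt v px vx p.
Proof.
move=> ca cu cs s0 b0 c1 c2 c3 c4 c5.
have cb : s_ j * u_ j @[j --> F] --> s * u by exact: cvgM.
have csg : Num.sg (s_ j * u_ j - a_ j) @[j --> F] --> Num.sg (s * u - a).
  by apply: (cvg_comp _ _ _ (cvg_sg b0)); exact: cvgB.
have cfa : f (a_ j) @[j --> F] --> f a.
  exact: (cvg_comp _ _ ca (lipschitz_continuous f_lip (x := a))).
rewrite /kruzkov; apply: cvgB; first apply: cvgD.
- by apply: cvgM => //; apply: cvg_norm; apply: cvgB => //; apply: cvgM => //; exact: cvgV.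
- apply: cvgM => //; apply: cvgM; first exact: cvgM.
  by apply: cvgB => //; exact: (cvg_comp _ _ cb (lipschitz_continuous f_lip (x := s * u))).
- by apply: cvgM => //; apply: cvgM => //; exact: cvgM.
Qed.

(** On the level set of [a] the sign is not continuous in [a], but its values
at levels above and below [a] cancel. *)
Lemma kruzkov_average_cvg (F : set_system nat) (FF : ProperFilter F)
    (a_ b_ : nat -> R) a u s pt v px vx p :
  a_ @ F --> a -> b_ @ F --> a -> (forall j, b_ j < a < a_ j) -> 0 < s ->
  kruzkov f (a_ j) u s pt v px vx p + kruzkov f (b_ j) u s pt v px vx p @[j --> F] -->
  kruzkov f a u s pt v px vx p + kruzkov f a u s pt v px vx p.
Proof.
move=> ca cb ab s0; have s1 := lt0r_neq0 s0.
have [E|b0] := eqVneq (s * u - a) 0; last first.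
  by apply: cvgD; apply: kruzkov_cvg => //; exact: cvg_cst.
have cf (c_ : nat -> R) : c_ @ F --> a -> f (c_ j) @[j --> F] --> f a.
  by move=> cc; exact: (cvg_comp _ _ cc (lipschitz_continuous f_lip (x := a))).
have cn (c_ : nat -> R) : c_ @ F --> a -> `|u - c_ j / s| * pt @[j --> F] --> `|u - a / s| * pt.
  move=> cc; apply: cvgM; last exact: cvg_cst.
  apply: cvg_norm; apply: cvgB; first exact: cvg_cst.
  by apply: cvgM => //; exact: cvg_cst.
have su : s * u = a by move/eqP: E; rewrite subr_eq0 => /eqP.
have -> : (fun j => kruzkov f (a_ j) u s pt v px vx p + kruzkov f (b_ j) u s pt v px vx p) =
    (fun j => `|u - a_ j / s| * pt + `|u - b_ j / s| * pt
       + (f (a_ j) - f (b_ j)) * (v * px + vx * p)).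
  apply/funext => j; have /andP[ba aa] := ab j.
  rewrite /kruzkov su (ltr0_sg (_ : a - a_ j < 0)) ?subr_lt0//.
  by rewrite (gtr0_sg (_ : 0 < a - b_ j)) ?subr_gt0//; ring.
have -> : kruzkov f a u s pt v px vx p + kruzkov f a u s pt v px vx p =
    `|u - a / s| * pt + `|u - a / s| * pt + (f a - f a) * (v * px + vx * p).
  by rewrite /kruzkov su subrr sgr0; ring.
apply: cvgD; first by apply: cvgD; exact: cn.
by apply: cvgM; [apply: cvgB; exact: cf|exact: cvg_cst].
Qed.

End Integrand.

(** * Null levels, and integrals of mesh functions *)

(** By Fubini, only a null set of levels is taken on a set of positive
measure. *)
Lemma ae_null_level d (T : measurableType d) (R : realType)
    (m : {measure set T -> \bar R}) (D : set T) (g : T -> R) :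
  measurable D -> (m D < +oo)%E -> measurable_fun [set: T] g ->
  {ae (@lebesgue_measure R), forall a, m (D `&` [set z | g z = a]) = 0}.
Proof.
move=> mD Dfin mg; pose mr : {sigma_finite_measure set T -> \bar R} := mfrestr mD Dfin.
pose S : set (R * T) := [set p | g p.2 = p.1].
have mS : measurable S.
  rewrite (_ : S = (fun p : R * T => g p.2 - p.1) @^-1` [set 0]).
    rewrite -[X in measurable X]setTI; apply: measurable_funB => //.
    exact: (measurableT_comp mg).
  apply/seteqP; split => [[a z] /= ->|[a z] /= /eqP]; first by rewrite subrr.
  by rewrite subr_eq0 => /eqP.
pose h (p : R * T) : \bar R := (\1_S p)%:E.
have mh : measurable_fun [set: R * T] h.
  by apply/measurable_EFinP; exact: measurable_indic.
have h0 p : (0 <= h p)%E by rewrite lee_fin.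
have F0 : (\int[@lebesgue_measure R]_a fubini_F mr h a = 0)%E.
  rewrite /fubini_F fubini_tonelli//; apply: integral0_eq => z _.
  rewrite (_ : (fun a => h (a, z)) = (fun a => (\1_[set g z] a)%:E)).
    by rewrite integral_indic// setIT; exact: lebesgue_measure_set1.
  apply/funext => a; rewrite /h !indicE; congr (nat_of_bool _)%:R%:E.
  by apply/idP/idP => /set_mem ?; exact/mem_set.
have mF : measurable_fun [set: R] (fubini_F mr h).
  exact: measurable_fun_fubini_tonelli_F.
have F_ge0 a : (0 <= fubini_F mr h a)%E by apply: integral_ge0.
have : ae_eq (@lebesgue_measure R) [set: R] (fubini_F mr h) (cst 0%E).
  apply/ae_eq_integral_abs => //.
  by rewrite -[RHS]F0; apply: eq_integral => a _; rewrite gee0_abs.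
move=> F_ae; apply: (ae_imp F_ae) => a /(_ I) /= <-; rewrite /fubini_F.
rewrite (_ : (fun z => h (a, z)) = (fun z => (\1_[set z | g z = a] z)%:E)).
  rewrite integral_indic//; first by rewrite setIT setIC.
  by rewrite -[X in measurable X]setTI; exact: (mg measurableT _ (measurable_set1 a)).
by apply/funext => z; rewrite /h !indicE.
Qed.

Section GridIntegral.
Context {R : realType}.
Local Notation leb := (@lebesgue_measure R).

(** A property of the space variable alone fails on the product of the time axis with
a null set. *)
Lemma ae_snd (Q : R -> Prop) : {ae leb, forall x, Q x} ->
  {ae (@leb2 R), forall z, Q z.2}.
Proof.
move=> [A [mA A0 QA]]; exists ([set: R] `*` A); split.
- exact: measurableX.
- rewrite /leb2 product_measure1E//; apply: etrans (mule0 (leb setT)).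
  by congr (_ * _)%E.
- by move=> [t x] /= nQ; split => //=; exact: QA.
Qed.

Variables (lambda dx T : R) (NT I : nat).
Context (dx0 : 0 < dx) (dt0 : 0 < dt lambda dx) (TE : T = NT%:R * dt lambda dx).
Local Notation dt := (dt lambda dx).
Local Notation o i := (i%:Z - I%:Z).
Local Notation m := (2 * I).+1.

(* the first time slab is taken open, since the integrals are over ]0, T[ *)
Let slab (n : nat) : set R :=
  [set` Interval (BSide (n != 0%N) (n%:R * dt)) (BLeft (n.+1%:R * dt))].
Let box n i : set (R * R) := slab n `*` cell dx i.

(** On the strip the integrand is a finite combination of indicators of boxes of
area [dt * dx]; only [2 * I + 1] columns carry a nonzero value. *)
Lemma grid_integral (E : nat -> int -> R) :
  (forall n i, (I < absz i)%N -> E n i = 0) ->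
  \int[leb2]_(z in QT T) E (tindex lambda dx z.1) (xindex dx z.2) =
  dt * dx * \sum_(0 <= n < NT) \sum_(0 <= i < m) E n (o i).
Proof.
move=> Eout.
have slabP n t : 0 < t -> slab n t = (tindex lambda dx t = n) :> Prop.
  move=> t0; have t1 : 0 <= t / dt by rewrite divr_ge0 ?ltW.
  have /andP[h1 h2] := truncn_itv t1; rewrite -/(tindex lambda dx t) in h1 h2.
  rewrite ler_pdivlMr// in h1; rewrite ltr_pdivrMr// in h2.
  apply/propext; split => [|<-].
    rewrite /slab /= in_itv/= => /andP[s1 s2]; apply: truncn_def.
    rewrite ler_pdivlMr// ltr_pdivrMr// s2 andbT.
    by move: s1; case: (n =P 0%N) => [->|_] //=; rewrite mul0r => /ltW.
  rewrite /slab /= in_itv/= h2 andbT.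
  by case: eqP => //= ->; rewrite mul0r.
have mbox n i : measurable (box n i).
  by apply: measurableX; [exact: measurable_itv|exact: measurable_cell].
have slabQ n : (n < NT)%N -> slab n `<=` `]0, T[.
  move=> nN t; rewrite /slab /= !in_itv/= => /andP[s1 s2]; apply/andP; split.
    have n0 : 0 <= n%:R * dt by apply: mulr_ge0 => //; exact: ltW.
    move: s1; case: (n =P 0%N) => [->|/eqP nn] /=; first by rewrite mul0r.
    by apply: lt_le_trans; rewrite mulr_gt0// ltr0n lt0n.
  by apply: lt_le_trans s2 _; rewrite TE ler_pM2r// ler_nat.
have boxE n i : (n < NT)%N -> leb2 (box n i `&` QT T) = (dt * dx)%:E.
  move=> nN; rewrite setIidl; last by move=> z [z1 _]; split => //; exact: slabQ nN _ z1.
  rewrite /leb2 product_measure1E//; first last.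
  - exact: measurable_cell.
  - exact: measurable_itv.
  rewrite EFinM; congr (_ * _)%E; last exact: lebesgue_cell.
  apply: etrans (lebesgue_measure_itv _) _; rewrite /= lte_fin ltr_pM2r// ltr_nat ltnSn.
  by rewrite -EFinB -mulrBl -natrB// subSnn mul1r.
have mQ : measurable (QT T : set (R * R)).
  by apply: measurableX => //; exact: measurable_itv.
have li n i : (n < NT)%N ->
    (\int[leb2]_(z in QT T) (\1_(box n i) z)%:E = (dt * dx)%:E :> \bar R)%E.
  move=> nN; rewrite integral_indic; [exact: boxE|exact: mQ|exact: mbox].
have ibox n i : (n < NT)%N ->
    (@leb2 R).-integrable (QT T) (fun z => ((\1_(box n i) z)%:E)).
  move=> nN; apply/integrableP; split.
    by apply/measurable_EFinP; apply: measurable_indic; exact: mbox.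
  under eq_integral do rewrite gee0_abs ?lee_fin//.
  by rewrite li// ltry.
rewrite /Rintegral; transitivity (fine (\int[leb2]_(z in QT T)
    (\sum_(n <- index_iota 0 NT | (n < NT)%N) \sum_(0 <= i < m)
       (E n (o i))%:E * (\1_(box n (o i)) z)%:E))%E).
  congr fine; apply: eq_integral => -[t x] /set_mem[/= tT _].
  have /andP[t0 tT'] : 0 < t < T by move: tT; rewrite in_itv.
  set n0 := tindex _ _ _; set i0 := xindex _ _.
  have ind n i : \1_(box n i) (t, x) = ((n == n0) && (i == i0))%:R :> R.
    rewrite indicE; congr (nat_of_bool _)%:R; apply/idP/idP.
      by move=> /set_mem[/=]; rewrite slabP// -/n0 => -> /(@cellP R dx i x dx0) <-; rewrite !eqxx.
    move=> /andP[/eqP -> /eqP ->]; apply/mem_set; split => /=; first by rewrite slabP.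
    exact: cell_xindex.
  have n0N : (n0 < NT)%N.
    rewrite -(ltr_nat R) -(ltr_pM2r dt0) -TE; apply: le_lt_trans tT'.
    have t1 : 0 <= t / dt by rewrite divr_ge0 ?ltW.
    by have /andP[+ _] := truncn_itv t1; rewrite ler_pdivlMr.
  have -> : E n0 i0 = \sum_(0 <= n < NT | n == n0) \sum_(0 <= i < m | o i == i0) E n (o i).
    rewrite big_nat1_eq /= n0N.
    have [Ii|iI] := ltnP I (absz i0).
      by rewrite Eout// big1// => i /eqP ->; rewrite Eout.
    pose j0 := absz (i0 + I%:Z).
    have oE i : (o i == i0) = (i == j0) by rewrite /j0; apply/eqP/eqP; lia.
    rewrite (eq_bigl _ _ oE) big_nat1_eq/= ifT; last by rewrite /j0; lia.
    by congr (E n0 _); apply/esym/eqP; rewrite oE.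
  rewrite -sumEFin big_mkcond/= big_nat [RHS]big_nat_cond.
  apply: eq_big => [n|n /andP[_ nN]]; first by case: (n < NT)%N; rewrite ?andbF ?andbT.
  case: eqP => [nn|nn].
    rewrite -sumEFin big_mkcond/=; apply: eq_bigr => i _.
    rewrite ind nn eqxx/= -EFinM; case: ifP => h; by rewrite ?mulr1 ?mulr0.
  rewrite big1// => i _; rewrite ind -EFinM (_ : (n == n0) = false) ?mulr0//.
  exact/eqP.
under eq_integral do rewrite big_mkcond/=.
rewrite (@integral_sum _ _ _ (@leb2 R) (QT T) mQ); last first.
  move=> n; case: (boolP (n < NT)%N) => nN; last exact: integrable0.
  apply: (@integrable_sum _ _ _ (@leb2 R) (QT T) mQ) => i _; apply: integrableZl => //; exact: ibox.
rewrite -[RHS]/(fine (_)%:E); congr fine.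
rewrite mulr_sumr -sumEFin big_nat [RHS]big_nat.
apply: eq_bigr => n /andP[_ nN]; rewrite nN.
rewrite (@integral_sum _ _ _ (@leb2 R) (QT T) mQ); last by move=> i; apply: integrableZl => //; exact: ibox.
rewrite mulr_sumr -sumEFin; apply: eq_bigr => i _.
by rewrite integralZl//; [rewrite li// -EFinM mulrC|exact: ibox].
Qed.

End GridIntegral.

(** * Test functions *)

Section TestFunctions.
Context {R : realType}.

(** By the mean value theorem the difference quotient is a value of the derivative
at a point that tends to [x] with the increment. *)
Lemma difference_quotient_cvg (V : normedModType R) (g : V -> R) (v x : V)
    (y : nat -> V) (h : nat -> R) :
  (forall z, derivable g z v) -> continuous ('D_v g) ->
  y @ \oo --> x -> h @ \oo --> (0 : R) -> (forall j, h j != 0) ->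
  (g (y j + h j *: v) - g (y j)) / h j @[j --> \oo] --> 'D_v g x.
Proof.
move=> dg cD yx h0 hn.
have /choice[r rP] : forall j, exists r : R, `|r| <= `|h j| /\
    (g (y j + h j *: v) - g (y j)) / h j = 'D_v g (y j + r *: v).
  move=> j; have [r rh E] := directional_MVT dg (y j) (h j).
  by exists r; rewrite E mulfK.
rewrite (_ : (fun j => _) = (fun j => 'D_v g (y j + r j *: v))); last first.
  by apply/funext => j; have [_] := rP j.
have r0 : r @ \oo --> (0 : R).
  apply/cvgr0Pnorm_le => e e0; near=> j.
  have [rh _] := rP j; apply: le_trans rh _; near: j.
  by have /cvgr0Pnorm_le := h0; apply.
have c : y j + r j *: v @[j --> \oo] --> x.
  rewrite -[X in _ --> X]addr0 -[X in _ --> _ + X](scale0r v).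
  by apply: cvgD => //; apply: cvgZ => //; exact: cvg_cst.
exact: (cvg_comp _ _ c (cD x)).
Unshelve. all: by end_near. Qed.

Lemma compact_support_bounded (V : normedModType R) (g : V -> R) (K : set V) :
  compact K -> continuous g -> (forall x, ~ K x -> g x = 0) ->
  exists2 B : R, 0 <= B & forall x, `|g x| <= B.
Proof.
move=> cK cg g0.
have [[x0 Kx0]|K0] := pselect (K !=set0); last first.
  by exists 0 => // x; rewrite g0 ?normr0// => Kx; apply: K0; exists x.
have cn : {within K, continuous (fun x => `|g x|)}.
  by apply: continuous_subspaceT => x; apply: cvg_norm; exact: cg.
have [c _ cP] := compact_EVT_max (ex_intro _ x0 Kx0) cK cn.
exists `|g c| => // x; have [Kx|nKx] := pselect (K x).
  by apply: cP; exact/mem_set.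
by rewrite g0 ?normr0.
Qed.

Local Notation et := ((1, 0) : R * R).
Local Notation ex := ((0, 1) : R * R).

(** What the convergence proof uses of a test function: bounds, supports, and
convergence of difference quotients along arbitrary sequences of points. *)
Record test_function (T : R) (phi : R * R -> R) (B X tau : R) : Prop := TestFunction {
  tf_tau : 0 < tau;
  tf_le : forall z, `|phi z| <= B;
  tf_lipt : forall t t' x, `|phi (t', x) - phi (t, x)| <= B * `|t' - t|;
  tf_lipx : forall t x x', `|phi (t, x') - phi (t, x)| <= B * `|x' - x|;
  tf_out : forall t x, X <= `|x| -> phi (t, x) = 0;
  tf_end : forall t x, T - tau <= t -> phi (t, x) = 0;
  tf_cvg : forall (t x : R) (t_ x_ : nat -> R), t_ @ \oo --> t -> x_ @ \oo --> x ->
    phi (t_ j, x_ j) @[j --> \oo] --> phi (t, x);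
  tf_cvgt : forall (t x : R) (t_ x_ h : nat -> R), t_ @ \oo --> t -> x_ @ \oo --> x ->
    h @ \oo --> (0 : R) -> (forall j, h j != 0) ->
    (phi (t_ j + h j, x_ j) - phi (t_ j, x_ j)) / h j @[j --> \oo] --> 'D_et phi (t, x);
  tf_cvgx : forall (t x : R) (t_ x_ h : nat -> R), t_ @ \oo --> t -> x_ @ \oo --> x ->
    h @ \oo --> (0 : R) -> (forall j, h j != 0) ->
    (phi (t_ j, x_ j + h j) - phi (t_ j, x_ j)) / h j @[j --> \oo] --> 'D_ex phi (t, x);
  tf_Dt0 : forall t x, X <= `|x| -> 'D_et phi (t, x) = 0;
  tf_Dx0 : forall t x, X <= `|x| -> 'D_ex phi (t, x) = 0;
  tf_Dt_le : forall z, `|'D_et phi z| <= B;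
  tf_Dx_le : forall z, `|'D_ex phi z| <= B }.

Lemma exists_test_function (T : R) (phi : R * R -> R) :
  smooth phi -> compactly_supported_in (`]-oo, T[ `*` setT) phi ->
  exists B X tau, test_function T phi B X tau.
Proof.
move=> sp [K [cK KD K0]].
have [cp dp] := sp 1%N.
have Kcl : closed K by apply: compact_closed cK; exact: norm_hausdorff.
have D0 (v z : R * R) : ~ K z -> 'D_v phi z = 0.
  move=> nKz; rewrite -(derive_cst (0 : R) z v); apply: near_eq_derive.
  have : open_nbhs z (~` K) by split => //; exact: closed_openC.
  by move=> /open_nbhs_nbhs; apply: filterS => y /= /K0.
have cD v : continuous ('D_v phi) by have [_ []] := dp v.
have dD v z : derivable phi z v by have [+ _] := dp v; apply.
have [B0 B00 B0P] := compact_support_bounded cK cp K0.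
have [B1 B10 B1P] := compact_support_bounded cK (cD et) (D0 et).
have [B2 B20 B2P] := compact_support_bounded cK (cD ex) (D0 ex).
pose B := B0 + B1 + B2.
have [M MP] : exists M, forall z, K z -> `|z| <= M.
  have [M [_ MP]] := compact_bounded cK; exists (M + 1) => z Kz.
  by apply: MP => //; rewrite ltrDl.
have [tau tau0 tauP] : exists2 tau, 0 < tau & forall t x, K (t, x) -> t < T - tau.
  have [[z0 Kz0]|Ke] := pselect (K !=set0); last first.
    by exists 1 => // t x Kz; case: Ke; exists (t, x).
  have cf : {within K, continuous (fun z : R * R => z.1)}.
    by apply: continuous_subspaceT => z; exact: cvg_fst.
  have [c /set_mem Kc cP] := compact_EVT_max (ex_intro _ z0 Kz0) cK cf.
  have [cT _] := KD c Kc; rewrite /= in_itv/= in cT.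
  exists ((T - c.1) / 2); first by rewrite divr_gt0// subr_gt0.
  by move=> t x Kz; have := cP (t, x) (mem_set Kz) => /=; lra.
exists B, (M + 1), tau.
have nK t x : M + 1 <= `|x| -> ~ K (t, x).
  move=> xM Kz; have := MP _ Kz; rewrite prod_normE ge_max/= => /andP[_].
  lra.
have st (t x h : R) : (t, x) + h *: et = (t + h, x).
  by congr pair; rewrite /= /GRing.scale /= ?mulr1// mulr0 addr0.
have sx (t x h : R) : (t, x) + h *: ex = (t, x + h).
  by congr pair; rewrite /= /GRing.scale /= ?mulr1// mulr0 addr0.
have cz (t x : R) (t_ x_ : nat -> R) : t_ @ \oo --> t -> x_ @ \oo --> x ->
    (t_ j, x_ j) @[j --> \oo] --> (t, x).
  by move=> c1 c2; exact: (cvg_pair c1 c2).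
split => //.
- by move=> z; apply: le_trans (B0P z) _; rewrite /B; lra.
- move=> t t' x; have [r _ E] := directional_MVT (dD et) (t, x) (t' - t).
  rewrite st subrKC in E; rewrite E normrM ler_wpM2r//.
  by apply: le_trans (B1P _) _; rewrite /B; lra.
- move=> t x x'; have [r _ E] := directional_MVT (dD ex) (t, x) (x' - x).
  rewrite sx subrKC in E; rewrite E normrM ler_wpM2r//.
  by apply: le_trans (B2P _) _; rewrite /B; lra.
- by move=> t x xM; apply: K0; exact: nK.
- by move=> t x tT; apply: K0 => /tauP; rewrite ltNge tT.
- by move=> t x t_ x_ c1 c2; exact: (cvg_comp _ _ (cz _ _ _ _ c1 c2) (cp (t, x))).
- move=> t x t_ x_ h c1 c2 h0 hn.
  have := difference_quotient_cvg (dD et) (cD et) (cz _ _ _ _ c1 c2) h0 hn.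
  by under eq_fun do rewrite st.
- move=> t x t_ x_ h c1 c2 h0 hn.
  have := difference_quotient_cvg (dD ex) (cD ex) (cz _ _ _ _ c1 c2) h0 hn.
  by under eq_fun do rewrite sx.
- by move=> t x xM; apply: D0; exact: nK.
- by move=> t x xM; apply: D0; exact: nK.
- by move=> z; apply: le_trans (B1P z) _; rewrite /B; lra.
- by move=> z; apply: le_trans (B2P z) _; rewrite /B; lra.
Qed.

End TestFunctions.

(** * Pointwise limits of the discrete quantities *)

Section PointwiseLimits.
Context {R : realType} {N : nat}.
Local Notation leb := (@lebesgue_measure R).
Variables (P : ivp R N) (sch : flux_type R) (lambda kappa T : R).
Variables (C : constants P sch lambda) (D : data P).
Context (kappa01 : 0 <= kappa <= 1) (T0 : 0 < T).
Variables (dx : nat -> R) (NT : nat -> nat) (U : 'I_N -> R -> R -> R).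
Context (Mh : forall m, mesh P sch lambda kappa (dx m) T (NT m)).
Context (dx_cvg0 : dx @ \oo --> (0 : R)) (UP : limit_of kappa T C D dx U).

Local Notation V j := (Un P sch lambda kappa (dx j)).
Local Notation dt_ j := (dt lambda (dx j)).
Local Notation n_ j t := (tindex lambda (dx j) t).
Local Notation i_ j x := (xindex (dx j) x).

Let dx0 j : 0 < dx j := dx_gt0 (Mh j).
Let dt0 j : 0 < dt_ j := dt_gt0 C (Mh j).
Let dt_cvg : dt_ j @[j --> \oo] --> (0 : R) := dt_cvg0 lambda dx_cvg0.

Lemma squeeze_to (u : nat -> R) (l K : R) (e : nat -> R) :
  e @ \oo --> (0 : R) -> (forall j, `|u j - l| <= K * e j) -> u @ \oo --> l.
Proof.
move=> e0 uK; apply/cvgrPdistC_le => eps eps0.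
have c : K * e j @[j --> \oo] --> (0 : R).
  by rewrite -[X in _ --> X](mulr0 K); apply: cvgM => //; exact: cvg_cst.
near=> j; apply: le_trans (uK j) _; near: j.
by apply: (cvgr_le _ c).
Unshelve. all: by end_near. Qed.

Lemma xgrid_cvg x : xgrid (dx j) (i_ j x) @[j --> \oo] --> x.
Proof.
apply: (squeeze_to (K := 1) dx_cvg0) => j; rewrite distrC mul1r.
by apply: le_trans (xindex_near x (dx0 j)) _; have := dx0 j; lra.
Qed.

Lemma tgrid_cvg t : 0 <= t -> (n_ j t)%:R * dt_ j @[j --> \oo] --> t.
Proof.
move=> t0; apply: (squeeze_to (K := 1) dt_cvg) => j.
have /andP[h1 h2] := tindex_itv C (Mh j) t0.
by rewrite ler0_norm ?subr_le0//; move: h2; rewrite -natr1 mulrDl !mul1r; lra.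
Qed.

Lemma tgrid_pred_cvg t : 0 <= t -> (n_ j t).-1%:R * dt_ j @[j --> \oo] --> t.
Proof.
move=> t0; apply: (squeeze_to (K := 2) dt_cvg) => j.
have /andP[h1 h2] := tindex_itv C (Mh j) t0; have d0 := dt0 j.
case: (n_ j t) h1 h2 => [|n] /=; rewrite -?natr1 ?mulrDl !mul1r => h1 h2.
  by rewrite ler0_norm; lra.
by rewrite ler0_norm; lra.
Qed.

Lemma tindex_gt0_near t : 0 < t -> \forall j \near \oo, (0 < n_ j t)%N.
Proof.
move=> t0; near=> j.
have jt : dt_ j <= t by near: j; exact: (cvgr_le _ dt_cvg).
have /andP[_ h2] := tindex_itv C (Mh j) (ltW t0).
by rewrite -ltnS -(ltr_nat R) -(ltr_pM2r (dt0 j)) mul1r; exact: le_lt_trans h2.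
Unshelve. all: by end_near. Qed.

Lemma sigma_cvg k x : {for x, continuous (sigma P k)} ->
  sigma_ P (dx j) k (i_ j x) @[j --> \oo] --> sigma P k x.
Proof. by move=> c; rewrite /sigma_; apply: continuous_cvg => //; exact: xgrid_cvg. Qed.

(** Averages over shrinking cells converge at the points of continuity of the
representative of bounded variation. *)
Lemma initial_cvg k : {ae leb, forall x,
  initial P (dx j) k (i_ j x) @[j --> \oo] --> U0 P k x}.
Proof.
have h := ae_and (rep_ae D k) (bv_le_ae_continuous (rep_bv D k)).
apply: (ae_imp h) => x [<- /cvgrPdistC_le c]; apply/cvgrPdistC_le => e e0.
have [d /= d0 dP] := c e e0.
near=> j; have jd : dx j < d by near: j; exact: (cvgr_lt _ dx_cvg0).
apply: (initial_near_rep (D := D) (dx0 j)) => y cy.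
apply: dP; apply: le_lt_trans jd => /=.
have cx := cell_xindex x (dx0 j).
move: cx cy; rewrite /cell /= !in_itv/= xhalfB1 xhalfE => /andP[x1 x2] /andP[y1 y2].
by rewrite ler_norml; apply/andP; split; lra.
Unshelve. all: by end_near. Qed.

Let half_cvg : (1 / 2 : R) ^+ j @[j --> \oo] --> (0 : R).
Proof. by apply: cvg_expr; rewrite ger0_norm ?divr_ge0// ltr_pdivrMr// mul1r ltr1n. Qed.

Let Umeas t k : measurable_fun [set: R] (U k t) := limit_measx UP k t.

(* one step changes the state by at most [time_rate * dt] in mean *)
Let slice_pred j k t : 0 <= t <= T ->
  (L1on [set: R] (fun y => V j (n_ j t).-1 k (i_ j y) - U k t y)%R
    <= (time_rate T C D * dt_ j + (1 / 2) ^+ j)%:E)%E.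
Proof.
move=> tT; have nN := tindex_le C (Mh j) tT.
have m1 := measurable_step (V j (n_ j t).-1 k) (dx0 j).
have m2 := measurable_step (V j (n_ j t) k) (dx0 j).
apply: (@L1on_leD _ _ (fun y => V j (n_ j t) k (i_ j y) - V j (n_ j t).-1 k (i_ j y))
  (fun y => V j (n_ j t) k (i_ j y) - U k t y)) => //.
- exact: measurable_funB.
- exact: measurable_funB.
- exact: measurable_funB.
- move=> y _; rewrite [in leRHS]distrC; apply: le_trans (ler_normD _ _).
  by rewrite subrKA.
- rewrite /L1on (integral_step_l1Z (fun i => V j (n_ j t) k i - V j (n_ j t).-1 k i))//.
  have r0 := time_rate_ge0 C D T0 k; have d0 := dt0 j.
  move: nN; case: (n_ j t) => [|n] nN /=.
    rewrite (_ : l1Z _ = 0%E); first by rewrite mule0 lee_fin mulr_ge0// ltW.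
    by rewrite /l1Z esum1// => i _; rewrite subrr normr0.
  have := Un_time C D kappa01 T0 (Mh j) k nN => h.
  apply: (@le_trans _ _ ((dx j)%:E * (lambda * time_rate T C D)%:E)%E).
    by apply: lee_wpmul2l; [rewrite lee_fin ltW|exact: h].
  rewrite -EFinM lee_fin /dt (_ : dx j * _ = time_rate T C D * (lambda * dx j))//.
  by ring.
- exact: (lim_L1 UP j k tT).
Qed.

Lemma nonlocal_cvg k t x : 0 <= t <= T ->
  vel P kappa (dx j) (V j (n_ j t)) k (i_ j x) @[j --> \oo] --> nonlocal P U k t x.
Proof.
move=> tT; have [K K0 KP] := vel_near C kappa01 (mass_ge0 D) (U_TV_ge0 C D T0 k)
  (Umeas t) (fun j => limit_integrable Mh UP j tT) k x.
apply: (squeeze_to (K := K) (e := fun j => dx j + (1 / 2) ^+ j)).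
  by rewrite -[X in _ --> X](addr0 0); exact: cvgD.
move=> j; have nN := tindex_le C (Mh j) tT.
have [] // := KP (dx j) ((1 / 2) ^+ j) (V j (n_ j t)) (dx0 j).
- exact: (Un_mass C D (Mh j) nN).
- by move=> k'; exact: (Un_zTV C D kappa01 (Mh j) k' nN).
- by move=> k'; exact: (lim_L1 UP j k' tT).
Qed.

(** The difference quotient is taken one time level below, as summation by parts in
time requires; the time estimate makes the shift harmless. *)
Lemma dnonlocal_cvg k t x : 0 <= t <= T ->
  (vel P kappa (dx j) (V j (n_ j t).-1) k (i_ j x)
   - vel P kappa (dx j) (V j (n_ j t).-1) k (i_ j x - 1)) / dx j @[j --> \oo]
    --> derive1 (nonlocal P U k t) x.
Proof.
move=> tT; have iU := fun j => limit_integrable Mh UP j tT.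
rewrite (derive1_nonlocal C (Umeas t) iU).
have [K K0 KP] := vel_near C kappa01 (mass_ge0 D) (U_TV_ge0 C D T0 k)
  (Umeas t) iU k x.
apply: (squeeze_to (K := K)
  (e := fun j => dx j + (time_rate T C D * dt_ j + (1 / 2) ^+ j))).
  rewrite -[X in _ --> X](_ : 0 + (time_rate T C D * 0 + 0) = 0); last by ring.
  apply: cvgD => //; apply: cvgD => //.
  by apply: cvgM; [exact: cvg_cst|exact: dt_cvg].
move=> j; have nN := tindex_le C (Mh j) tT.
have nN' : ((n_ j t).-1 <= NT j)%N by apply: leq_trans nN; exact: leq_pred.
have r0 := time_rate_ge0 C D T0 k; have d0 := dt0 j.
have [] // := KP (dx j) (time_rate T C D * dt_ j + (1 / 2) ^+ j) (V j (n_ j t).-1) (dx0 j).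
- by rewrite addr_ge0 ?exprn_ge0 ?divr_ge0// mulr_ge0// ltW.
- exact: (Un_mass C D (Mh j) nN').
- by move=> k'; exact: (Un_zTV C D kappa01 (Mh j) k' nN').
- by move=> k'; exact: slice_pred.
Qed.

Variables (phi : R * R -> R) (B X tau : R).
Context (tf : test_function T phi B X tau).

Definition sample j (n : nat) (i : int) : R := phi (n%:R * dt_ j, xgrid (dx j) i).

Lemma sample_cvgt t x : 0 < t ->
  (sample j (n_ j t) (i_ j x) - sample j (n_ j t).-1 (i_ j x)) / dt_ j @[j --> \oo]
    --> 'D_((1, 0) : R * R) phi (t, x).
Proof.
move=> t0; have c := tf_cvgt tf (tgrid_pred_cvg (ltW t0)) (@xgrid_cvg x) dt_cvg
  (fun j => lt0r_neq0 (dt0 j)).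
apply: cvg_trans c; apply: near_eq_cvg.
apply: filterS (tindex_gt0_near t0) => j n0.
have E : (n_ j t)%:R * dt_ j = (n_ j t).-1%:R * dt_ j + dt_ j.
  by rewrite -[X in X%:R * _ = _](prednK n0) -natr1 mulrDl mul1r.
by rewrite /sample E.
Qed.

Lemma sample_cvgx t x : 0 <= t ->
  (sample j (n_ j t) (i_ j x + 1) - sample j (n_ j t) (i_ j x)) / dx j @[j --> \oo]
    --> 'D_((0, 1) : R * R) phi (t, x).
Proof.
move=> t0; have := tf_cvgx tf (tgrid_cvg t0) (@xgrid_cvg x) dx_cvg0
  (fun j => lt0r_neq0 (dx0 j)).
apply: cvg_trans; apply: near_eq_cvg; apply: nearW => j.
have E i : xgrid (dx j) (i + 1) = xgrid (dx j) i + dx j.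
  by rewrite /xgrid intrD mulrDl mulr1z mul1r.
by rewrite /sample E.
Qed.

Lemma sample_cvg t x : 0 < t ->
  (n_ j t != 0%N)%:R * sample j (n_ j t).-1 (i_ j x) @[j --> \oo] --> phi (t, x).
Proof.
move=> t0; have := tf_cvg tf (tgrid_pred_cvg (ltW t0)) (@xgrid_cvg x).
apply: cvg_trans; apply: near_eq_cvg.
by apply: filterS (tindex_gt0_near t0) => j; rewrite lt0n => ->; rewrite mul1r.
Qed.

End PointwiseLimits.

(** * The entropy inequality in integral form on a mesh *)

Lemma Rintegral_support d (T : measurableType d) (R : realType)
    (m : {measure set T -> \bar R}) (A B : set T) (f : T -> R) : A `<=` B ->
  (forall x, B x -> ~ A x -> f x = 0) ->
  \int[m]_(x in B) f x = \int[m]_(x in A) f x.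
Proof.
move=> AB f0; rewrite Rintegral_mkcond [RHS]Rintegral_mkcond.
apply: eq_Rintegral => x _; rewrite !patchE.
have [Ax|nAx] := pselect (A x); first by rewrite !mem_set//; exact: AB.
rewrite [in RHS]memNset//; case: ifPn => // /set_mem Bx; exact: f0.
Qed.

Section EntropyLimit.
Context {R : realType} {N : nat}.
Local Notation leb := (@lebesgue_measure R).
Local Notation et := ((1, 0) : R * R).
Local Notation ex := ((0, 1) : R * R).
Variables (P : ivp R N) (sch : flux_type R) (lambda kappa T : R).
Variables (C : constants P sch lambda) (D : data P).
Context (kappa01 : 0 <= kappa <= 1) (T0 : 0 < T).
Variables (dx : nat -> R) (NT : nat -> nat) (U : 'I_N -> R -> R -> R).
Context (Mh : forall m, mesh P sch lambda kappa (dx m) T (NT m)).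
Context (dx_cvg0 : dx @ \oo --> (0 : R)) (UP : limit_of kappa T C D dx U).
Variables (phi : R * R -> R) (B X tau : R).
Context (tf : test_function T phi B X tau).
Context (phi_ge0 : forall t x, 0 <= t -> 0 <= phi (t, x)).
Variable k : 'I_N.

Local Notation V j := (Un P sch lambda kappa (dx j)).
Local Notation dt_ j := (dt lambda (dx j)).
Local Notation n_ j t := (tindex lambda (dx j) t).
Local Notation i_ j x := (xindex (dx j) x).
Local Notation p_ j := (sample lambda dx phi j).

Let dx0 j : 0 < dx j := dx_gt0 (Mh j).
Let dt0 j : 0 < dt_ j := dt_gt0 C (Mh j).
Let l0 : 0 < lambda := lam_gt0 C.
Let B0 : 0 <= B := le_trans (normr_ge0 _) (tf_le tf (0, 0)).

(** Large enough for the mesh functions to vanish beyond it on every mesh: they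
involve the test function up to two cells away, and [dx <= T / lambda]. *)
Definition radius : R := X + 2 * (T / lambda).
Definition space_box : set R := `[- radius, radius]%classic.
Definition box : set (R * R) := `]0, T[ `*` space_box.

Definition density j alpha (z : R * R) : R :=
  entropy_density P sch lambda kappa (dx j) k alpha (p_ j) (n_ j z.1) (i_ j z.2).

Definition initial_density j alpha (x : R) : R :=
  `|V j 0%N k (i_ j x) - alpha / sigma_ P (dx j) k (i_ j x)| * p_ j 0%N (i_ j x).

Definition limit_density alpha (z : R * R) : R :=
  kruzkov (flux P k) alpha (U k z.1 z.2) (sigma P k z.2) ('D_et phi z)
    (nonlocal P U k z.1 z.2) ('D_ex phi z) (derive1 (nonlocal P U k z.1) z.2) (phi z).

(** The representative of bounded variation is used because it is bounded at every
point. *)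
Definition limit_initial_density alpha (x : R) : R :=
  `|rep D k x - alpha / sigma P k x| * phi (0, x).

Let xindex_far j x : ~ space_box x -> X <= `|xgrid (dx j) (i_ j x)| /\
  X <= `|xgrid (dx j) (i_ j x + 1)|.
Proof.
move=> /=; rewrite /space_box /= in_itv/= -ler_norml => /negP; rewrite -ltNge /radius => xX.
have := xindex_near x (dx0 j); have dT := dx_le C T0 (Mh j); have d0 := dx0 j.
have -> : xgrid (dx j) (i_ j x + 1) = xgrid (dx j) (i_ j x) + dx j.
  by rewrite /xgrid intrD mulrDl mulr1z mul1r.
move: (xgrid _ _) => g h; have := ler_normD (x - g) g; rewrite subrK.
have := ler_normD (x - g - dx j) (g + dx j).
rewrite (_ : x - g - dx j + (g + dx j) = x); last by ring.
move=> h1 h2.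
have := ler_normB (x - g) (dx j); rewrite (gtr0_norm d0) => h3.
by split; lra.
Qed.

Lemma density_far j alpha t x : ~ space_box x -> density j alpha (t, x) = 0.
Proof.
move=> /(@xindex_far j x)[h1 h2]; rewrite /density /entropy_density /sample /=.
by rewrite !(tf_out tf)// !(subrr, mul0r, mulr0, addr0).
Qed.

Lemma space_box_fin : (leb space_box < +oo)%E.
Proof. by rewrite /space_box lebesgue_measure_itv /=; case: ifP => _; rewrite ltry. Qed.

Lemma measurable_space_box : measurable space_box.
Proof. exact: measurable_itv. Qed.

Lemma initial_density_meas j alpha : measurable_fun [set: R] (initial_density j alpha).
Proof.
exact: (measurable_step (fun i => `|V j 0%N k i - alpha / sigma_ P (dx j) k i| * p_ j 0%N i)).
Qed.

Lemma initial_density_le j alpha a x : `|alpha| <= a ->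
  `|initial_density j alpha x| <= (U0s D + a / sig_min C) * B.
Proof.
move=> aa; have s0 : 0 < sigma_ P (dx j) k (i_ j x) by exact: s_gt0 (dx j) C k _.
rewrite normrM normr_id; apply: ler_pM => //; last exact: tf_le tf _.
apply: le_trans (ler_normB _ _) _; apply: lerD.
  exact: (initial_le D (dx0 j)).
rewrite normrM normfV (gtr0_norm s0) ler_pM// ?invr_ge0 ?(ltW s0)//.
by rewrite lef_pV2 ?posrE ?sig_min_gt0//; exact: sig_ge.
Qed.

Lemma initial_density_far j alpha x : ~ space_box x -> initial_density j alpha x = 0.
Proof.
move=> /(@xindex_far j x)[h1 h2]; rewrite /initial_density /sample.
by rewrite !(tf_out tf)// mulr0.
Qed.

(** The last term is the cost of the diagonal values of the entropy flux. The time
step must be so small that the test function vanishes on the last time slab. *)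
Lemma entropy_meshed alpha j : dt_ j <= tau ->
  0 <= \int[leb2]_(z in QT T) density j alpha z
    + \int[leb]_(x in space_box) initial_density j alpha x
    + T * (B * (2 * visc C k * bar_TV T C D)) * dx j.
Proof.
move=> jtau; pose I := (Num.truncn (X / dx j)).+1.
have far n i : (I <= absz i)%N -> p_ j n i = 0.
  move=> Ii; apply: (tf_out tf); rewrite /xgrid normrM (gtr0_norm (dx0 j)).
  rewrite -ler_pdivrMr// -intr_norm; apply: le_trans (ltW (truncnS_gt _)) _.
  by rewrite -/I pmulrn ler_int; lia.
have p0 n i : 0 <= p_ j n i by apply: phi_ge0; rewrite mulr_ge0// ltW.
have pe i : p_ j (NT j).-1 i = 0.
  apply: (tf_end tf); have TE := NT_dt (Mh j); rewrite [leLHS](_ : _ = (NT j)%:R * dt_ j - tau).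
    case: (NT j) TE => [|n] TE /=; rewrite ?natr1.
      by move: T0; rewrite TE mul0r ltxx.
    by rewrite -natr1 mulrDl mul1r; lra.
  by rewrite -TE.
have pl n i : `|p_ j n (i + 1) - p_ j n i| <= B * dx j.
  apply: le_trans (tf_lipx tf _ _ _) _; rewrite ler_wpM2l//.
  by rewrite /xgrid intrD mulrDl mulr1z mul1r addrAC subrr add0r gtr0_norm.
have h := discrete_entropy C D kappa01 T0 (Mh j) k alpha p0 far pe pl.
apply: le_trans h _; rewrite lerD2r; apply: lerD.
  rewrite /density (grid_integral (I := I) (dx0 j) (dt0 j) (NT_dt (Mh j)))// => n i Ii.
  rewrite /entropy_density !(far _ i) ?(ltnW Ii)// (far _ (i + 1)); last by lia.
  by rewrite !(subrr, mul0r, mulr0, addr0).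
pose a (i : int) := `|V j 0%N k i - alpha / sigma_ P (dx j) k i| * p_ j 0%N i.
have a0 i : `|a i| = a i by rewrite ger0_norm// mulr_ge0.
have w := l1Z_window a (2 * I).+1 (- I%:Z).
have dxp : (0 <= (dx j)%:E)%E by rewrite lee_fin ltW.
have {w} := lee_wpmul2l dxp w; rewrite -EFinM -integral_step_l1Z//.
have -> : (\int[leb]_x `|a (xindex (dx j) x)|%:E)%E =
    (\int[leb]_(x in space_box) initial_density j alpha x)%:E.
  have mI := initial_density_meas j alpha.
  rewrite /Rintegral fineK; last first.
    apply: integrable_fin_num; first exact: measurable_space_box.
    apply: (@bounded_integrable _ _ _ (@lebesgue_measure R) space_box _ _ _
      ((U0s D + `|alpha| / sig_min C) * B)).
    - exact: measurable_space_box.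
    - exact: space_box_fin.
    - exact: measurable_funTS.
    - by move=> x _; exact: initial_density_le.
  rewrite [RHS]integral_mkcond; apply: eq_integral => x _; rewrite patchE a0.
  case: ifPn => // /negP nx; congr EFin; apply: (initial_density_far j alpha (x := x)).
  by move=> bx; apply: nx; exact/mem_set.
rewrite lee_fin; apply: le_trans.
by rewrite big_mkord; under [X in _ <= _ * X]eq_bigr do rewrite a0.
Qed.

Definition density_bound (a : R) : R :=
  kruzkov_bound (lipf C) a (sig_min C) (sig_max C) (U_sup T C D) B
    (reg C + vel1 (mass D) C).

Lemma density_le j alpha a t x : `|alpha| <= a -> 0 < t < T ->
  `|density j alpha (t, x)| <= density_bound a.
Proof.
move=> alp /andP[t0 tT].
have tT' : 0 <= t <= T by rewrite !ltW.
have nN := tindex_le C (Mh j) tT'.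
have nN' : ((n_ j t).-1 <= NT j)%N by apply: leq_trans nN; exact: leq_pred.
have d0 := dt0 j; have dd := dx0 j.
have [r0 nB _ _ _] := nu_reg C k.
have v0 := vel1_ge0 C (mass_ge0 D) k.
apply: (kruzkov_le (lipf_ge0 C) (flux_lip C k) (flux0 C k)) => //.
- exact: sig_min_gt0.
- by rewrite /sigma_ sig_ge// sig_le.
- by rewrite ger0_norm ?(Un_ge0 C D (Mh j))//; exact: (Un_le C D kappa01 (Mh j)).
- rewrite normrM normfV (gtr0_norm d0) ler_pdivrMr//.
  apply: le_trans (tf_lipt tf _ _ _) _; rewrite ler_wpM2l// -mulrBl.
  rewrite normrM (gtr0_norm d0) ler_piMl ?(ltW d0)//.
  by case: (n_ j t) => [|n] /=; rewrite ?subrr ?normr0// -natr1 [_ + 1]addrC addrK normr1.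
- rewrite normrM normfV (gtr0_norm dd) ler_pdivrMr//.
  apply: le_trans (tf_lipx tf _ _ _) _; rewrite ler_wpM2l//.
  by rewrite /xgrid intrD mulrDl mulr1z mul1r addrAC subrr add0r gtr0_norm.
- rewrite normrM ger0_norm//.
  apply: le_trans (_ : 1 * B <= B); last by rewrite mul1r.
  by apply: ler_pM => //; [case: (_ != _); rewrite ?ler01|exact: tf_le tf _].
- by apply: le_trans (nB _) _; rewrite lerDl.
- rewrite normrM normfV (gtr0_norm dd) ler_pdivrMr//.
  apply: le_trans (vel_diff1 C kappa01 dd (Un_mass C D (Mh j) nN') k _) _.
  by rewrite ler_pM2r// lerDr.
Qed.

End EntropyLimit.

(** * The entropy inequality in the limit *)

Section EntropySolution.
Context {R : realType} {N : nat}.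
Local Notation leb := (@lebesgue_measure R).
Local Notation et := ((1, 0) : R * R).
Local Notation ex := ((0, 1) : R * R).
Variables (P : ivp R N) (sch : flux_type R) (lambda kappa T : R).
Variables (C : constants P sch lambda) (D : data P).
Context (kappa01 : 0 <= kappa <= 1) (T0 : 0 < T).
Variables (dx : nat -> R) (NT : nat -> nat) (U : 'I_N -> R -> R -> R).
Context (Mh : forall m, mesh P sch lambda kappa (dx m) T (NT m)).
Context (dx_cvg0 : dx @ \oo --> (0 : R)) (UP : limit_of kappa T C D dx U).
Variables (phi : R * R -> R) (B X tau : R).
Context (tf : test_function T phi B X tau).
Context (phi_ge0 : forall t x, 0 <= t -> 0 <= phi (t, x)).
Variable k : 'I_N.

Local Notation V j := (Un P sch lambda kappa (dx j)).
Local Notation n_ j t := (tindex lambda (dx j) t).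
Local Notation i_ j x := (xindex (dx j) x).
Local Notation p_ j := (sample lambda dx phi j).
Local Notation boxT := (box lambda T X).
Local Notation boxX := (space_box lambda T X).
Local Notation dens j := (density P sch lambda kappa dx phi k j).
Local Notation ldens := (limit_density P U phi k).
Local Notation idens j := (initial_density P sch lambda kappa dx phi k j).
Local Notation lidens := (limit_initial_density D phi k).
Local Notation K := (kruzkov (flux P k)).

Let dx0 j : 0 < dx j := dx_gt0 (Mh j).
Let B0 : 0 <= B := le_trans (normr_ge0 _) (tf_le tf (0, 0)).
Let fl := flux_lip C k.
Let v0 := vel1_ge0 C (mass_ge0 D) k.

Let boxP t x : boxT (t, x) -> 0 < t < T.
Proof. by move=> [/=]; rewrite in_itv. Qed.

Let measurable_box : measurable (boxT : set (R * R)).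
Proof. by apply: measurableX; [exact: measurable_itv|exact: measurable_space_box]. Qed.

Let box_fin : (leb2 boxT < +oo)%E.
Proof.
rewrite /leb2 product_measure1E; [|exact: measurable_itv|exact: measurable_space_box].
apply: lte_mul_pinfty => //; last exact: space_box_fin.
have h : (leb (`]0%R, T[%classic : set R) < +oo)%E.
  by rewrite lebesgue_measure_itv/=; case: ifP => _; rewrite ltry.
by apply/fin_numPlt/andP; split; [apply: lt_le_trans (measure_ge0 _ _)|exact: h].
Qed.

Let U_meas : measurable_fun boxT (fun z => U k z.1 z.2).
Proof. by apply: measurable_funTS; exact: (lim_meas UP k). Qed.

Let sigma_meas : measurable_fun boxT (fun z : R * R => sigma P k z.2).
Proof.
apply: measurable_funTS; apply: (measurableT_comp _ measurable_snd).
exact: bv_le_measurable (sig_bv C k).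
Qed.

Let s0 x : 0 < sigma P k x.
Proof. exact: lt_le_trans (sig_min_gt0 C) (sig_ge C k x). Qed.

Let grid_cvg_meas (A : nat -> nat -> int -> R) (g : R * R -> R) :
  (forall t x, 0 < t < T -> A j (n_ j t) (i_ j x) @[j --> \oo] --> g (t, x)) ->
  measurable_fun boxT g.
Proof.
move=> Ag; apply: (@measurable_fun_cvg _ _ _ _ (fun j z => A j (n_ j z.1) (i_ j z.2))).
  by move=> j; apply: measurable_funTS; exact: (grid_meas C (Mh j)).
by move=> [t x] /boxP; exact: Ag.
Qed.

Let Dt_meas : measurable_fun boxT ('D_et phi).
Proof.
apply: (grid_cvg_meas (A := fun j n i => (p_ j n i - p_ j n.-1 i) / dt lambda (dx j))).
by move=> t x /andP[t0 _]; exact: (sample_cvgt C Mh dx_cvg0 tf).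
Qed.

Let Dx_meas : measurable_fun boxT ('D_ex phi).
Proof.
apply: (grid_cvg_meas (A := fun j n i => (p_ j n (i + 1) - p_ j n i) / dx j)).
by move=> t x /andP[t0 _]; exact: (sample_cvgx C Mh dx_cvg0 tf (ltW t0)).
Qed.

Let phi_meas : measurable_fun boxT phi.
Proof.
apply: (grid_cvg_meas (A := fun j n i => (n != 0%N)%:R * p_ j n.-1 i)).
by move=> t x /andP[t0 _]; exact: (sample_cvg C Mh dx_cvg0 tf).
Qed.

Let nonlocal_meas : measurable_fun boxT (fun z => nonlocal P U k z.1 z.2).
Proof.
apply: (grid_cvg_meas (A := fun j n i => vel P kappa (dx j) (V j n) k i)).
move=> t x /andP[t0 tT]; apply: (nonlocal_cvg kappa01 T0 Mh dx_cvg0 UP).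
by rewrite !ltW.
Qed.

Let dnonlocal_cvgE t x : 0 < t < T ->
  (vel P kappa (dx j) (V j (n_ j t).-1) k (i_ j x)
   - vel P kappa (dx j) (V j (n_ j t).-1) k (i_ j x - 1)) / dx j @[j --> \oo]
    --> derive1 (nonlocal P U k t) x.
Proof.
move=> /andP[t0 tT]; apply: (dnonlocal_cvg kappa01 T0 Mh dx_cvg0 UP).
by rewrite !ltW.
Qed.

Let dnonlocal_meas : measurable_fun boxT (fun z => derive1 (nonlocal P U k z.1) z.2).
Proof.
apply: (grid_cvg_meas (A := fun j n i =>
  (vel P kappa (dx j) (V j n.-1) k i - vel P kappa (dx j) (V j n.-1) k (i - 1)) / dx j)).
by move=> t x tT; exact: dnonlocal_cvgE.
Qed.

Let nonlocal_le z : `|nonlocal P U k z.1 z.2| <= reg C + vel1 (mass D) C.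
Proof.
by have [_ nB _ _ _] := nu_reg C k; apply: le_trans (nB _) _; rewrite lerDl.
Qed.

Let dnonlocal_le t x : 0 < t < T ->
  `|derive1 (nonlocal P U k t) x| <= reg C + vel1 (mass D) C.
Proof.
move=> tT; have := @dnonlocal_cvgE t x tT.
set l : R := derive1 _ _ => /cvg_norm cv.
apply: (cvgr_to_le cv); apply: nearW => j.
have tT' : 0 <= t <= T by have /andP[t0 t1] := tT; rewrite !ltW.
have nN' : ((n_ j t).-1 <= NT j)%N.
  by apply: leq_trans (tindex_le C (Mh j) tT'); exact: leq_pred.
rewrite normrM normfV (gtr0_norm (dx0 j)) ler_pdivrMr//.
apply: le_trans (vel_diff1 C kappa01 (dx0 j) (Un_mass C D (Mh j) nN') k _) _.
have [r0 _ _ _ _] := nu_reg C k.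
by rewrite ler_pM2r// lerDr.
Qed.

(* [e1], [e2], [e3] select terms of the integrand *)
Let part (e1 e2 e3 alpha : R) (z : R * R) : R :=
  K alpha (U k z.1 z.2) (sigma P k z.2) (e1 * 'D_et phi z)
    (nonlocal P U k z.1 z.2) (e2 * 'D_ex phi z)
    (derive1 (nonlocal P U k z.1) z.2) (e3 * phi z).

Let part_meas e1 e2 e3 alpha : measurable_fun boxT (part e1 e2 e3 alpha).
Proof.
apply: (kruzkov_meas fl) => //.
- by apply: measurable_funM; [exact: measurable_cst|exact: Dt_meas].
- by apply: measurable_funM; [exact: measurable_cst|exact: Dx_meas].
- by apply: measurable_funM; [exact: measurable_cst|exact: phi_meas].
Qed.

Let part_le e1 e2 e3 alpha a z : `|e1| <= 1 -> `|e2| <= 1 -> `|e3| <= 1 ->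
  `|alpha| <= a -> boxT z -> `|part e1 e2 e3 alpha z| <= density_bound T C D B a.
Proof.
move=> h1 h2 h3 aa; case: z => t x /boxP tT.
have eB (e y : R) : `|e| <= 1 -> `|y| <= B -> `|e * y| <= B.
  by move=> he hy; rewrite normrM -[B]mul1r; exact: ler_pM.
apply: (kruzkov_le (lipf_ge0 C) fl (flux0 C k)) => //.
- exact: sig_min_gt0.
- by rewrite sig_ge// sig_le.
- exact: (lim_bnd UP k t x).
- by apply: eB => //; exact: tf_Dt_le tf _.
- by apply: eB => //; exact: tf_Dx_le tf _.
- by apply: eB => //; exact: tf_le tf _.
- exact: dnonlocal_le.
Qed.

Let part_int e1 e2 e3 alpha : `|e1| <= 1 -> `|e2| <= 1 -> `|e3| <= 1 ->
  (@leb2 R).-integrable boxT (EFin \o part e1 e2 e3 alpha).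
Proof.
move=> h1 h2 h3.
apply: (@bounded_integrable _ _ _ (@leb2 R) boxT measurable_box box_fin _
  (density_bound T C D B `|alpha|)); first exact: part_meas.
by move=> z bz; exact: part_le.
Qed.

Let ldensE alpha : ldens alpha = part 1 1 1 alpha.
Proof. by apply/funext => z; rewrite /part !mul1r. Qed.

Let ldens_meas alpha : measurable_fun boxT (ldens alpha).
Proof. by rewrite ldensE. Qed.

Let ldens_le alpha a z : `|alpha| <= a -> boxT z ->
  `|ldens alpha z| <= density_bound T C D B a.
Proof. by move=> *; rewrite ldensE; apply: part_le => //; rewrite normr1. Qed.

Let ldens_int alpha : (@leb2 R).-integrable boxT (EFin \o ldens alpha).
Proof. by rewrite ldensE; apply: part_int; rewrite normr1. Qed.

Let initial_meas alpha (g : R -> R) : measurable_fun [set: R] g ->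
  measurable_fun [set: R] (fun x => `|g x - alpha / sigma P k x| * phi (0, x)).
Proof.
move=> mg; have ms := bv_le_measurable (sig_bv C k).
apply: measurable_funM.
  apply: measurableT_comp => //; apply: measurable_funB => //.
  apply: measurable_funM; first exact: measurable_cst.
  rewrite (_ : (fun x => (sigma P k x)^-1) = (fun x => expR (- ln (sigma P k x)))).
    apply: (measurableT_comp (@measurable_expR R)); apply: measurableT_comp => //.
    exact: (measurableT_comp (@measurable_ln R)).
  by apply/funext => x; rewrite expRN lnK ?posrE.
apply: continuous_measurable_fun; apply: (@lipschitz_continuous _ _ B).
exact: tf_lipx tf 0.
Qed.

Let lidens_meas alpha : measurable_fun [set: R] (lidens alpha).
Proof. by apply: initial_meas; exact: bv_le_measurable (rep_bv D k). Qed.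

Let idens_cvg alpha : {ae leb, forall x, boxX x ->
  idens j alpha x @[j --> \oo] --> lidens alpha x}.
Proof.
have h := ae_and (ae_and (initial_cvg D Mh dx_cvg0 k) (rep_ae D k))
  (bv_le_ae_continuous (sig_bv C k)).
apply: (ae_imp h) => x [[+ rx] cs] _; rewrite -rx => ci; apply: cvgM.
  apply: cvg_norm; apply: cvgB; first exact: ci.
  apply: cvgM; first exact: cvg_cst.
  by apply: cvgV; [exact: lt0r_neq0|exact: (sigma_cvg Mh dx_cvg0)].
apply: (tf_cvg tf); last exact: (xgrid_cvg Mh dx_cvg0).
by under eq_fun do rewrite mul0r; exact: cvg_cst.
Qed.

Let lidens_le alpha a x : `|alpha| <= a ->
  `|lidens alpha x| <= (U0s D + a / sig_min C) * B.
Proof.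
move=> aa; rewrite normrM normr_id; apply: ler_pM => //; last exact: tf_le tf _.
apply: le_trans (ler_normB _ _) _; apply: lerD; first exact: rep_le.
rewrite normrM normfV (gtr0_norm (s0 x)) ler_pM// ?invr_ge0 ?(ltW (s0 x))//.
by rewrite lef_pV2 ?posrE ?sig_min_gt0//; exact: sig_ge.
Qed.

(** All factors converge almost everywhere. For the sign this uses that the limit
avoids the level [alpha] almost everywhere. *)
Let entropy_good_level alpha :
  {ae (@leb2 R), forall z, boxT z -> sigma P k z.2 * U k z.1 z.2 - alpha != 0} ->
  0 <= \int[leb2]_(z in boxT) ldens alpha z + \int[leb]_(x in boxX) lidens alpha x.
Proof.
move=> good.
have c1 : \int[leb2]_(z in boxT) dens j alpha z @[j --> \oo] -->
    \int[leb2]_(z in boxT) ldens alpha z.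
  apply: (@bounded_cvg_Rintegral _ _ _ (@leb2 R) boxT measurable_box box_fin _ _
    (density_bound T C D B `|alpha|)) => //.
  - by move=> j; apply: measurable_funTS; exact: (grid_meas C (Mh j)
      (entropy_density P sch lambda kappa (dx j) k alpha (p_ j))).
  - exact: ldens_meas.
  - by move=> j [t x] /boxP tT; exact: (density_le C D kappa01 Mh tf k j x (lexx _) tT).
  have h := ae_and good (ae_and (lim_ae2 UP k) (ae_snd (bv_le_ae_continuous (sig_bv C k)))).
  apply: (ae_imp h) => -[t x] /= [g [cU cs]] bz; have tT := boxP bz.
  have /andP[t0 t1] := tT; have tT' : 0 <= t <= T by rewrite !ltW.
  apply: (kruzkov_cvg fl) => //.
  - exact: cvg_cst.
  - by apply: cU; split => //=; rewrite in_itv.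
  - exact: (sigma_cvg Mh dx_cvg0).
  - exact: lt0r_neq0.
  - exact: g.
  - exact: (sample_cvgt C Mh dx_cvg0 tf).
  - exact: (nonlocal_cvg kappa01 T0 Mh dx_cvg0 UP).
  - exact: (sample_cvgx C Mh dx_cvg0 tf (ltW t0)).
  - exact: dnonlocal_cvgE.
  - exact: (sample_cvg C Mh dx_cvg0 tf).
have c2 : \int[leb]_(x in boxX) idens j alpha x @[j --> \oo] -->
    \int[leb]_(x in boxX) lidens alpha x.
  apply: (@bounded_cvg_Rintegral _ _ _ leb boxX _ _ _ _ ((U0s D + `|alpha| / sig_min C) * B)).
  - exact: measurable_space_box.
  - exact: space_box_fin.
  - by move=> j; apply: measurable_funTS; exact: (initial_density_meas Mh).
  - by apply: measurable_funTS; exact: lidens_meas.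
  - by move=> j x _; exact: (initial_density_le C D Mh tf k j x (lexx _)).
  - exact: idens_cvg.
set E := T * (B * (2 * visc C k * bar_TV T C D)).
have c3 : E * dx j @[j --> \oo] --> (0 : R).
  by rewrite -[X in _ --> X](mulr0 E); apply: cvgM => //; exact: cvg_cst.
rewrite -[X in _ <= X]addr0; apply: (cvgr_to_ge (cvgD (cvgD c1 c2) c3)).
near=> j.
have jt : dt lambda (dx j) <= tau.
  by near: j; exact: (cvgr_le _ (dt_cvg0 lambda dx_cvg0) _ (tf_tau tf)).
have := entropy_meshed C D kappa01 T0 Mh tf phi_ge0 k alpha jt.
rewrite (@Rintegral_support _ _ _ (@leb2 R) boxT) //.
- by move=> z [z1 z2].
- by move=> [t x] [z1 z2] nb; apply: (density_far C T0 Mh tf) => bx; apply: nb.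
Unshelve. all: by end_near. Qed.

Let sigmaU_meas : measurable_fun [set: R * R] (fun z => sigma P k z.2 * U k z.1 z.2).
Proof.
apply: measurable_funM; last exact: (lim_meas UP k).
by apply: (measurableT_comp _ measurable_snd); exact: bv_le_measurable (sig_bv C k).
Qed.

Let lidens_int alpha : leb.-integrable boxX (EFin \o lidens alpha).
Proof.
apply: (@bounded_integrable _ _ _ leb boxX _ _ _ ((U0s D + `|alpha| / sig_min C) * B)).
- exact: measurable_space_box.
- exact: space_box_fin.
- by apply: measurable_funTS; exact: lidens_meas.
- by move=> x _; exact: lidens_le.
Qed.

Let entropy_near_level (x y : R) : x < y -> exists2 a, x < a < y &
  0 <= \int[leb2]_(z in boxT) ldens a z + \int[leb]_(z in boxX) lidens a z.
Proof.
move=> xy.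
have h : {ae leb, forall a, leb2 (boxT `&` [set z | sigma P k z.2 * U k z.1 z.2 = a]) = 0}.
  by apply: ae_null_level; [exact: measurable_box|exact: box_fin|exact: sigmaU_meas].
have mxy : measurable (`]x, y[%classic : set R) by exact: measurable_itv.
have lxy : (0 < leb (`]x, y[%classic : set R))%E.
  by rewrite lebesgue_measure_itv/= lte_fin xy -EFinB lte_fin subr_gt0.
have [a + a0] := ae_exists mxy lxy h.
rewrite /= in_itv/= => axy; exists a => //; apply: entropy_good_level.
exists (boxT `&` [set z | sigma P k z.2 * U k z.1 z.2 = a]); split => //.
  apply: measurableI => //.
  by have := sigmaU_meas measurableT (measurable_set1 a); rewrite setTI.
move=> z /= nz; apply: contrapT => nb; apply: nz => bz; apply/eqP => E.
by apply: nb; split => //; apply/eqP; rewrite -subr_eq0 E.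
Qed.

(** Almost every level is taken by the limit on a null set only, so [alpha] is
approached by such levels from above and from below; the sum of the two
inequalities converges to twice the inequality at [alpha], since the signs cancel
where the limit takes the value [alpha]. *)
Lemma entropy_limit alpha :
  0 <= \int[leb2]_(z in boxT) ldens alpha z + \int[leb]_(x in boxX) lidens alpha x.
Proof.
have [q [e0 e1 he]] : exists q : nat -> R,
    [/\ forall m, 0 < q m, forall m, q m <= 1 & q @ \oo --> (0 : R)].
  exists (fun m => m.+1%:R^-1); split; last exact: cvg_harmonic.
    by move=> m; rewrite invr_gt0 ltr0n.
  by move=> m; rewrite invf_le1 ?ltr0n// ler1n.
have /choice[a_ aP] : forall m : nat, exists a, alpha < a < alpha + q m /\
    0 <= \int[leb2]_(z in boxT) ldens a z + \int[leb]_(z in boxX) lidens a z.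
  move=> m; have h : alpha < alpha + q m by rewrite ltrDl.
  by have [a h1 h2] := entropy_near_level h; exists a.
have /choice[b_ bP] : forall m : nat, exists a, alpha - q m < a < alpha /\
    0 <= \int[leb2]_(z in boxT) ldens a z + \int[leb]_(z in boxX) lidens a z.
  move=> m; have h : alpha - q m < alpha by rewrite ltrBlDr ltrDl.
  by have [a h1 h2] := entropy_near_level h; exists a.
have ca : a_ @ \oo --> alpha.
  apply: (squeeze_to (K := 1) he) => m; have [/andP[h1 h2] _] := aP m.
  by rewrite mul1r ger0_norm; lra.
have cb : b_ @ \oo --> alpha.
  apply: (squeeze_to (K := 1) he) => m; have [/andP[h1 h2] _] := bP m.
  by rewrite mul1r ler0_norm; lra.
have al m : `|a_ m| <= `|alpha| + 1.
  have [/andP[h1 h2] _] := aP m; rewrite -(subrK alpha (a_ m)) addrC.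
  by apply: le_trans (ler_normD _ _) _; rewrite lerD2l ger0_norm; have := e1 m; lra.
have bl m : `|b_ m| <= `|alpha| + 1.
  have [/andP[h1 h2] _] := bP m; rewrite -(subrK alpha (b_ m)) addrC.
  by apply: le_trans (ler_normD _ _) _; rewrite lerD2l ler0_norm; have := e1 m; lra.
set DB := density_bound T C D B (`|alpha| + 1).
have c1 : \int[leb2]_(z in boxT) (ldens (a_ m) z + ldens (b_ m) z) @[m --> \oo] -->
    \int[leb2]_(z in boxT) (ldens alpha z + ldens alpha z).
  apply: (@bounded_cvg_Rintegral _ _ _ (@leb2 R) boxT measurable_box box_fin _ _ (DB + DB)).
  - by move=> m; apply: measurable_funD; exact: ldens_meas.
  - by apply: measurable_funD; exact: ldens_meas.
  - move=> m z bz; apply: le_trans (ler_normD _ _) _; apply: lerD; exact: ldens_le.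
  apply/aeW => z bz; apply: (kruzkov_average_cvg fl) => // m.
  by have [/andP[h1 h2] _] := aP m; have [/andP[h3 h4] _] := bP m; rewrite h4.
have mI b : measurable_fun boxX (lidens b).
  by apply: measurable_funTS; exact: lidens_meas.
set IB := (U0s D + (`|alpha| + 1) / sig_min C) * B.
have c2 : \int[leb]_(x in boxX) (lidens (a_ m) x + lidens (b_ m) x) @[m --> \oo] -->
    \int[leb]_(x in boxX) (lidens alpha x + lidens alpha x).
  apply: (@bounded_cvg_Rintegral _ _ _ leb boxX _ _ _ _ (IB + IB)).
  - exact: measurable_space_box.
  - exact: space_box_fin.
  - by move=> m; apply: measurable_funD; exact: mI.
  - by apply: measurable_funD; exact: mI.
  - move=> m z bz; apply: le_trans (ler_normD _ _) _; apply: lerD; exact: lidens_le.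
  have c (c_ : nat -> R) x : c_ @ \oo --> alpha -> lidens (c_ m) x @[m --> \oo] --> lidens alpha x.
    move=> cc; apply: cvgM; last exact: cvg_cst.
    apply: cvg_norm; apply: cvgB; first exact: cvg_cst.
    by apply: cvgM => //; exact: cvg_cst.
  by apply/aeW => x bx; apply: cvgD; exact: c.
have h : 0 <= \int[leb2]_(z in boxT) (ldens alpha z + ldens alpha z) +
    \int[leb]_(x in boxX) (lidens alpha x + lidens alpha x).
  apply: (cvgr_to_ge (cvgD c1 c2)); apply: nearW => m.
  suff : 0 <= \int[leb2]_(z in boxT) (ldens (a_ m) z + ldens (b_ m) z) +
    \int[leb]_(x in boxX) (lidens (a_ m) x + lidens (b_ m) x) by [].
  rewrite (@RintegralD _ _ _ (@leb2 R) boxT); [|exact: measurable_box|exact: ldens_int|exact: ldens_int].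
  rewrite (@RintegralD _ _ _ leb boxX); [|exact: measurable_space_box|exact: lidens_int|exact: lidens_int].
  by rewrite addrACA; have [_ h1] := aP m; have [_ h2] := bP m; exact: addr_ge0.
move: h; rewrite (@RintegralD _ _ _ (@leb2 R) boxT); [|exact: measurable_box|exact: ldens_int|exact: ldens_int].
rewrite (@RintegralD _ _ _ leb boxX); [|exact: measurable_space_box|exact: lidens_int|exact: lidens_int].
by move: (\int[_]_(_ in _) _) (\int[_]_(_ in _) _) => u w; lra.
Qed.

Lemma entropy_inequality alpha :
  0 <=
    \int[leb2]_(z in QT T)
      (`|U k z.1 z.2 - alpha / sigma P k z.2| * 'D_et phi z)
  + \int[leb2]_(z in QT T)
      (sg_alpha P U k alpha z * nonlocal P U k z.1 z.2
       * (flux P k (sigma P k z.2 * U k z.1 z.2) - flux P k alpha)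
       * 'D_ex phi z)
  - \int[leb2]_(z in QT T)
      (flux P k alpha * sg_alpha P U k alpha z
       * derive1 (nonlocal P U k z.1) z.2 * phi z)
  + \int[leb]_x (`|U0 P k x - alpha / sigma P k x| * phi (0, x)).
Proof.
have far x : ~ boxX x -> X <= `|x|.
  rewrite /space_box /= in_itv/= -ler_norml => /negP; rewrite -ltNge /radius.
  by have h : 0 < T / lambda := divr_gt0 T0 (lam_gt0 C); lra.
have toBox (g g' : R * R -> R) : (forall t x, X <= `|x| -> g (t, x) = 0) -> g =1 g' ->
    \int[leb2]_(z in QT T) g z = \int[leb2]_(z in boxT) g' z.
  move=> g0 gg'; rewrite (@Rintegral_support _ _ _ (@leb2 R) boxT).
  - by apply: eq_Rintegral => z _; exact: gg'.
  - by move=> z [z1 z2].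
  - by move=> [t x] [z1 z2] nb; apply: g0; apply: far => bx; apply: nb.
(* the three space-time integrals become the parts of one integral over the box *)
rewrite (toBox _ (part 1 0 0 alpha)); first last.
- by move=> z; rewrite /part /kruzkov; ring.
- by move=> t x Xx; rewrite (tf_Dt0 tf)// mulr0.
rewrite (toBox _ (part 0 1 0 alpha)); first last.
- by move=> z; rewrite /part /kruzkov /sg_alpha; ring.
- by move=> t x Xx; rewrite (tf_Dx0 tf)// mulr0.
rewrite (toBox _ (part 0 0 (- 1) alpha)); first last.
- by move=> z; rewrite /part /kruzkov /sg_alpha; ring.
- by move=> t x Xx; rewrite (tf_out tf)// mulr0.
have n0 : `|0 : R| <= 1 by rewrite normr0.
have n1 : `|1 : R| <= 1 by rewrite normr1.
have n2 : `|- 1 : R| <= 1 by rewrite normrN normr1.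
have i1 := part_int alpha n1 n0 n0; have i2 := part_int alpha n0 n1 n0.
have i3 := part_int alpha n0 n0 n2.
have i12 : (@leb2 R).-integrable boxT (EFin \o (fun z => part 1 0 0 alpha z + part 0 1 0 alpha z)).
  by have h := @integrableD _ _ _ (@leb2 R) boxT measurable_box _ _ i1 i2; exact: h.
rewrite -(@RintegralD _ _ _ (@leb2 R) boxT); [|exact: measurable_box|exact: i1|exact: i2].
rewrite -(@RintegralB _ _ _ (@leb2 R) boxT); [|exact: measurable_box|exact: i12|exact: i3].
have -> : \int[leb]_x (`|U0 P k x - alpha / sigma P k x| * phi (0, x)) =
    \int[leb]_(x in boxX) lidens alpha x.
  rewrite (@Rintegral_support _ _ _ leb boxX)//; last first.
    by move=> x _ /far Xx; rewrite (tf_out tf)// mulr0.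
  congr fine; apply: ae_eq_integral.
  - exact: measurable_space_box.
  - apply/measurable_EFinP.
    have /integrableP[/measurable_EFinP mU _] := U0_int D k.
    by apply: measurable_funTS; exact: initial_meas.
  - by apply/measurable_EFinP; apply: measurable_funTS; exact: lidens_meas.
  - by apply: (ae_imp (rep_ae D k)) => x rx _; rewrite /= /limit_initial_density rx.
have := entropy_limit alpha.
rewrite (@eq_Rintegral _ _ _ (@leb2 R) boxT (fun z => part 1 0 0 alpha z
  + part 0 1 0 alpha z - part 0 0 (- 1) alpha z))//.
by move=> z _; rewrite /limit_density /part /kruzkov; ring.
Qed.

End EntropySolution.

(** * Bounds in the supremum norm *)

Section SupEstimates.
Context {R : realType} {N : nat}.
Local Notation leb := (@lebesgue_measure R).

Lemma Loo_norms_le (g : 'I_N -> R -> R) (y : \bar R) : (0 <= y)%E ->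
  (forall k, (Loo_norm (g k) <= y)%E) -> (Loo_norms g <= y)%E.
Proof. by move=> y0 h; apply: bigmax_le. Qed.

Lemma le_Loo_norms (g : 'I_N -> R -> R) k : (Loo_norm (g k) <= Loo_norms g)%E.
Proof. exact: (le_bigmax _ (fun k => Loo_norm (g k)) k). Qed.

Lemma Loo_norms_ge0 (g : 'I_N -> R -> R) : (0 <= Loo_norms g)%E.
Proof. exact: bigmax_ge_id. Qed.

Lemma Loo_norms_fin (g : 'I_N -> R -> R) (B : R) : 0 <= B ->
  (forall k, (Loo_norm (g k) <= B%:E)%E) -> Loo_norms g \is a fin_num.
Proof.
move=> B0 h; rewrite ge0_fin_numE ?Loo_norms_ge0//.
by apply: le_lt_trans (Loo_norms_le _ h) (ltry _); rewrite lee_fin.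
Qed.

Variables (P : ivp R N) (sch : flux_type R) (lambda kappa T : R).
Variables (C : constants P sch lambda) (D : data P).
Context (N0 : (0 < N)%N) (h3 : H3 P).
Context (kappa01 : 0 <= kappa <= 1) (T0 : 0 < T).

(** The minimum is taken in the extended reals, starting from infinity; it is finite
because there is at least one component. *)
Lemma min_sigmaP : 0 < min_sigma P /\ forall k x, min_sigma P <= sigma P k x.
Proof.
have inf0 k : 0 < inf (range (sigma P k)) by have [] := h3 k.
set m := \big[mine/+oo%E]_(k < N) (inf (range (sigma P k)))%:E.
have m_le k : (m <= (inf (range (sigma P k)))%:E)%E.
  exact: (bigmin_le _ k (fun k => (inf (range (sigma P k)))%:E)).
have m0 : (0 < m)%E by apply: lt_bigmin => // k _; rewrite lte_fin.
have mfin : m \is a fin_num.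
  by rewrite ge0_fin_numE ?ltW//; apply: le_lt_trans (m_le (Ordinal N0)) (ltry _).
have E : m = (min_sigma P)%:E by rewrite /min_sigma fineK.
split; first by rewrite -lte_fin -E.
move=> k x; rewrite -lee_fin -E; apply: le_trans (m_le k) _.
by rewrite lee_fin; exact: sigma_ge_inf.
Qed.

Variables (dx : R) (NT : nat).
Context (Mh : mesh P sch lambda kappa dx T NT).

Local Notation U := (Un P sch lambda kappa dx).
Local Notation n_ t := (tindex lambda dx t).

Let dx0 : 0 < dx := dx_gt0 Mh.

Let tindex0 : n_ 0 = 0%N.
Proof. by rewrite /tindex mul0r truncn0. Qed.

Let bar_le_growth (M0 : R) t k i : 0 <= M0 ->
  (forall k i, bar P dx (U 0%N) k i <= M0) -> 0 <= t <= T ->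
  bar P dx (U (n_ t)) k i <= expR (growth C D * t) * M0.
Proof.
move=> M00 hM tT; have nN := tindex_le C Mh tT.
apply: le_trans (Un_sup C D kappa01 Mh M00 (hM k) nN i) _.
apply: ler_wpM2r => //; rewrite ler_expR ler_wpM2l ?(growth_ge0 C D k)//.
by have /andP[t0 _] := tT; have /andP[] := tindex_itv C Mh t0.
Qed.

Let bar_ge0n k i t : 0 <= t <= T -> 0 <= bar P dx (U (n_ t)) k i.
Proof.
move=> tT; have nN := tindex_le C Mh tT.
by apply: (bar_ge0 dx C) => k' i'; exact: (Un_ge0 C D Mh).
Qed.

Let T_ge0 : 0 <= (0 : R) <= T. Proof. by rewrite lexx ltW. Qed.

Lemma Ubardelta_Loo t : 0 < t <= T ->
  (Loo_norms (fun k => Ubardelta P sch lambda kappa dx k t)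
    <= (expR (growth C D * t))%:E
       * Loo_norms (fun k => Ubardelta P sch lambda kappa dx k (0 : R)%R))%E.
Proof.
move=> /andP[t0 tT]; have tT' : 0 <= t <= T by rewrite ltW.
set S := Loo_norms (fun k => Ubardelta P sch lambda kappa dx k (0 : R)).
have Sfin : S \is a fin_num.
  apply: (@Loo_norms_fin _ (sig_max C * U0s D)).
    by rewrite mulr_ge0 ?U0s_ge0// (sig_max_ge0 C (Ordinal N0)).
  move=> k; apply/(Loo_norm_step _ _ dx0) => i; rewrite lee_fin tindex0.
  rewrite ger0_norm; first exact: (bar0_le C D Mh).
  by rewrite -tindex0; exact: bar_ge0n.
have S0 : (0 <= S)%E := Loo_norms_ge0 _.
rewrite -(fineK Sfin) -EFinM; apply: Loo_norms_le.
  by rewrite lee_fin mulr_ge0 ?expR_ge0// fine_ge0.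
move=> k; apply/(Loo_norm_step _ _ dx0) => i; rewrite lee_fin.
rewrite ger0_norm ?bar_ge0n//; apply: bar_le_growth => // [|k' i']; first exact: fine_ge0.
rewrite -lee_fin fineK//; apply: le_trans (le_Loo_norms _ k').
rewrite -[X in (X%:E <= _)%E]ger0_norm; last by rewrite -tindex0; exact: bar_ge0n.
by move: i'; apply/(Loo_norm_step (bar P dx (U 0%N) k') _ dx0); rewrite -{1}tindex0.
Qed.

(** The division by [sigma] is paid once, at time [t]; at time zero [sigma] is bounded
by its norm and the averages by the norm of the data. *)
Lemma Udelta_Loo t : 0 < t <= T ->
  (Loo_norms (fun k => Udelta P sch lambda kappa dx k t)
    <= Loo_norms (sigma P) * ((min_sigma P)^-1)%:E
       * (expR (growth C D * t))%:E * Loo_norms (U0 P))%E.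
Proof.
move=> /andP[t0 tT]; have tT' : 0 <= t <= T by rewrite ltW.
have [m0 mle] := min_sigmaP.
have Gfin : Loo_norms (sigma P) \is a fin_num.
  apply: (@Loo_norms_fin _ (sig_max C)); first exact: (sig_max_ge0 C (Ordinal N0)).
  move=> k; apply/Loo_normP; apply/aeW => x; rewrite lee_fin ger0_norm ?sig_le//.
  by apply: le_trans (mle k x); exact: ltW.
have Ufin : Loo_norms (U0 P) \is a fin_num.
  apply: (@Loo_norms_fin _ (U0s D)); first exact: U0s_ge0.
  move=> k; apply/Loo_normP; apply: (ae_imp (rep_ae D k)) => x <-.
  by rewrite lee_fin; exact: rep_le.
have G0 : 0 <= fine (Loo_norms (sigma P)) by rewrite fine_ge0// Loo_norms_ge0.
have S0 : 0 <= fine (Loo_norms (U0 P)) by rewrite fine_ge0// Loo_norms_ge0.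
have im0 : 0 <= (min_sigma P)^-1 by rewrite invr_ge0 ltW.
rewrite -(fineK Gfin) -(fineK Ufin) -!EFinM; apply: Loo_norms_le.
  by rewrite lee_fin !mulr_ge0// expR_ge0.
move=> k; apply/(Loo_norm_step _ _ dx0) => i; rewrite lee_fin.
rewrite ger0_norm; last by apply: (Un_ge0 C D Mh); exact: (tindex_le C Mh).
rewrite -(bar_div dx C (U (n_ t)) k i).
have -> : forall a b c d : R, a * b * c * d = (c * (a * d)) * b by move=> *; ring.
apply: ler_pM; [exact: bar_ge0n|by rewrite invr_ge0 ltW// (s_gt0 dx C)| |].
  apply: bar_le_growth => // [|k' i']; first exact: mulr_ge0.
  have sp := s_gt0 dx C k' i'.
  rewrite /bar; apply: ler_pM; [exact: ltW| |  |].
  - exact: (initial_ge0 D dx0).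
  - apply: le_trans (sigma_le_norm h3 k' _) _; rewrite /sigma_norm.
    apply: fine_le; [exact: bv_le_Loo_norm_fin (sig_bv C k')|exact: Gfin|].
    exact: le_Loo_norms.
  - apply: le_trans (ler_norm _) _; rewrite -lee_fin fineK//.
    by apply: le_trans (initial_le_ess D dx0 k' i') _; exact: le_Loo_norms.
by rewrite lef_pV2 ?posrE ?(s_gt0 dx C)//; exact: mle.
Qed.

End SupEstimates.

Theorem theorem3p2 (R : realType) (N : nat) (T : R) (P : ivp R N)
    (sch : flux_type R) (lambda kappa : R)
    (HN : (0 < N)%N) (HT : 0 < T)
    (hyp1 : H1 P) (hyp2 : H2 P) (hyp3 : H3 P) (hypU0 : nonneg_initial_data P)
    (Hlambda : 0 < lambda) (Hkappa : 0 <= kappa <= 1)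
    (Hcfl : CFL P sch lambda) :
  exists K3 K4 K5 K6 : R,
    (forall (dx : R) (NT : nat), mesh P sch lambda kappa dx T NT ->
       let U := Un P sch lambda kappa dx in
       let UD := Udelta P sch lambda kappa dx in
       let UbarD := Ubardelta P sch lambda kappa dx in
       let tn (n : nat) := n%:R * dt lambda dx in
       [/\ (* positivity *)
           forall k t x, 0 < t <= T -> 0 <= UD k t x,
           (* L^1 estimate *)
           forall t, 0 < t <= T ->
             L1_norms (fun k => UD k t) = L1_norms (U0 P),
           (* L^oo estimates *)
           forall t, 0 < t <= T ->
             (Loo_norms (fun k => UbarD k t)
                <= (expR (K3 * t))%:E * Loo_norms (fun k => UbarD k (0 : R)%R))%E /\
             (Loo_norms (fun k => UD k t)
                <= Loo_norms (sigma P) * ((min_sigma P)^-1)%:E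
                   * (expR (K3 * t))%:E * Loo_norms (U0 P))%E &
           [/\ (* BV estimate *)
               forall (n : nat) k, (n <= NT)%N ->
                 (zTV (bar P dx (U n) k)
                    <= (expR (K4 * tn n))%:E
                       * (zTV (bar P dx (U 0%N) k) + (K5 * tn n)%:E))%E,
               (* time estimate *)
               forall (n : nat) k, (n < NT)%N ->
                 (dx%:E * l1Z (fun i => U n.+1 k i - U n k i)%R
                    <= (K6 * dt lambda dx)%:E)%E &
               (* discrete entropy inequality *)
               forall (n : nat) (i : int) k (alpha : R), (n < NT)%N ->
                 let G := entropy_flux P sch lambda kappa dx (U n) k in
                 let a := alpha / sigma_ P dx k i in
                 `|U n.+1 k i - a| - `|U n k i - a|
                 + lambda * (G i (U n k i) (U n k (i + 1)) alpha
                             - G (i - 1) (U n k (i - 1)) (U n k i) alpha)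
                 + lambda * Num.sg (U n.+1 k i - a) * flux P k alpha
                   * (vel P kappa dx (U n) k i - vel P kappa dx (U n) k (i - 1))
                 <= 0]])
    /\
    (* convergence of a subsequence to an entropy solution *)
    (forall (dx : nat -> R) (NT : nat -> nat),
       (forall m, mesh P sch lambda kappa (dx m) T (NT m)) ->
       dx m @[m --> \oo] --> (0 : R) ->
       exists (s : nat -> nat) (U : 'I_N -> R -> R -> R),
         [/\ forall m n, (m < n)%N -> (s m < s n)%N,
             entropy_solution P T U,
             forall k (K : set (R * R)), compact K -> K `<=` QTbar T ->
               (\int[leb2]_(z in K)
                  `|Udelta P sch lambda kappa (dx (s m)) k z.1 z.2
                    - U k z.1 z.2|%:E)%E @[m --> \oo] --> 0%E &
             forall k, {ae leb2, forall z, QTbar T z ->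
               Udelta P sch lambda kappa (dx (s m)) k z.1 z.2 @[m --> \oo]
                 --> U k z.1 z.2}]).
Proof.
have [C] := exists_constants HN hyp1 hyp2 hyp3 Hlambda Hcfl.
have [D] := exists_data hypU0.
(* one rate governs both the supremum and the variation *)
exists (growth C D), (growth C D), (source T C D), (time_rate T C D); split.
  move=> dx NT Mh U UD UbarD tn; have dx0 := dx_gt0 Mh; split.
  - by move=> k t x /andP[t0 tT]; apply: (Udelta_ge0 C D Mh); rewrite ltW.
  - move=> t /andP[t0 tT]; apply: eq_bigr => k _; rewrite [LHS]/L1_norm Lnorm1.
    by apply: (Udelta_mass C D Mh); rewrite ltW.
  - move=> t tT; split; first exact: (Ubardelta_Loo C D HN Hkappa HT Mh tT).
    exact: (Udelta_Loo C D HN hyp3 Hkappa Mh tT).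
  split=> [n k nN|n k nN|n i k alpha nN].
  - have Vfin : zTV (bar P dx (U 0%N) k) \is a fin_num.
      exact: l1Z_fin (Un_TV_le C D Hkappa Mh k (leq0n NT)).
    rewrite -(fineK Vfin) -EFinD -EFinM.
    apply: (Un_TV C D Hkappa Mh) => //; first by rewrite fineK.
    by rewrite fine_ge0// l1Z_ge0.
  - have h := Un_time C D Hkappa HT Mh k nN.
    apply: (@le_trans _ _ (dx%:E * (lambda * time_rate T C D)%:E)%E).
      by apply: lee_wpmul2l; [rewrite lee_fin ltW|exact: h].
    rewrite -EFinM lee_fin /dt (_ : dx * _ = time_rate T C D * (lambda * dx))//.
    by ring.
  - exact: (step_entropy C (fun k' i' bm b bp bm' b' bp' => Un_mono Mh k' i' nN)).
move=> dx NT Mh dx0.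
have [s [U [s_incr UP]]] := exists_limit C D Hkappa HT HN Mh dx0.
have Mhs m : mesh P sch lambda kappa ((dx \o s) m) T ((NT \o s) m) by exact: Mh.
have dxs0 : (dx \o s) @ \oo --> (0 : R).
  have s_ge m : (m <= s m)%N.
    by elim: m => // m IH; apply: leq_ltn_trans IH _; exact: s_incr.
  apply: (cvg_comp _ _ _ dx0) => A [M _ MA]; exists M => // m /= Mm.
  by apply: MA; exact: leq_trans Mm (s_ge m).
exists s, U; split => //.
- split; first exact: (limit_solution_space Hkappa HT Mhs dxs0 UP).
  move=> k alpha phi sm cs phi_ge0.
  have [B [X [tau tf]]] := exists_test_function sm cs.
  exact: (entropy_inequality Hkappa HT Mhs dxs0 UP tf phi_ge0).
- by move=> k K _ KQ; exact: (limit_compact HT Mhs UP k KQ).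
- exact: (lim_ae2 UP).
Qed.
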